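(* Let $\lambda,\mu>0$, $k\ge1$ an integer and $\nu\in(0,1)$. The service times of a $\nu$-fractional $M/E_k/1$ queue (with arrival rate $\lambda$, $k$ phases and phase rate $k\mu$) are i.i.d. generalized Erlang random variables with fractional index $\nu$, shape parameter $k$ and rate $k\mu$.
   Context: Classical queue: let $\mathcal{S}^*=\{(n,s): n\ge 1,\ 1\le s\le k\}$ ($n,s$ integers) and $\mathcal{S}=\mathcal{S}^*\cup\{(0,0)\}$. The state-phase process $Q(t)=(N(t),S(t))$ of the classical $M/E_k/1$ queue ($N$ = number of customers in the system, $S$ = phase of the customer currently being served, $S=0$ if $N=0$) is the continuous-time Markov chain on $\mathcal{S}$ with transition rates: $(0,0)\to(1,k)$ at rate $\lambda$; $(n,s)\to(n+1,s)$ at rate $\lambda$ for $(n,s)\in\mathcal{S}^*$ (arrivals); $(n,s)\to(n,s-1)$ at rate $k\mu$ for $s\ge2$; $(n,1)\to(n-1,k)$ at rate $k\mu$ for $n\ge2$; $(1,1)\to(0,0)$ at rate $k\mu$ (phase completions). Fractional queue: let $\{\sigma_\nu(t)\}_{t\ge0}$ be a $\nu$-stable subordinator independent of $Q$, with $\mathbb{E}[e^{-v\sigma_\nu(t)}]=e^{-tv^\nu}$ for $v>0$, and let $L_\nu(t)=\inf\{s\ge0:\sigma_\nu(s)>t\}$. The $\nu$-fractional $M/E_k/1$ queue has state-phase process $Q^\nu(t)=(N^\nu(t),S^\nu(t)):=Q(L_\nu(t))$. The service time of a customer is the time from the beginning of its first service phase (phase $k$) to the completion of its last one (phase $1$), i.e.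 the sum of the durations of its $k$ consecutive service phases. A generalized Erlang random variable $T$ with fractional index $\nu$, shape parameter $k$ and rate $\theta>0$, denoted $T\sim GE_\nu(k,\theta)$, has distribution function $$F_T(t)=1-\sum_{n=0}^{k-1}\frac{(\theta t^\nu)^n}{n!}E_\nu^{(n)}(-\theta t^\nu),\qquad t\ge0,$$ where $E_\nu(z)=\sum_{j=0}^{+\infty}\frac{z^j}{\Gamma(\nu j+1)}$ and $E_\nu^{(n)}$ is its $n$-th derivative. Equivalently, $T$ has the law of the sum of $k$ i.i.d. random variables with distribution function $1-E_\nu(-\theta t^\nu)$, $t\ge 0$. *)

(* Defs.v *)
From HB Require Import structures.
From mathcomp Require Import all_boot all_order all_algebra.
From mathcomp Require Import all_classical all_reals all_analysis.
Set Implicit Arguments.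
Unset Strict Implicit.
Unset Printing Implicit Defensive.
Import Order.TTheory GRing.Theory Num.Theory.
Import numFieldNormedType.Exports.
Local Open Scope classical_set_scope.
Local Open Scope ring_scope.

(** * Independence *)

Definition mutually_independent d (Omega : measurableType d) (R : realType)
    (P : probability Omega R) (I : choiceType) (X : I -> Omega -> R) : Prop :=
  forall (s : seq I) (A : I -> set R), uniq s -> (forall i, measurable (A i)) ->
    P (\big[setI/setT]_(i <- s) (X i @^-1` A i)) =
    (\prod_(i <- s) P (X i @^-1` A i))%E.

(* Processes are families indexed by R, of which only the times t >= 0
   matter. *)
Definition process_events d (Omega : measurableType d) (R : realType) d'
    (E : measurableType d') (X : R -> Omega -> E) : set (set Omega) :=
  <<s [set A | exists t (B : set E),
        [/\ 0 <= t, measurable B & A = X t @^-1` B] ] >>.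

Definition independent_processes d (Omega : measurableType d) (R : realType)
    (P : probability Omega R) d1 (E1 : measurableType d1)
    d2 (E2 : measurableType d2)
    (X : R -> Omega -> E1) (Y : R -> Omega -> E2) : Prop :=
  forall A B, process_events X A -> process_events Y B ->
    P (A `&` B) = (P A * P B)%E.

(** * Continuous-time Markov chains *)

Definition exit_rate (R : realType) (E : choiceType) (q : E -> E -> R) (x : E)
    : R :=
  fine (\esum_(y in [set: E]) (q x y)%:E).

(* [is_ctmc P S q X]: X is a (non-explosive, right-continuous) continuous-time
   Markov chain on the countable set S with transition rates q x y (x <> y),
   in the jump chain / holding times sense: Y is the sequence of visited
   states, H the sequence of sojourn times, Y is a discrete-time Markov chain
   with transition probabilities q x y / exit_rate q x and, conditionally on Y,
   the H i are independent exponential variables of rates exit_rate q (Y i).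
   The initial law, carried by S, is arbitrary. The exit rates on S are assumed
   to be finite and positive (no absorbing state). *)
Definition is_ctmc d (Omega : measurableType d) (R : realType)
    (P : probability Omega R) d' (E : measurableType d')
    (S : set E) (q : E -> E -> R) (X : R -> Omega -> E) : Prop :=
  (forall t, 0 <= t -> measurable_fun setT (X t)) /\
  exists (Y : nat -> Omega -> E) (H : nat -> Omega -> R),
    let J n w := \sum_(i < n) H i w in
    [/\ forall n, measurable_fun setT (Y n),
        forall n, measurable_fun setT (H n),
        {ae P, forall w,
          [/\ forall t, 0 <= t -> S (X t w),
              forall n, 0 < H n w,
              J n w @[n --> \oo] --> +oo &
              forall n t, J n w <= t < J n.+1 w -> X t w = Y n w]} &
        forall n (y : nat -> E) (t : nat -> R), (forall i, 0 <= t i) ->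
          P [set w | forall i, (i <= n)%N -> Y i w = y i /\ t i < H i w] =
          (P [set w | Y 0%N w = y 0%N] *
           (\prod_(i < n) (q (y i) (y i.+1) / exit_rate q (y i)) *
            \prod_(i < n.+1) expR (- (exit_rate q (y i) * t i)))%:E)%E].

(** * The classical M/E_k/1 queue *)

Definition busy_state (k : nat) (x : nat * nat) : bool :=
  [&& 1 <= x.1, 1 <= x.2 & x.2 <= k]%N.

Definition queue_state (k : nat) : set (nat * nat) :=
  [set x | busy_state k x \/ x = (0%N, 0%N)].

Definition queue_rate (R : realType) (lambda mu : R) (k : nat)
    (x y : nat * nat) : R :=
  let: (n, s) := x in
  if (x == (0, 0)%N) && (y == (1%N, k)) then lambda
  else if busy_state k x && (y == (n.+1, s)) then lambda
  else if [&& busy_state k x, (2 <= s)%N & y == (n, s.-1)] then k%:R * mu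
  else if [&& (2 <= n)%N, s == 1%N & y == (n.-1, k)] then k%:R * mu
  else if (x == (1, 1)%N) && (y == (0, 0)%N) then k%:R * mu
  else 0.

Definition is_erlang_queue d (Omega : measurableType d) (R : realType)
    (P : probability Omega R) (lambda mu : R) (k : nat)
    (Q : R -> Omega -> nat * nat) : Prop :=
  is_ctmc P (queue_state k) (queue_rate lambda mu k) Q.

(** * Stable subordinators and the fractional queue *)

Definition is_stable_subordinator d (Omega : measurableType d) (R : realType)
    (P : probability Omega R) (nu : R) (sigma : R -> Omega -> R) : Prop :=
  [/\ forall t, 0 <= t -> measurable_fun setT (sigma t),
      {ae P, forall w,
        [/\ sigma 0 w = 0,
            forall s t, 0 <= s -> s <= t -> sigma s w <= sigma t w &
            forall t, 0 <= t -> sigma u w @[u --> t^'+] --> sigma t w]},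
      forall t : nat -> R, 0 <= t 0%N -> (forall n, t n <= t n.+1) ->
        mutually_independent P (fun n w => sigma (t n.+1) w - sigma (t n) w),
      forall s t (A : set R), 0 <= s -> 0 <= t -> measurable A ->
        P [set w | A (sigma (s + t) w - sigma s w)] = P (sigma t @^-1` A) &
      forall t v, 0 <= t -> 0 < v ->
        ('E_P[fun w => expR (- (v * sigma t w))] =
         (expR (- (t * v `^ nu)))%:E)%E].

Definition inverse_process (Omega : Type) (R : realType)
    (sigma : R -> Omega -> R) (t : R) (w : Omega) : R :=
  inf [set s | 0 <= s /\ t < sigma s w].

Definition fractional_queue (Omega : Type) (R : realType)
    (Q : R -> Omega -> nat * nat) (sigma : R -> Omega -> R)
    (t : R) (w : Omega) : nat * nat :=
  Q (inverse_process sigma t w) w.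

(** * Service times along a trajectory x of the state-phase process *)

Definition jumps (R : realType) (x : R -> nat * nat) (t : R) (a b : nat * nat)
    : Prop :=
  [/\ 0 < t, \forall u \near t^'-, x u = a & x t = b].

(* A customer's first phase begins when an arrival finds the system empty, or
   when the preceding customer leaves. Observation starts at time 0, so a
   customer found in phase k at that time begins its service then; one found
   in a phase < k has only a residual service, which is not counted. *)
Definition service_begins (R : realType) (k : nat) (x : R -> nat * nat) (t : R)
    : Prop :=
  [\/ [/\ t = 0, (1 <= (x 0%R).1)%N & (x 0).2 = k],
      jumps x t (0, 0)%N (1%N, k) |
      exists2 n, (2 <= n)%N & jumps x t (n, 1%N) (n.-1, k)].

Definition service_ends (R : realType) (k : nat) (x : R -> nat * nat) (t : R)
    : Prop :=
  jumps x t (1, 1)%N (0, 0)%N \/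
  exists2 n, (2 <= n)%N & jumps x t (n, 1%N) (n.-1, k).

(* T is the sequence of service times of x: B enumerates in increasing order
   the instants at which a service begins, and the m-th service ends at
   B m + T m. *)
Definition are_service_times (R : realType) (k : nat) (x : R -> nat * nat)
    (T : nat -> R) : Prop :=
  exists B : nat -> R,
    [/\ forall m, B m < B m.+1,
        forall t, service_begins k x t <-> exists m, t = B m &
        forall m,
          [/\ 0 < T m, service_ends k x (B m + T m) &
              forall u, B m < u < B m + T m -> ~ service_ends k x u]].

(** * Generalized Erlang distributions *)

Definition Gamma (R : realType) (x : R) : R :=
  \int[lebesgue_measure]_(u in `]0, +oo[) (u `^ (x - 1) * expR (- u)).

Definition mittag_leffler (R : realType) (nu z : R) : R :=
  limn (series (fun j : nat => z ^+ j / Gamma (nu * j%:R + 1))).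

Definition GE_cdf (R : realType) (nu : R) (k : nat) (theta t : R) : R :=
  let z := theta * t `^ nu in
  1 - \sum_(n < k) z ^+ n / n`!%:R * derive1n n (mittag_leffler nu) (- z).

Definition is_GE d (Omega : measurableType d) (R : realType)
    (P : probability Omega R) (nu : R) (k : nat) (theta : R)
    (X : {RV P >-> R}) : Prop :=
  forall t, 0 <= t -> cdf X t = (GE_cdf nu k theta t)%:E.

(* Main.v *)
(* Let Y be the jump chain of Q, J_n its jump times and A_n = sigma(J_n -), the
   left limit. Since L_nu(t) lies in [J_n, J_(n+1)) exactly when t lies in
   [A_n, A_(n+1)), the fractional queue has the jump chain Y and the jump times
   A_n. Approximating A_n by values of sigma on a grid and using that sigma is
   independent of Q, one gets for every history y
     E[1{Y = y} exp(- sum_i b_i (A_(i+1) - A_i))]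
       = E[1{Y = y} exp(- sum_i b_i^nu (J_(i+1) - J_i))]
       = P(Y_0 = y_0) prod_i q(y_i, y_(i+1)) / (q(y_i) + b_i^nu).
   With theta = k mu, discount the time spent in the m-th service at rate v_m
   and let each phase still to be served in it count for a factor
   theta / (theta + v_m^nu): this product is a martingale, and its limit gives
     E exp(- sum_m v_m T_m) = prod_m (theta / (theta + v_m^nu))^k.
   Uniqueness of Laplace transforms yields both independence and the law of T_m,
   as the right-hand side factors are the transforms of the GE law. *)
From HB Require Import structures.
Require Import Defs.
From mathcomp Require Import all_boot all_order all_algebra.
From mathcomp Require Import all_classical all_reals all_analysis.
From mathcomp Require Import measurable_realfun ring lra zify.
Set Implicit Arguments.
Unset Strict Implicit.
Unset Printing Implicit Defensive.
Import Order.TTheory GRing.Theory Num.Theory.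
Import numFieldNormedType.Exports.
Local Open Scope classical_set_scope.
Local Open Scope ring_scope.

(** * Laws and Laplace transforms *)

(** Why left limits: [s <= L_nu(t)] holds if and only if [sigma(s-) <= t], even when [sigma] jumps
    at [s], so the description of the time change is exact path by path. The main obstacle is
    independence. It speaks of the events of [Q], whereas the jump chain and the holding times are
    only given to exist; their events must first be recovered, up to null sets, from the values of
    [Q] at rational times, which works because consecutive states differ. On a grid the jump times
    have countably many positions, and on each of them [sigma] is evaluated at deterministic times.
    An arrival changes neither the phases ahead nor the discount rate. This is why [lambda] and the
    initial law disappear from the limit of the martingale. Uniqueness is reduced to moments:
    [exp(-X)] lies in the unit interval and its [n]-th moment is the transform of [X] at [n].
    Knowing a transform at integers, possibly shifted by a constant, is thus enough. The shift
    matters for the GE law, whose series is integrated term by term at large rates. *)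

Lemma measurable_natr_bool d (T : measurableType d) (R : realType) (b : T -> bool) :
  measurable_fun setT b -> measurable_fun setT (fun x => (b x)%:R : R).
Proof.
move=> mb; rewrite (_ : (fun x => _) = \1_[set x | b x]).
  apply: measurable_indic; have := mb measurableT [set true] I; rewrite setTI.
  by congr measurable; apply/seteqP; split => x /=.
by apply/funext => x; rewrite indicE; congr (_%:R); rewrite /in_mem/= /in_set/= asboolb.
Qed.

Lemma measurable_expRNM d (T : measurableType d) (R : realType) (a : R) (X : T -> R) :
  measurable_fun setT X -> measurable_fun setT (fun x => expR (- (a * X x))).
Proof.
move=> mX; apply: measurableT_comp => //; apply: measurableT_comp => //.
exact: measurable_funM.
Qed.

Lemma integral_setb d (T : measurableType d) (R : realType)
    (m : {measure set T -> \bar R}) (b : T -> bool) (f : T -> R) :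
  (\int[m]_(x in [set x | b x]) (f x)%:E = \int[m]_x ((b x)%:R * f x)%:E)%E.
Proof.
rewrite integral_mkcond; apply: eq_integral => x _; rewrite patchE.
rewrite /in_mem/= /in_set/= asboolb.
by case: (b x); rewrite ?mul1r ?mul0r.
Qed.

(** The law of [X] under the measure of density [W]. When [W] gathers the factors of all other
    coordinates, an equation between weighted laws lets one coordinate be treated separately from
    the rest. *)
Definition weighted_law d (T : measurableType d) (R : realType) d'
    (E : measurableType d') (m : {measure set T -> \bar R}) (W : T -> R)
    (X : T -> E) (A : set E) : \bar R :=
  (\int[m]_(x in X @^-1` A) (W x)%:E)%E.

Section weighted_law_theory.
Local Open Scope ereal_scope.
Context d (T : measurableType d) (R : realType) d' (E : measurableType d').
Variables (m : {measure set T -> \bar R}) (W : T -> R) (X : T -> E).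
Hypotheses (mW : measurable_fun setT W) (W0 : forall x, (0 <= W x)%R).
Hypothesis mX : measurable_fun setT X.

Lemma measurable_preimageT (A : set E) : measurable A -> measurable (X @^-1` A).
Proof. by move=> mA; rewrite -[X in measurable X]setTI; exact: mX. Qed.

Lemma weighted_law_measure :
  exists mu : {measure set E -> \bar R}, mu = weighted_law m W X :> (_ -> _).
Proof.
pose mu := weighted_law m W X.
have mu0 : mu set0 = 0 by rewrite /mu /weighted_law preimage_set0 integral_set0.
have mu_ge0 A : 0 <= mu A by apply: integral_ge0 => x _; rewrite lee_fin.
have muS : semi_sigma_additive mu.
  move=> F mF tF mUF; rewrite /mu /weighted_law preimage_bigcup.
  rewrite ge0_integral_bigcup//=.
  - apply: is_cvg_nneseries => n _ _; exact: mu_ge0.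
  - by move=> k; exact: measurable_preimageT.
  - by apply/measurable_EFinP; exact: measurable_funTS.
  - by move=> x _; rewrite lee_fin.
  - apply/trivIsetP => i j _ _ ij; rewrite -preimage_setI.
    by move/trivIsetP : tF => ->//; rewrite preimage_set0.
pose mix := isMeasure.Build _ _ _ mu mu0 mu_ge0 muS.
pose m' : {measure set E -> \bar R} := HB.pack mu mix.
by exists m'.
Qed.

Import HBNNSimple.

(** The approximations [g n] live on [E], so the right-hand side depends on [m], [W] and [X] through
    [weighted_law] alone. Equal weighted laws therefore give equal integrals, even across different
    spaces. *)
Lemma weighted_law_integralE (f : E -> R) (mf : measurable_fun setT f)
    (f0 : forall x, (0 <= f x)%R) :
  let g := nnsfun_approx measurableT (proj2 (measurable_EFinP setT f) mf) in
  \int[m]_x (f (X x) * W x)%:E =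
  limn (fun n => \sum_(k \in range (g n))
                  (k%:E * weighted_law m W X (g n @^-1` [set k]))).
Proof.
move=> g.
have mgX n : measurable_fun setT (fun x => g n (X x)).
  by apply: measurableT_comp => //; exact: measurable_funP.
transitivity (limn (fun n => \int[m]_x (g n (X x) * W x)%:E)).
  rewrite -monotone_convergence//.
  - apply: eq_integral => x _; apply/esym/cvg_lim => //.
    rewrite EFinM; under eq_fun do rewrite EFinM.
    apply: cvgeZr => //.
    by apply: cvg_nnsfun_approx=> // y _; rewrite lee_fin.
  - by move=> n; apply/measurable_EFinP/measurable_funM.
  - by move=> n x _; rewrite lee_fin mulr_ge0.
  - move=> x _ p q pq; rewrite lee_fin ler_wpM2r//.
    exact/lefP/nd_nnsfun_approx.
congr (limn _); apply/funext => n.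
have mpre k : measurable (X @^-1` (g n @^-1` [set k])).
  by apply: measurable_preimageT.
transitivity (\int[m]_x (\sum_(k \in range (g n))
    (k * (\1_(X @^-1` (g n @^-1` [set k])) x * W x))%:E)).
  apply: eq_integral => x _; rewrite [in LHS]fimfunE fsbig_finite// [in RHS]fsbig_finite//=.
  rewrite mulr_suml sumEFin; congr EFin.
  by apply: eq_bigr => k _; rewrite mulrA.
rewrite ge0_integral_fsum//.
- apply: eq_fsbigr => k /set_mem [y _ gk].
  have k0 : (0 <= k)%R by rewrite -gk.
  under eq_integral do rewrite EFinM.
  rewrite ge0_integralZl_EFin//=.
  + congr (_ * _); rewrite /weighted_law [RHS]integral_mkcond.
    apply: eq_integral => x _; rewrite patchE indicE.
    by case: ifPn => _; rewrite ?mul1r ?mul0r.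
  + by move=> x _; rewrite lee_fin mulr_ge0.
  + by apply/measurable_EFinP/measurable_funM => //; exact: measurable_indic.
- move=> k; apply/measurable_EFinP/measurable_funM => //.
  by apply: measurable_funM => //; exact: measurable_indic.
- move=> k x _; rewrite indicE; case: (boolP (_ \in _)) => [|_].
    by rewrite inE/= => <-; rewrite mul1r lee_fin mulr_ge0.
  by rewrite mul0r mulr0.
Qed.

End weighted_law_theory.

Section weighted_law_transfer.
Import HBNNSimple.

Lemma weighted_law_integral_eq (R : realType) d' (E : measurableType d')
    d1 (T1 : measurableType d1) (m1 : {measure set T1 -> \bar R})
    (W1 : T1 -> R) (X1 : T1 -> E)
    d2 (T2 : measurableType d2) (m2 : {measure set T2 -> \bar R})
    (W2 : T2 -> R) (X2 : T2 -> E) (f : E -> R) :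
  measurable_fun setT W1 -> (forall x, 0 <= W1 x) -> measurable_fun setT X1 ->
  measurable_fun setT W2 -> (forall x, 0 <= W2 x) -> measurable_fun setT X2 ->
  measurable_fun setT f -> (forall x, 0 <= f x) ->
  (forall A, measurable A ->
    weighted_law m1 W1 X1 A = weighted_law m2 W2 X2 A) ->
  (\int[m1]_x (f (X1 x) * W1 x)%:E = \int[m2]_x (f (X2 x) * W2 x)%:E)%E.
Proof.
move=> mW1 W10 mX1 mW2 W20 mX2 mf f0 E12.
rewrite (weighted_law_integralE m1 mW1 W10 mX1 mf f0).
rewrite (weighted_law_integralE m2 mW2 W20 mX2 mf f0).
congr (limn _); apply/funext => n; apply: eq_fsbigr => k _.
by rewrite E12.
Qed.

End weighted_law_transfer.

(* The expectation of [g] at a binomial variable of parameters [n] and [y]. *)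
Fixpoint bernstein (R : realType) (n : nat) (g : nat -> R) (y : R) : R :=
  if n is m.+1 then
    y * bernstein m (fun i => g i.+1) y + (1 - y) * bernstein m g y
  else g 0%N.

Section bernstein_theory.
Variable R : realType.
Implicit Types (g h : nat -> R) (n : nat) (y c a : R).

Lemma le_bernstein n g h y : 0 <= y <= 1 -> (forall i, (i <= n)%N -> g i <= h i) ->
  bernstein n g y <= bernstein n h y.
Proof.
move=> /andP[y0 y1]; elim: n g h => [|n IH] g h gh /=; first exact: gh.
apply: lerD; apply: ler_wpM2l; rewrite ?subr_ge0//; apply: IH => i iln; apply: gh => //.
exact: leqW.
Qed.

Lemma bernsteinD n g h y :
  bernstein n (fun i => g i + h i) y = bernstein n g y + bernstein n h y.
Proof. elim: n g h => [//|n IH] g h /=; rewrite !IH; ring. Qed.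

Lemma bernsteinZ n g a y : bernstein n (fun i => a * g i) y = a * bernstein n g y.
Proof. elim: n g => [//|n IH] g /=; rewrite !IH; ring. Qed.

Lemma bernstein_cst n c y : bernstein n (fun=> c) y = c.
Proof. elim: n => [//|n IH] /=; rewrite !IH; ring. Qed.

(** The arbitrary centre makes the induction go: a success moves it from [c] to [c - 1]. At
    [c = n y] only the variance is left. *)
Lemma bernstein_variance n c y :
  bernstein n (fun i => (i%:R - c) ^+ 2) y = n%:R * (y * (1 - y)) + (n%:R * y - c) ^+ 2.
Proof.
elim: n c => [|n IH] c /=; first by rewrite !mul0r !add0r.
have -> : (fun i : nat => (i.+1%:R - c) ^+ 2) = (fun i : nat => (i%:R - (c - 1)) ^+ 2).
  by apply/funext => i; rewrite -natr1; congr (_ ^+ 2); ring.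
rewrite !IH -[n.+1%:R]natr1; ring.
Qed.

Lemma bernstein_ge0 n g y : 0 <= y <= 1 -> (forall i, 0 <= g i) ->
  0 <= bernstein n g y.
Proof.
move=> y01 g0; rewrite -(bernstein_cst n 0 y).
by apply: le_bernstein => // i _.
Qed.

Lemma bernstein_lipschitz n (f : R -> R) (L e y : R) : 0 <= y <= 1 -> 0 <= L -> 0 < e ->
  (forall a b, `|f a - f b| <= L * `|a - b|) ->
  `|bernstein n.+1 (fun i => f (i%:R / n.+1%:R)) y - f y| <= L * (e + (n.+1%:R * e)^-1).
Proof.
move=> y01 L0 e0 fL.
(* Majorant of Chebyshev type: [|u| <= e + u ^ 2 / e], from [(|u| - e) ^ 2 >= 0], bounds the
   deviation by a second moment and leaves [e] free. *)
pose q i : R := e + (i%:R - n.+1%:R * y) ^+ 2 / (n.+1%:R ^+ 2 * e).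
have fq i : `|f (i%:R / n.+1%:R) - f y| <= L * q i.
  apply: (le_trans (fL _ _)); apply: ler_wpM2l => //.
  set u : R := i%:R / n.+1%:R - y.
  have -> : q i = e + u ^+ 2 / e.
    rewrite /q /u; congr (_ + _).
    by field; rewrite (gt_eqF e0)/= addrC natr1 gt_eqF.
  have : 0 <= (`|u| - e) ^+ 2 / e by rewrite divr_ge0 ?sqr_ge0// ltW.
  have -> : (`|u| - e) ^+ 2 / e = u ^+ 2 / e + e - 2 * `|u|.
    rewrite sqrrB real_normK ?num_real//.
    by field; rewrite gt_eqF.
  have := normr_ge0 u; lra.
have Eq : bernstein n.+1 q y = e + (y * (1 - y)) / (n.+1%:R * e).
  have -> : q = (fun i => (fun=> e) i +
      (fun i : nat => (n.+1%:R ^+ 2 * e)^-1 * (i%:R - n.+1%:R * y) ^+ 2) i).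
    by apply/funext => i; rewrite /q mulrC (mulrC (_^-1)).
  rewrite bernsteinD bernstein_cst bernsteinZ bernstein_variance subrr expr0n addr0.
  congr (_ + _); field.
  by rewrite (gt_eqF e0)/= addrC natr1 gt_eqF.
have qle : L * bernstein n.+1 q y <= L * (e + (n.+1%:R * e)^-1).
  apply: ler_wpM2l => //; rewrite Eq lerD2l ler_piMl//.
    by rewrite invr_ge0 mulr_ge0// ltW.
  by case/andP: y01 => *; nra.
apply: le_trans qle; rewrite -bernsteinZ ler_norml; apply/andP; split.
  rewrite lerBrDl -(bernstein_cst n.+1 (f y) y) -mulN1r -bernsteinZ -bernsteinD.
  apply: le_bernstein => // i _.
  by have := fq i; rewrite ler_norml => /andP[]; lra.
rewrite lerBlDl -[f y in leRHS](bernstein_cst n.+1 (f y) y) -bernsteinD.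
apply: le_bernstein => // i _.
by have := fq i; rewrite ler_norml => /andP[]; lra.
Qed.

Lemma cvg_bernstein (f : R -> R) (L y : R) : 0 <= y <= 1 -> 0 <= L ->
  (forall a b, `|f a - f b| <= L * `|a - b|) ->
  bernstein n.+1 (fun i => f (i%:R / n.+1%:R)) y @[n --> \oo] --> f y.
Proof.
move=> y01 L0 fL; apply/cvgrPdist_le => e e0.
(* Once [1 / n.+1 <= d * d], the bound of [bernstein_lipschitz] at [d] is at most [2 * L * d <= e];
   [L + 1] keeps the denominator positive. *)
pose d := e / (2 * (L + 1)).
have L1 : 0 < 2 * (L + 1) by rewrite mulr_gt0// ltr_wpDl.
have d0 : 0 < d by rewrite divr_gt0.
have /cvgrPdist_le/(_ _ (mulr_gt0 d0 d0)) := @cvg_harmonic R.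
apply: filterS => n /=; rewrite sub0r normrN /harmonic ger0_norm// => nd.
rewrite distrC; apply: (le_trans (bernstein_lipschitz n y01 L0 d0 fL)).
have : (n.+1%:R * d)^-1 <= d.
  by rewrite invfM ler_pdivrMr.
have : d * (2 * (L + 1)) = e by rewrite /d divfK// gt_eqF.
move=> E1 E2; apply: (le_trans (ler_wpM2l L0 (lerD (lexx d) E2))).
rewrite -E1; clearbody d; nra.
Qed.

Lemma measurable_bernstein n g : measurable_fun setT (bernstein n g).
Proof.
elim: n g => [|n IH] g /=; first exact: measurable_cst.
apply: measurable_funD; apply: measurable_funM => //.
by apply: measurable_funB.
Qed.

End bernstein_theory.

Lemma EFin_add_inj (R : realType) (x y a b : \bar R) : (a < +oo)%E -> (0 <= a)%E ->
  a = b -> (x + a = y + b)%E -> x = y.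
Proof.
move=> ay a0 <-; have afin : a \is a fin_num by rewrite ge0_fin_numE.
by move=> /(congr1 (fun z => z - a)%E); rewrite !addeK.
Qed.

Lemma clamp_lipschitz (R : realType) (u v : R) :
  `|Num.min 1 (Num.max 0 u) - Num.min 1 (Num.max 0 v)| <= `|u - v|.
Proof.
have := ler_norm (u - v); have := ler_norm (v - u); rewrite (distrC v u).
set w : R := `|u - v|; clearbody w => vw uw; rewrite ler_norml !minEle !maxEle.
by case: (lerP 0 u) => ?; case: (lerP 0 v) => ?;
  repeat (case: ifPn; rewrite -?ltNge => ?); lra.
Qed.

(** * Laws on the unit interval are determined by their moments *)

Section moments.
Context (R : realType) d1 (T1 : measurableType d1) (m1 : {measure set T1 -> \bar R})
  d2 (T2 : measurableType d2) (m2 : {measure set T2 -> \bar R}).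
Variables (W1 : T1 -> R) (Y1 : T1 -> R) (W2 : T2 -> R) (Y2 : T2 -> R).
Hypotheses (mW1 : measurable_fun setT W1) (mW2 : measurable_fun setT W2)
  (mY1 : measurable_fun setT Y1) (mY2 : measurable_fun setT Y2).
Hypotheses (W10 : forall x, 0 <= W1 x) (W20 : forall x, 0 <= W2 x).
Hypotheses (Y101 : forall x, 0 <= Y1 x <= 1) (Y201 : forall x, 0 <= Y2 x <= 1).
Hypotheses (W1oo : (\int[m1]_x (W1 x)%:E < +oo)%E)
  (W2oo : (\int[m2]_x (W2 x)%:E < +oo)%E).

(** The class of such [f] is enlarged step by step: monomials, Bernstein polynomials, Lipschitz
    functions, indicators of half-lines. Functions that are nonnegative on the unit interval can be
    added without integrability conditions. *)
Let eqI (f : R -> R) :=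
  (\int[m1]_x (f (Y1 x) * W1 x)%:E = \int[m2]_x (f (Y2 x) * W2 x)%:E)%E.
Let ok (f : R -> R) := measurable_fun setT f /\ forall y, 0 <= y <= 1 -> 0 <= f y.

Let ok_meas1 f : ok f -> measurable_fun setT (fun x => (f (Y1 x) * W1 x)%:E).
Proof.
by move=> [mf _]; apply/measurable_EFinP/measurable_funM => //; apply: measurableT_comp.
Qed.
Let ok_meas2 f : ok f -> measurable_fun setT (fun x => (f (Y2 x) * W2 x)%:E).
Proof.
by move=> [mf _]; apply/measurable_EFinP/measurable_funM => //; apply: measurableT_comp.
Qed.
Let ok_ge1 f x : ok f -> (0 <= (f (Y1 x) * W1 x)%:E)%E.
Proof. by move=> [_ f0]; rewrite lee_fin mulr_ge0// f0. Qed.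
Let ok_ge2 f x : ok f -> (0 <= (f (Y2 x) * W2 x)%:E)%E.
Proof. by move=> [_ f0]; rewrite lee_fin mulr_ge0// f0. Qed.

Let integralDE1 f g : ok f -> ok g ->
  (\int[m1]_x ((f (Y1 x) + g (Y1 x)) * W1 x)%:E =
  \int[m1]_x (f (Y1 x) * W1 x)%:E + \int[m1]_x (g (Y1 x) * W1 x)%:E)%E.
Proof.
move=> okf okg; rewrite -ge0_integralD//; [|by move=> x _; exact: ok_ge1|exact: ok_meas1
  |by move=> x _; exact: ok_ge1|exact: ok_meas1].
by apply: eq_integral => x _; rewrite mulrDl EFinD.
Qed.
Let integralDE2 f g : ok f -> ok g ->
  (\int[m2]_x ((f (Y2 x) + g (Y2 x)) * W2 x)%:E =
  \int[m2]_x (f (Y2 x) * W2 x)%:E + \int[m2]_x (g (Y2 x) * W2 x)%:E)%E.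
Proof.
move=> okf okg; rewrite -ge0_integralD//; [|by move=> x _; exact: ok_ge2|exact: ok_meas2
  |by move=> x _; exact: ok_ge2|exact: ok_meas2].
by apply: eq_integral => x _; rewrite mulrDl EFinD.
Qed.

Let eqID f g : ok f -> ok g -> eqI f -> eqI g -> eqI (fun y => f y + g y).
Proof. by move=> okf okg E1 E2; rewrite /eqI integralDE1// integralDE2// E1 E2. Qed.

Let eqIB f g : ok f -> ok g -> (forall y, 0 <= y <= 1 -> g y <= 1) ->
  eqI (fun y => f y + g y) -> eqI g -> eqI f.
Proof.
move=> okf okg g1; rewrite /eqI integralDE1// integralDE2// => E1 E2.
apply: EFin_add_inj E2 E1.
  apply: le_lt_trans W1oo; apply: ge0_le_integral => //.
  - by move=> x _; exact: ok_ge1.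
  - exact: ok_meas1.
  - by apply/measurable_EFinP.
  - by move=> x _; rewrite lee_fin ler_piMl// g1.
by apply: integral_ge0 => x _; exact: ok_ge1.
Qed.

Let eqIZ f c : 0 <= c -> ok f -> eqI f -> eqI (fun y => c * f y).
Proof.
move=> c0 okf; rewrite /eqI => E.
under eq_integral do rewrite -mulrA EFinM.
rewrite ge0_integralZl_EFin//; [|by move=> x _; exact: ok_ge1|exact: ok_meas1].
under [RHS]eq_integral do rewrite -mulrA EFinM.
rewrite ge0_integralZl_EFin//; [|by move=> x _; exact: ok_ge2|exact: ok_meas2].
by rewrite E.
Qed.

Let eqI_lim (f_ : nat -> R -> R) f : (forall n, ok (f_ n)) ->
  (forall n y, 0 <= y <= 1 -> f_ n y <= 1) ->
  (forall y, 0 <= y <= 1 -> f_ n y @[n --> \oo] --> f y) ->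
  (forall n, eqI (f_ n)) -> eqI f.
Proof.
move=> okf f1 cf E.
have H d (T : measurableType d) (m : {measure set T -> \bar R}) (W Y : T -> R) :
    measurable_fun setT W -> measurable_fun setT Y -> (forall x, 0 <= W x) ->
    (forall x, 0 <= Y x <= 1) -> (\int[m]_x (W x)%:E < +oo)%E ->
    ((\int[m]_x (f_ n (Y x) * W x)%:E @[n --> \oo] --> \int[m]_x (f (Y x) * W x)%:E)%E).
  move=> mW mY W0 Y01 Woo.
  apply: (@dominated_cvg _ _ _ m setT measurableT _ _ (EFin \o W)) => //.
  - move=> n; apply/measurable_EFinP/measurable_funM => //.
    by apply: measurableT_comp => //; case: (okf n).
  - move=> x _; apply: cvg_EFin; first by near=> n.
    by apply: cvgMr_tmp; apply: cf.
  - apply/integrableP; split; first exact/measurable_EFinP.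
    by under eq_integral do rewrite /= ger0_norm//.
  - move=> n x _; rewrite /= lee_fin normrM (ger0_norm (W0 x)).
    rewrite ger0_norm ?ler_piMl ?f1//.
    by case: (okf n) => _; apply.
have := H _ _ m1 W1 Y1 mW1 mY1 W10 Y101 W1oo.
rewrite (_ : (fun n => _) = (fun n => \int[m2]_x (f_ n (Y2 x) * W2 x)%:E)%E); last first.
  by apply/funext => n; exact: E.
move=> H1; have H2 := H _ _ m2 W2 Y2 mW2 mY2 W20 Y201 W2oo.
exact: (cvg_unique _ H1 H2).
Unshelve. all: by end_near. Qed.

Hypothesis moments : forall n,
  (\int[m1]_x (Y1 x ^+ n * W1 x)%:E = \int[m2]_x (Y2 x ^+ n * W2 x)%:E)%E.

Let okmono a b : ok (fun y => y ^+ a * (1 - y) ^+ b).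
Proof.
split.
  apply: measurable_funM; first exact: measurable_funX.
  by apply: measurable_funX; apply: measurable_funB.
by move=> y /andP[y0 y1]; rewrite mulr_ge0 ?exprn_ge0 ?subr_ge0.
Qed.

(** The powers of [1 - y] are introduced by cancellation: the functions for [(a, b.+1)] and
    [(a.+1, b)] add up to the one for [(a, b)]. *)
Let eqI_mono a b : eqI (fun y => y ^+ a * (1 - y) ^+ b).
Proof.
elim: b a => [|b IH] a.
  by have := moments a; rewrite /eqI; under eq_integral do rewrite -[_ ^+ a]mulr1;
    under [RHS]eq_integral do rewrite -[_ ^+ a]mulr1.
apply: (@eqIB (fun y => y ^+ a * (1 - y) ^+ b.+1) _ (okmono _ _) (okmono a.+1 b) _ _ (IH a.+1)).
  move=> y /andP[y0 y1]; rewrite mulr_ile1 ?exprn_ge0 ?subr_ge0//.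
    by rewrite exprn_ile1.
  by rewrite exprn_ile1 ?subr_ge0// gerBl.
rewrite (_ : (fun y => _) = (fun y => y ^+ a * (1 - y) ^+ b))//.
by apply/funext => y; rewrite !exprS; ring.
Qed.

Let okbern n g a b : (forall i, 0 <= g i) ->
  ok (fun y => bernstein n g y * (y ^+ a * (1 - y) ^+ b)).
Proof.
move=> g0; have [mm m0] := okmono a b; split.
  by apply: measurable_funM => //; exact: measurable_bernstein.
by move=> y y01; rewrite mulr_ge0 ?m0 ?bernstein_ge0.
Qed.

(** The monomial is carried along so that each step of the recursion of [bernstein] can push its
    factor [y] or [1 - y] into it. *)
Let eqI_bern n g a b : (forall i, 0 <= g i) ->
  eqI (fun y => bernstein n g y * (y ^+ a * (1 - y) ^+ b)).
Proof.
elim: n g a b => [|n IH] g a b g0 /=.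
  exact: (@eqIZ (fun y => y ^+ a * (1 - y) ^+ b) _ (g0 0%N) (okmono a b) (eqI_mono a b)).
rewrite (_ : (fun y => _) = (fun y => (bernstein n (fun i => g i.+1) y * (y ^+ a.+1 * (1 - y) ^+ b))
   + (bernstein n g y * (y ^+ a * (1 - y) ^+ b.+1)))); last first.
  by apply/funext => y; rewrite !exprS; ring.
by apply: eqID; [exact: okbern|exact: okbern|exact: IH|exact: IH].
Qed.

Lemma moments_lipschitz (f : R -> R) L : 0 <= L ->
  (forall a b, `|f a - f b| <= L * `|a - b|) -> (forall y, 0 <= f y <= 1) ->
  (\int[m1]_x (f (Y1 x) * W1 x)%:E = \int[m2]_x (f (Y2 x) * W2 x)%:E)%E.
Proof.
move=> L0 fL f01.
have f0 y : 0 <= f y by case/andP: (f01 y).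
apply: (@eqI_lim (fun n y => bernstein n.+1 (fun i => f (i%:R / n.+1%:R)) y)).
- by move=> n; split; [exact: measurable_bernstein|move=> y y01; exact: bernstein_ge0].
- move=> n y y01; rewrite -[leRHS](bernstein_cst n.+1 1 y).
  by apply: le_bernstein => // i _; case/andP: (f01 (i%:R / n.+1%:R)).
- by move=> y y01; apply: (cvg_bernstein y01 L0 fL).
- move=> n; have := @eqI_bern n.+1 (fun i => f (i%:R / n.+1%:R)) 0 0 (fun=> f0 _).
  rewrite (_ : (fun y => _) = bernstein n.+1 (fun i => f (i%:R / n.+1%:R)))//.
  by apply/funext => y; rewrite !expr0 !mulr1.
Qed.

Lemma moments_le c :
  (\int[m1]_(x in [set x | (Y1 x <= c)%R]) (W1 x)%:E =
   \int[m2]_(x in [set x | (Y2 x <= c)%R]) (W2 x)%:E)%E.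
Proof.
(* Ramps that equal 1 up to [c] and 0 from [c + 1 / n] on; they are [n]-Lipschitz and converge to
   the indicator of [y <= c]. *)
pose f (n : nat) (y : R) : R := Num.min 1 (Num.max 0 (1 + n%:R * (c - y))).
have f01 n y : 0 <= f n y <= 1.
  by rewrite /f le_min ler01 le_max lexx/= ge_min lexx.
have : eqI (fun y => (y <= c)%R%:R).
  apply: (@eqI_lim f).
  - move=> n; split; last by move=> y _; case/andP : (f01 n y).
    apply: measurable_minr => //; apply: measurable_maxr => //.
    by apply: measurable_funD => //; apply: measurable_funM => //; apply: measurable_funB.
  - by move=> n y _; case/andP: (f01 n y).
  - move=> y _; case: (leP y c) => yc /=.
      apply: cvg_near_cst; apply: nearW => n; apply/eqP.
      rewrite /f; have : 0 <= n%:R * (c - y) by rewrite mulr_ge0// subr_ge0.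
      by move=> h; rewrite max_r ?min_l//; lra.
    have yc' : 0 < y - c by rewrite subr_gt0.
    apply: cvg_near_cst; near=> n; apply/eqP; rewrite /f.
    have : (y - c)^-1 <= n%:R by near: n; exact: nbhs_infty_ger.
    rewrite -(ler_pM2r yc') mulVf ?lt0r_neq0// => nb.
    have : 1 + n%:R * (c - y) <= 0 by rewrite -opprB mulrN subr_le0.
    by move=> h; rewrite max_l// min_r.
  - move=> n; apply: (@moments_lipschitz _ n%:R) => // a b.
    have -> : n%:R * `|a - b| = `|(1 + n%:R * (c - a)) - (1 + n%:R * (c - b))|.
      rewrite distrC -[in LHS](ger0_norm (ler0n R n)) -normrM; congr (`| _ |); ring.
    exact: clamp_lipschitz.
by rewrite /eqI => E; rewrite !integral_setb.
Unshelve. all: by end_near. Qed.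

End moments.

Section laplace_uniqueness.
Context (R : realType) d1 (T1 : measurableType d1) (m1 : {measure set T1 -> \bar R})
  d2 (T2 : measurableType d2) (m2 : {measure set T2 -> \bar R}).
Variables (W1 : T1 -> R) (X1 : T1 -> R) (W2 : T2 -> R) (X2 : T2 -> R).
Hypotheses (mW1 : measurable_fun setT W1) (mW2 : measurable_fun setT W2)
  (mX1 : measurable_fun setT X1) (mX2 : measurable_fun setT X2).
Hypotheses (W10 : forall x, 0 <= W1 x) (W20 : forall x, 0 <= W2 x).
Hypotheses (X10 : forall x, 0 <= X1 x) (X20 : forall x, 0 <= X2 x).
Hypotheses (W1oo : (\int[m1]_x (W1 x)%:E < +oo)%E)
  (W2oo : (\int[m2]_x (W2 x)%:E < +oo)%E).
Hypothesis laplace : forall n : nat,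
  (\int[m1]_x (expR (- (n%:R * X1 x)) * W1 x)%:E =
   \int[m2]_x (expR (- (n%:R * X2 x)) * W2 x)%:E)%E.

(** The [n]-th moment of [exp (- X)], a variable in the unit interval, is the transform at [n], so
    integers suffice. The sets [exp (- X) <= exp (- c)] are the half-lines [X >= c], which generate
    the Borel sets. *)
Lemma laplace_unique (A : set R) : measurable A ->
  weighted_law m1 W1 X1 A = weighted_law m2 W2 X2 A.
Proof.
have [mu1 mu1E] := weighted_law_measure m1 mW1 W10 mX1.
have [mu2 mu2E] := weighted_law_measure m2 mW2 W20 mX2.
rewrite -mu1E -mu2E => mA.
have rays c : mu1 `[c, +oo[%classic = mu2 `[c, +oo[%classic.
  rewrite mu1E mu2E /weighted_law.
  have rayE T (X : T -> R) : X @^-1` `[c, +oo[%classic = [set x | expR (- X x) <= expR (- c)].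
    by apply/seteqP; split => x /=; rewrite in_itv/= andbT ler_expR lerN2.
  rewrite !rayE; apply: (@moments_le _ _ _ m1 _ _ m2 W1 (fun x => expR (- X1 x)) W2 (fun x => expR (- X2 x))) => //.
  - by apply: measurableT_comp => //; apply: measurableT_comp.
  - by apply: measurableT_comp => //; apply: measurableT_comp.
  - by move=> x; rewrite expR_ge0/= -expR0 ler_expR oppr_le0.
  - by move=> x; rewrite expR_ge0/= -expR0 ler_expR oppr_le0.
  - move=> n; have := laplace n.
    under eq_integral do rewrite -mulrN expRM_natl.
    by under [X in _ = X -> _]eq_integral do rewrite -mulrN expRM_natl.
apply: (measure_unique (@RGenCInfty.G R) (fun k => `[- k%:R, +oo[%classic)) => //.
- exact: RGenCInfty.measurableE.
- move=> _ _ [x ->] [y ->]; exists (Num.max x y).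
  by apply/seteqP; split => z /=; rewrite !in_itv/= !andbT ge_max => /andP.
- by move=> k; exists (- k%:R).
- apply/seteqP; split => // x _; have [n _ xn] := nbhs_infty_ger (- x).
  by exists n => //=; rewrite in_itv/= andbT lerNl; apply: xn => /=.
- by move=> _ [x ->].
- move=> k; rewrite mu1E; apply: le_lt_trans W1oo.
  apply: ge0_subset_integral => //.
  + exact: measurable_preimageT.
  + by apply/measurable_EFinP.
  + by move=> x _; rewrite lee_fin.
Qed.

End laplace_uniqueness.

Section laplace_tail.
Context (R : realType) d (T : measurableType d)
  (m : {sigma_finite_measure set T -> \bar R}) (W X : T -> R).
Hypotheses (mW : measurable_fun setT W) (mX : measurable_fun setT X).
Hypotheses (W0 : forall x, 0 <= W x) (X0 : forall x, 0 <= X x).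

Lemma integral_exponential_pdf_lt (a x : R) : 0 < a -> 0 <= x ->
  (\int[lebesgue_measure]_t (exponential_pdf a t * (t < x)%R%:R)%:E =
   (1 - expR (- (a * x)))%:E)%E.
Proof.
move=> a0; rewrite le_eqVlt => /predU1P[<-|x0].
  rewrite mulr0 oppr0 expR0 subrr; apply: integral0_eq => t _.
  case: ltP => t0; last by rewrite mulr0.
  by rewrite lt0_exponential_pdf// mul0r.
have := exponential_prob_itv0c a x0; rewrite mulNr -EFinB => <-.
rewrite /exponential_prob -integral_itv_bndo_bndc; last first.
  apply/measurable_EFinP; apply: measurable_funTS; exact: measurable_exponential_pdf.
have -> : `[0, x[%classic = [set t : R | 0 <= t < x].
  by apply/seteqP; split => t /=; rewrite in_itv.
rewrite integral_setb; apply: eq_integral => t _.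
have [t0|t0] := leP 0 t; last by rewrite lt0_exponential_pdf// mul0r mulr0.
by rewrite mulrC.
Qed.

(** Tonelli, with [1 - exp (- a X)] seen as the integral of the exponential density over [t < X].
    This is the passage from tails to Laplace transforms. *)
Lemma integral_tail_exponential (a : R) : 0 < a ->
  (\int[lebesgue_measure]_t ((exponential_pdf a t)%:E *
      \int[m]_(x in [set x | (t < X x)%R]) (W x)%:E) =
   \int[m]_x ((1 - expR (- (a * X x))) * W x)%:E)%E.
Proof.
move=> a0.
have e0 t : 0 <= exponential_pdf a t by apply: exponential_pdf_ge0; exact: ltW.
pose f (tx : measurableTypeR R * T) : \bar R :=
  (exponential_pdf a tx.1 * ((tx.1 < X tx.2)%R%:R * W tx.2))%:E.
have f0 tx : (0 <= f tx)%E by rewrite lee_fin !mulr_ge0.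
have mf : measurable_fun setT f.
  apply/measurable_EFinP; apply: measurable_funM.
    apply: measurableT_comp => //; exact: measurable_exponential_pdf.
  apply: measurable_funM; last by apply: measurableT_comp.
  by apply: measurable_natr_bool; apply: measurable_fun_ltr => //; apply: measurableT_comp.
transitivity (\int[lebesgue_measure]_t \int[m]_x f (t, x))%E.
  apply: eq_integral => t _.
  rewrite integral_setb -ge0_integralZl_EFin//.
  - by move=> x _; rewrite lee_fin mulr_ge0.
  - apply/measurable_EFinP/measurable_funM => //.
    by apply: measurable_natr_bool; apply: measurable_fun_ltr.
rewrite (fubini_tonelli f mf f0).
apply: eq_integral => x _; rewrite /f/=.
under eq_integral do rewrite mulrA mulrC EFinM.
rewrite ge0_integralZl_EFin//; first by rewrite integral_exponential_pdf_lt// -EFinM mulrC.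
  by move=> t _; rewrite lee_fin mulr_ge0.
apply/measurable_EFinP/measurable_funM; first exact: measurable_exponential_pdf.
by apply: measurable_natr_bool; apply: measurable_fun_ltr.
Qed.

Lemma laplace_of_exponential_tail (C r a : R) : 0 <= C -> 0 < r -> 0 <= a ->
  (\int[m]_x (W x)%:E = C%:E)%E ->
  (forall t, 0 <= t ->
    (\int[m]_(x in [set x | (t < X x)%R]) (W x)%:E = (C * expR (- (r * t)))%:E)%E) ->
  (\int[m]_x (expR (- (a * X x)) * W x)%:E = (C * (r / (r + a)))%:E)%E.
Proof.
move=> C0 r0; rewrite le_eqVlt => /predU1P[<-|a0] WC tailC.
  rewrite addr0 divff ?gt_eqF// mulr1 -WC; apply: eq_integral => x _.
  by rewrite mul0r oppr0 expR0 mul1r.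
have ra : 0 < r + a by rewrite addr_gt0.
(* What the transform lacks to reach the total mass [C]: against the tail [C exp (- r t)], the
   density [a exp (- a t)] becomes [a / (r + a)] times the exponential density of rate [r + a]. *)
have tE : (\int[m]_x ((1 - expR (- (a * X x))) * W x)%:E = (C * (a / (r + a)))%:E)%E.
  rewrite -integral_tail_exponential//.
  transitivity (\int[lebesgue_measure]_t ((C * (a / (r + a)))%:E * (exponential_pdf (r + a) t)%:E))%E.
    apply: eq_integral => t _; have [t0|t0] := leP 0 t; last first.
      by rewrite !lt0_exponential_pdf// mul0e mule0.
    rewrite tailC// !exponential_pdfE// -!EFinM; congr EFin.
    have -> : - (r + a) * t = - a * t + - (r * t) by ring.
    by rewrite expRD; field; rewrite gt_eqF.
  rewrite ge0_integralZl_EFin//; last 3 first.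
    by move=> t _; rewrite lee_fin exponential_pdf_ge0// ltW.
    apply/measurable_EFinP; exact: measurable_exponential_pdf.
    by rewrite !mulr_ge0// ?invr_ge0 ltW.
  by rewrite integral_exponential_pdf// mule1.
apply: (EFin_add_inj _ _ tE).
- by rewrite tE ltry.
- by rewrite tE lee_fin !mulr_ge0// ?invr_ge0 ltW.
- rewrite -EFinD -mulrDr -mulrDl divff ?gt_eqF// mulr1 -WC -ge0_integralD//.
  + by apply: eq_integral => x _; rewrite -EFinD -mulrDl addrC subrK mul1r.
  + by move=> x _; rewrite lee_fin mulr_ge0.
  + by apply/measurable_EFinP/measurable_funM => //; exact: measurable_expRNM.
  + by move=> x _; rewrite lee_fin mulr_ge0// subr_ge0 -expR0 ler_expR oppr_le0 mulr_ge0// ltW.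
  + by apply/measurable_EFinP/measurable_funM => //; apply: measurable_funB => //; exact: measurable_expRNM.
Qed.

End laplace_tail.

(** * The generalized Erlang law *)

Section gamma.
Variable R : realType.
Notation leb := (@lebesgue_measure R).
Implicit Types a v M : R.

Lemma continuous_powR_gt0 a x : 0 < x -> {for x, continuous (fun u : R => u `^ a)}.
Proof.
move=> x0; apply: differentiable_continuous; apply/derivable1_diffP.
by apply: derivable_powR; rewrite in_itv/= x0.
Qed.

Lemma cvg_powR_at_right a x : 0 <= a -> 0 <= x -> u `^ a @[u --> x^'+] --> x `^ a.
Proof.
rewrite le_eqVlt => /predU1P[<- _|a0].
  by rewrite powRr0; under eq_fun do rewrite powRr0; exact: cvg_cst.
rewrite le_eqVlt => /predU1P[<-|x0]; first by rewrite powR0 ?gt_eqF//; exact: powR_cvg0.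
by apply: cvg_at_right_filter; exact: continuous_powR_gt0.
Qed.

Lemma measurable_powR_expR a v : measurable_fun setT (fun u : R => u `^ a * expR (- (v * u))).
Proof. by apply: measurable_funM; [exact: measurable_powR|exact: measurable_expRNM]. Qed.

Lemma integral_exponential_itv v : 0 < v ->
  (\int[leb]_(u in `[0%R, +oo[) (v * expR (- (v * u)))%:E = 1)%E.
Proof.
move=> v0; rewrite -(integral_exponential_pdf v0) [RHS](_ : _ =
  \int[leb]_x ((EFin \o (fun u : R => (v * expR (- v * u))%R)) \_ `[0%R, +oo[%classic) x)%E; last first.
  by apply: eq_integral => x _; rewrite /exponential_pdf !patchE; case: ifP.
by rewrite -integral_mkcond; apply: eq_integral => x _ /=; rewrite mulNr.
Qed.

Lemma gamma_integral_lty a : 0 <= a ->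
  (\int[leb]_(u in `[0%R, +oo[) (u `^ a * expR (- u))%:E < +oo)%E.
Proof.
move=> a0; have [n _ /(_ n (leqnn n))/= an] := nbhs_infty_ger a.
pose C : R := 2 ^+ n.+1 * n.+1`!%:R + 1.
have C0 : 0 <= C by rewrite addr_ge0// mulr_ge0// exprn_ge0.
have bound (u : R) : 0 <= u -> u `^ a * expR (- u) <= (2 * C) * (2^-1 * expR (- (2^-1 * u))).
  move=> u0; rewrite mulrA (_ : 2 * C * 2^-1 = C); last by rewrite mulrAC divff ?mul1r.
  have -> : - u = - (2^-1 * u) + - (2^-1 * u) by field.
  rewrite expRD mulrA ler_wpM2r ?expR_ge0//.
  have h1 : 1 <= expR (2^-1 * u) by rewrite -expR0 ler_expR mulr_ge0.
  suff : u `^ a <= C * expR (2^-1 * u).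
    by rewrite expRN ler_pdivrMr ?expR_gt0.
  have [u1|u1] := leP u 1.
    have : u `^ a <= 1.
      by have := @ge0_ler_powR R a a0 u 1; rewrite !nnegrE powR1; apply.
    have : 0 <= 2 ^+ n.+1 * n.+1`!%:R :> R by rewrite mulr_ge0// exprn_ge0.
    rewrite /C; nra.
  have un : u `^ a <= u ^+ n.+1.
    rewrite -powR_mulrn//; apply: ler_powR; first exact: ltW.
    by apply: (le_trans an); rewrite ler_nat.
  apply: (le_trans un).
  have := @expR_ge1Dxn R (2^-1 * u) n.
  rewrite mulr_ge0// => /(_ isT) h2.
  have : (2^-1 * u) ^+ n.+1 / n.+1`!%:R <= expR (2^-1 * u).
    by apply: le_trans h2; rewrite lerDr.
  rewrite ler_pdivrMr ?ltr0n ?fact_gt0// exprMn exprVn => h3.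
  have : u ^+ n.+1 <= 2 ^+ n.+1 * (expR (2^-1 * u) * n.+1`!%:R).
    by rewrite -ler_pdivrMl.
  rewrite /C mulrDl mul1r => h4; apply: (le_trans h4).
  by rewrite (mulrC (expR _)) mulrA lerDl expR_ge0.
apply: (@le_lt_trans _ _ (\int[leb]_(u in `[0%R, +oo[) ((2 * C)%:E * (2^-1 * expR (- (2^-1 * u)))%:E))%E).
  apply: ge0_le_integral => //.
  - by move=> u _; rewrite lee_fin mulr_ge0 ?powR_ge0 ?expR_ge0.
  - apply/measurable_EFinP/measurable_funTS.
    have := @measurable_powR_expR a 1; under eq_fun do rewrite mul1r.
    exact.
  - apply/measurable_EFinP/measurable_funTS; apply: measurable_funM => //.
    by apply: measurable_funM => //; apply: measurable_expRNM.
  - by move=> u; rewrite /= in_itv/= andbT => u0; rewrite -EFinM lee_fin bound.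
rewrite ge0_integralZl_EFin//.
- by rewrite integral_exponential_itv// mule1 ltry.
- apply/measurable_EFinP/measurable_funTS.
  by apply: measurable_funM => //; apply: measurable_expRNM.
- by rewrite mulr_ge0.
Qed.

Lemma Gamma_integral a : 0 <= a ->
  ((Gamma (a + 1))%:E = \int[leb]_(u in `[0%R, +oo[) (u `^ a * expR (- u))%:E)%E.
Proof.
move=> a0; rewrite /Gamma /Rintegral addrK integral_itv_obnd_cbnd; last first.
  apply/measurable_EFinP/measurable_funTS.
  by have := @measurable_powR_expR a 1; under eq_fun do rewrite mul1r.
rewrite fineK// ge0_fin_numE ?gamma_integral_lty//.
by apply: integral_ge0 => u _; rewrite lee_fin mulr_ge0 ?powR_ge0 ?expR_ge0.
Qed.

Lemma integral_powR_expR a v : 0 <= a -> 0 < v ->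
  (\int[leb]_(t in `[0%R, +oo[) (t `^ a * expR (- (v * t)))%:E =
   (Gamma (a + 1) / v `^ (a + 1))%:E)%E.
Proof.
move=> a0 v0.
pose G (u : R) := u `^ a * expR (- u).
have v1 : v * 0 = 0 :> R by rewrite mulr0.
have dE (x : R) : is_derive x 1 (fun t : R => v * t) v.
  by apply: is_derive_eq; rewrite scaler1 // addr0 mulr1.
have d1E : ((fun t : R => v * t)^`() = cst v)%classic.
  by apply/funext => x; rewrite derive1E; apply: derive_val.
have := @increasing_ge0_integration_by_substitutiony R (fun t => v * t) G 0.
rewrite v1 d1E => H.
have {H} : (\int[leb]_(x in `[0%R, +oo[) (G x)%:E =
   \int[leb]_(x in `[0%R, +oo[) (((G \o [eta *%R v]) * cst v)%R x)%:E)%E.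
  apply: H.
  - by move=> x y _ _; rewrite ltr_pM2l.
  - by move=> x _; exact: cst_continuous.
  - exact: is_cvg_cst.
  - exact: is_cvg_cst.
  - split => [x _|]; first by case: (dE x).
    by apply: cvg_at_right_filter; apply: cvgM; [exact: cvg_cst|exact: cvg_id].
  - exact: gt0_cvgMry.
  - apply/continuous_within_itvcyP; split => [x|].
      rewrite in_itv/= andbT => x0; apply: cvgM; first exact: continuous_powR_gt0.
      by apply: continuous_comp; [exact: opp_continuous|exact: continuous_expR].
    apply: cvgM; first exact: cvg_powR_at_right.
    apply: cvg_at_right_filter.
    by apply: continuous_comp; [exact: opp_continuous|exact: continuous_expR].
  - by move=> x _; rewrite mulr_ge0 ?powR_ge0 ?expR_ge0.
rewrite -Gamma_integral// => E.
have Gx (x : R) : 0 <= x ->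
    ((G \o [eta *%R v]) * cst v)%R x = v `^ (a + 1) * (x `^ a * expR (- (v * x))).
  move=> x0; rewrite /G/= fctE/= powRM// ?ltW// powRD ?(gt_eqF v0) ?implybT// powRr1 ?ltW//.
  ring.
have I0 : (0 <= \int[leb]_(t in `[0%R, +oo[) (t `^ a * expR (- (v * t)))%:E)%E.
  by apply: integral_ge0 => t _; rewrite lee_fin mulr_ge0 ?powR_ge0 ?expR_ge0.
have vp : 0 < v `^ (a + 1) by exact: powR_gt0.
have : ((Gamma (a + 1))%:E = (v `^ (a + 1))%:E *
    \int[leb]_(t in `[0%R, +oo[) (t `^ a * expR (- (v * t)))%:E)%E.
  rewrite E -ge0_integralZl_EFin//.
  - apply: eq_integral => x; rewrite inE/= in_itv/= andbT => x0.
    by rewrite Gx// EFinM.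
  - by move=> t _; rewrite lee_fin mulr_ge0 ?powR_ge0 ?expR_ge0.
  - by apply/measurable_EFinP/measurable_funTS; exact: measurable_powR_expR.
  - exact: ltW.
case: (integral _ _ _) I0 => [r| |]//.
- move=> r0 [->]; congr EFin; field; exact: lt0r_neq0.
- by rewrite gt0_muley ?lte_fin.
Qed.

(** The integrand is at least this large on the interval from [M] to [M + 1]. As [M] is free, Gamma
    outgrows every geometric sequence, which makes the Mittag-Leffler series entire. *)
Lemma Gamma_ge a M : 0 <= a -> 0 <= M -> M `^ a * expR (- (M + 1)) <= Gamma (a + 1).
Proof.
move=> a0 M0; rewrite -lee_fin Gamma_integral//.
have mG D : measurable_fun D (fun u : R => (u `^ a * expR (- u))%:E).
  apply/measurable_EFinP/measurable_funTS.
  by have := @measurable_powR_expR a 1; under eq_fun do rewrite mul1r.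
apply: (@le_trans _ _ (\int[leb]_(u in `[M, (M + 1)%R]) (u `^ a * expR (- u))%:E)%E); last first.
  apply: ge0_subset_integral => //; first exact: mG.
  - by move=> u _; rewrite lee_fin mulr_ge0 ?powR_ge0 ?expR_ge0.
  - by move=> u /=; rewrite !in_itv/= andbT => /andP[+ _]; apply: le_trans.
apply: (@le_trans _ _ (\int[leb]_(u in `[M, (M + 1)%R]) (M `^ a * expR (- (M + 1)))%:E)%E).
  rewrite integral_cst//= lebesgue_measure_itv/= lte_fin ltrDl ltr01.
  by rewrite -EFinD addrAC subrr add0r mule1.
apply: ge0_le_integral => //.
- by move=> u _; rewrite lee_fin mulr_ge0 ?powR_ge0 ?expR_ge0.
- exact: mG.
- move=> u; rewrite /= in_itv/= => /andP[Mu uM].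
  rewrite lee_fin ler_pM ?powR_ge0 ?expR_ge0//; last by rewrite ler_expR lerN2.
  by have := @ge0_ler_powR R a a0 M u; rewrite !nnegrE; apply => //; apply: le_trans Mu.
Qed.

Lemma Gamma_gt0 a : 0 <= a -> 0 < Gamma (a + 1).
Proof.
by move=> a0; apply: lt_le_trans (Gamma_ge a0 ler01); rewrite powR1 mul1r expR_gt0.
Qed.

End gamma.

(** * Entire power series and their derivatives *)

Section entire_series.
Variable R : realType.
Implicit Types (c : nat -> R) (x K : R).

(** Infinite radius of convergence, stated as boundedness: [K = 2 |x|] dominates the series at [x]
    by a geometric one of ratio 1/2. *)
Definition entire_coef c := forall K, 0 <= K -> exists B, forall j, `|c j| * K ^+ j <= B.

(** The factor [j.+1] is at most [2 ^ j], hence absorbed by passing from [K] to [2 * K + 1]. *)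
Lemma entire_coef_diffs c : entire_coef c -> entire_coef (pseries_diffs c).
Proof.
move=> ec K K0; have K21 : 0 <= 2 * K + 1 by rewrite addr_ge0// mulr_ge0.
have [B cB] := ec _ K21; exists B => j; apply: le_trans (cB j.+1).
rewrite /pseries_diffs normrM mulrAC mulrC ler_wpM2l//.
rewrite ger0_norm// exprS.
have h1 : j.+1%:R <= 2 ^+ j :> R by rewrite -natrX ler_nat ltn_expl.
have h2 : 2 ^+ j * K ^+ j <= (2 * K + 1) ^+ j.
  by rewrite -exprMn lerXn2r ?nnegrE ?mulr_ge0// lerDl.
have h3 : j.+1%:R * K ^+ j <= 2 ^+ j * K ^+ j by rewrite ler_wpM2r ?exprn_ge0.
have h4 : 0 <= (2 * K + 1) ^+ j by rewrite exprn_ge0.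
nra.
Qed.

Lemma entire_coef_iter_diffs n c : entire_coef c -> entire_coef (iter n (@pseries_diffs R) c).
Proof. by move=> ec; elim: n => //= n; exact: entire_coef_diffs. Qed.

Lemma is_cvg_entire c x : entire_coef c -> cvgn (pseries c x).
Proof.
move=> ec; have [B cB] := ec (2 * `|x|) (mulr_ge0 (ler0n R 2) (normr_ge0 x)).
have B0 : 0 <= B by apply: le_trans (cB 0%N); rewrite expr0 mulr1.
apply: normed_cvg.
apply: (@series_le_cvg _ _ (geometric B 2^-1)).
- by move=> n /=; exact: normr_ge0.
- by move=> n /=; rewrite mulr_ge0// exprn_ge0.
- move=> n /=; rewrite normrM normrX; have := cB n.
  rewrite exprMn mulrCA exprVn => h; rewrite ler_pdivlMr ?exprn_gt0//.
  by rewrite mulrC.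
- by apply: is_cvg_geometric_series; rewrite ger0_norm// invf_lt1// ltr1n.
Qed.

Lemma is_derive_entire c x : entire_coef c ->
  is_derive x 1 (fun y => limn (pseries c y)) (limn (pseries (pseries_diffs c) x)).
Proof.
move=> ec; apply: (@pseries_snd_diffs _ _ (`|x| + 1)).
- exact: is_cvg_entire.
- by apply: is_cvg_entire; exact: entire_coef_diffs.
- by apply: is_cvg_entire; do 2 apply: entire_coef_diffs.
- by rewrite [ltRHS]ger0_norm ?addr_ge0// ltrDl.
Qed.

Lemma derive1n_entire n c : entire_coef c ->
  derive1n n (fun y => limn (pseries c y)) =
  (fun y => limn (pseries (iter n (@pseries_diffs R) c) y)).
Proof.
move=> ec; elim: n => [//|n IH].
rewrite derive1nS IH; apply/funext => x; rewrite derive1E.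
have /@derive_val := is_derive_entire x (entire_coef_iter_diffs n ec); exact.
Qed.

Lemma iter_pseries_diffs n c j :
  iter n (@pseries_diffs R) c j = n`!%:R * 'C(n + j, n)%:R * c (n + j)%N.
Proof.
elim: n j => [|n IH] j; first by rewrite bin0 !mul1r.
rewrite iterS /pseries_diffs IH addnS addSn mulrA; congr (_ * _).
rewrite -!natrM; congr (_%:R).
by rewrite factS -mulnA mulnCA (mulnCA (n.+1)) mul_bin_left mulnA -addnS addKn mulnA.
Qed.

End entire_series.

(** Dominated convergence, the partial sums being dominated by the sum of all [f j]. That sum may be
    infinite at some points, but its integral is finite by monotone convergence. *)
Lemma alternating_series_integral d (T : measurableType d) (R : realType)
    (m : {measure set T -> \bar R}) (D : set T) (f : nat -> T -> R) (F : T -> R) :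
  measurable D -> (forall j, measurable_fun D (f j)) -> measurable_fun D F ->
  (forall j x, D x -> 0 <= f j x) ->
  (\sum_(j <oo) \int[m]_(x in D) (f j x)%:E < +oo)%E ->
  (forall x, D x -> series (fun j => (-1) ^+ j * f j x) @ \oo --> F x) ->
  m.-integrable D (EFin \o F) /\
  ((\sum_(0 <= j < n) ((-1) ^+ j)%:E * \int[m]_(x in D) (f j x)%:E)%E @[n --> \oo] -->
    (\int[m]_(x in D) (F x)%:E)%E).
Proof.
move=> mD mf mF f0 sf cF.
have intg : m.-integrable D (fun x => \sum_(j <oo) (f j x)%:E)%E.
  apply/integrableP; split.
    apply: ge0_emeasurable_sum => [j x Dx _|j _]; first by rewrite lee_fin f0.
    exact/measurable_EFinP.
  rewrite (eq_integral (fun x => \sum_(j <oo) (f j x)%:E)%E).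
    rewrite integral_nneseries//.
    by move=> j; exact/measurable_EFinP.
  move=> x /[!inE] Dx; rewrite gee0_abs//; apply: nneseries_ge0 => j _ _.
  by rewrite lee_fin f0.
have intf j : m.-integrable D (EFin \o f j).
  apply: le_integrable intg => //; first exact/measurable_EFinP.
  move=> x Dx; rewrite /= ger0_norm ?f0// gee0_abs; last first.
    by apply: nneseries_ge0 => i _ _; rewrite lee_fin f0.
  have := @nneseries_lim_ge R (fun i => (f i x)%:E) xpredT 0 j.+1 (fun i _ _ => f0 i x Dx).
  apply: le_trans; rewrite big_nat_recr//= leeDr// sume_ge0// => i _.
  by rewrite lee_fin f0.
have iaf j : m.-integrable D (fun x => ((-1) ^+ j * f j x)%:E).
  rewrite (_ : (fun x => _) = (fun x => ((-1) ^+ j)%:E * (f j x)%:E)%E)//.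
  exact: (integrableZl mD _ (intf j)).
have [iF _ cI] : [/\ m.-integrable D (EFin \o F),
    [sequence \int[m]_(x in D)
      `|(series (fun j => ((-1) ^+ j * f j x)%R) n)%:E - (F x)%:E| ]_n @ \oo --> 0 &
    [sequence \int[m]_(x in D) (series (fun j => ((-1) ^+ j * f j x)%R) n)%:E]_n @ \oo -->
    \int[m]_(x in D) (F x)%:E]%E.
  apply: (@dominated_convergence _ _ _ m D mD _ _ (fun x => \sum_(j <oo) (f j x)%:E)%E) => //.
  - move=> n; apply/measurable_EFinP; rewrite /series.
    apply: measurable_sum => j; apply: measurable_funM => //.
  - exact/measurable_EFinP.
  - by apply: aeW => x Dx; apply: cvg_EFin; [exact: nearW|exact: cF].
  - apply: aeW => x n Dx; apply: (@le_trans _ _ (\sum_(0 <= j < n) (f j x)%:E)%E).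
      rewrite abse_EFin sumEFin lee_fin /series/=; apply: (le_trans (ler_norm_sum _ _ _)).
      apply: ler_sum => j _; rewrite normrM normrX normrN1 expr1n mul1r.
      by rewrite ger0_norm// f0.
    by apply: nneseries_lim_ge => j _ _; rewrite lee_fin f0.
split => //; apply: cvg_trans cI; apply: near_eq_cvg; apply: nearW => n /=.
under eq_integral do rewrite /series/= -sumEFin.
rewrite integral_sum//; apply: eq_bigr => j _.
by rewrite -(integralZl mD (intf j)).
Qed.

Lemma bin_le_exp2 m n : ('C(m, n) <= 2 ^ m)%N.
Proof.
elim: m n => [|m IH] [|n]//; first by rewrite bin0 expn_gt0.
by rewrite binS expnS mul2n -addnn leq_add.
Qed.

(** By Pascal's rule, [1 - y] times a partial sum is the partial sum for the previous [n] minus a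
    boundary term. Bounding binomial coefficients by powers of 2 makes that term vanish for
    [|y| < 1/2], a range that large Laplace variables reach. *)
Lemma cvg_negative_binomial (R : realType) n (y : R) : `|y| < 2^-1 ->
  series (fun j => 'C(n + j, n)%:R * y ^+ j) @ \oo --> ((1 - y)^-1) ^+ n.+1.
Proof.
move=> y12; have y1 : `|y| < 1 by apply: (lt_trans y12); rewrite invf_lt1// ltr1n.
have y0 : 1 - y != 0.
  by rewrite subr_eq0; apply: contraTneq y1 => <-; rewrite normr1 ltxx.
elim: n => [|n IH].
  have := @cvg_geometric_series R 1 y y1; rewrite mul1r expr1; apply: cvg_trans.
  apply: near_eq_cvg; apply: nearW => N; rewrite /series/=; apply: eq_bigr => j _.
  by rewrite add0n bin0.
have partial N : series (fun j => 'C(n.+1 + j, n.+1)%:R * y ^+ j) N =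
    (1 - y)^-1 * (series (fun j => 'C(n + j, n)%:R * y ^+ j) N - 'C(n + N, n.+1)%:R * y ^+ N).
  apply: (mulfI y0); rewrite mulrA divff// mul1r.
  elim: N => [|N IHN]; first by rewrite /series/= !big_geq// addn0 bin_small// mul0r subrr mulr0.
  rewrite !seriesSr mulrDr IHN addSn addnS binS natrD exprS; ring.
have -> : (1 - y)^-1 ^+ n.+2 = (1 - y)^-1 * ((1 - y)^-1 ^+ n.+1 - 0) by rewrite subr0 -exprS.
have /funext -> := partial.
apply: cvgM; first exact: cvg_cst.
apply: cvgB => //.
have := @cvg_geometric R (2 ^+ n) (2 * `|y|).
have -> : `|2 * `|y| | < 1.
  by rewrite ger0_norm ?mulr_ge0// -ltr_pdivlMl// mulr1.
move=> /(_ isT) g0; apply/cvgr0Pnorm_le => e e0.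
move/cvgr0Pnorm_le : g0 => /(_ e e0); apply: filterS => N.
apply: le_trans; rewrite [leRHS]ger0_norm /geometric/=; last first.
  by rewrite mulr_ge0 ?exprn_ge0 ?mulr_ge0.
rewrite normrM normrX normr_nat.
rewrite exprMn mulrA ler_wpM2r ?exprn_ge0// -exprD -natrX ler_nat.
exact: bin_le_exp2.
Qed.

Lemma nneseries_EFin (R : realType) (u : nat -> R) (l : R) :
  series u @ \oo --> l -> (\sum_(j <oo) (u j)%:E = l%:E)%E.
Proof.
move=> cu; apply/cvg_lim => //.
rewrite (_ : (fun n => _) = EFin \o series u); last first.
  by apply/funext => n; rewrite /= /series sumEFin.
by apply: cvg_EFin => //; exact: nearW.
Qed.

(** * Laplace transforms of the terms of the GE distribution function *)

Section mittag_leffler_theory.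
Variables (R : realType) (nu : R).
Hypothesis nu0 : 0 < nu.
Notation leb := (@lebesgue_measure R).

Let c (j : nat) : R := (Gamma (nu * j%:R + 1))^-1.

Let nuj j : 0 <= nu * j%:R. Proof. by rewrite mulr_ge0// ltW. Qed.
Let c_gt0 j : 0 < c j. Proof. by rewrite invr_gt0 Gamma_gt0. Qed.

Lemma entire_mittag_leffler_coef : entire_coef c.
Proof.
(* With this [M], the power [nu * j] of [M] is [(K + 1) ^ j], so that [Gamma_ge] gives the bound
   [exp (M + 1)] for every [j] at once. *)
move=> K K0; pose M := (K + 1) `^ nu^-1.
have K1 : 0 < K + 1 by rewrite ltr_wpDl.
have M0 : 0 <= M by exact: powR_ge0.
exists (expR (M + 1)) => j; rewrite (ger0_norm (ltW (c_gt0 j))) /c mulrC ler_pdivrMr ?Gamma_gt0//.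
have := Gamma_ge (nuj j) M0.
have -> : M `^ (nu * j%:R) = (K + 1) ^+ j.
  by rewrite /M -powRrM mulrA mulVf ?(gt_eqF nu0)// mul1r powR_mulrn// ltW.
move=> h.
have h2 : K ^+ j <= (K + 1) ^+ j by rewrite lerXn2r ?nnegrE ?(ltW K1) ?lerDl.
apply: (le_trans h2); rewrite -ler_pdivrMl ?expR_gt0// mulrC -expRN.
exact: h.
Qed.

Lemma mittag_lefflerE : mittag_leffler nu = (fun z => limn (pseries c z)).
Proof.
apply/funext => z; rewrite /mittag_leffler /pseries; congr (limn (series _)).
by apply/funext => j; rewrite mulrC.
Qed.

Lemma cvg_derive1n_mittag_leffler n z :
  series (fun j => n`!%:R * 'C(n + j, n)%:R * c (n + j)%N * z ^+ j) @ \oo -->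
  derive1n n (mittag_leffler nu) z.
Proof.
rewrite mittag_lefflerE (derive1n_entire n entire_mittag_leffler_coef).
have := @is_cvg_entire _ _ z (entire_coef_iter_diffs n entire_mittag_leffler_coef).
rewrite /pseries/=; under eq_fun do rewrite iter_pseries_diffs.
by [].
Qed.

Lemma continuous_derive1n_mittag_leffler n : continuous (derive1n n (mittag_leffler nu)).
Proof.
move=> z; rewrite mittag_lefflerE (derive1n_entire n entire_mittag_leffler_coef).
apply: differentiable_continuous; apply/derivable1_diffP.
by have [] := is_derive_entire z (entire_coef_iter_diffs n entire_mittag_leffler_coef).
Qed.

Variable theta : R.
Hypothesis theta0 : 0 < theta.

(** The probability that a fractional Poisson process of rate [theta] has exactly [n] events up to
    time [t]; the survival function of the GE law is the sum over [n < k]. *)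
Definition GE_term n (t : R) : R :=
  (theta * t `^ nu) ^+ n / n`!%:R * derive1n n (mittag_leffler nu) (- (theta * t `^ nu)).

Lemma measurable_GE_term n : measurable_fun setT (GE_term n).
Proof.
have mz : measurable_fun setT (fun t : R => theta * t `^ nu).
  by apply: measurable_funM => //; exact: measurable_powR.
apply: measurable_funM.
  by apply: measurable_funM => //; exact: measurable_funX.
apply: measurableT_comp; last exact: measurableT_comp.
by apply: continuous_measurable_fun; exact: continuous_derive1n_mittag_leffler.
Qed.

Lemma GE_term_right_continuous n t : 0 <= t -> GE_term n u @[u --> t^'+] --> GE_term n t.
Proof.
move=> t0.
have zc : theta * u `^ nu @[u --> t^'+] --> theta * t `^ nu.
  apply: cvgM; first exact: cvg_cst.
  by apply: cvg_powR_at_right => //; exact: ltW.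
apply: cvgM; first by apply: cvgM; [exact: (cvg_comp _ _ zc (@exprn_continuous R n _))|exact: cvg_cst].
apply: continuous_cvg; last exact: cvgN.
exact: continuous_derive1n_mittag_leffler.
Qed.

(** Modulus of the [j]-th term in the power series of [GE_term n t], discounted at rate [v]. *)
Let f v n j t : R := 'C(n + j, n)%:R * c (n + j)%N * (theta * t `^ nu) ^+ (n + j) * expR (- (v * t)).

(** The Gamma factor of the integral cancels the one hidden in [c (n + j)]; what remains is the term
    of a negative binomial series. *)
Let intf v n j : 0 < v ->
  (\int[leb]_(t in `[0%R, +oo[) (f v n j t)%:E =
   ('C(n + j, n)%:R * (theta / v `^ nu) ^+ (n + j) / v)%:E)%E.
Proof.
move=> v0.
have tp (t : R) : f v n j t = 'C(n + j, n)%:R * c (n + j)%N * theta ^+ (n + j) *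
    (t `^ (nu * (n + j)%:R) * expR (- (v * t))).
  by rewrite /f exprMn powRrM powR_mulrn ?powR_ge0//; ring.
under eq_integral do rewrite tp EFinM.
rewrite ge0_integralZl_EFin//; last 3 first.
- by move=> t _; rewrite lee_fin mulr_ge0 ?powR_ge0 ?expR_ge0.
- by apply/measurable_EFinP/measurable_funTS; exact: measurable_powR_expR.
- by rewrite !mulr_ge0// ?exprn_ge0 ?ltW.
rewrite integral_powR_expR// -EFinM; congr EFin.
rewrite powRD ?(gt_eqF v0) ?implybT// powRr1 ?ltW// powRrM powR_mulrn ?powR_ge0//.
have G0 : Gamma (nu * (n + j)%:R + 1) != 0 by rewrite gt_eqF// Gamma_gt0.
have vn0 : v `^ nu != 0 by rewrite gt_eqF// powR_gt0.
rewrite /c exprMn exprVn; field.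
by rewrite G0 (gt_eqF v0) expf_neq0.
Qed.

(** The bound on the ratio [x] serves twice: the series of moduli sums to a power of [1 / (1 - x)],
    which allows integration term by term, and the alternating series to a power of
    [1 / (1 + x)]. *)
Lemma laplace_GE_term n v : 0 < v -> theta / v `^ nu < 2^-1 ->
  let x := theta / v `^ nu in
  leb.-integrable `[0%R, +oo[ (fun t => (GE_term n t * expR (- (v * t)))%:E) /\
  (\int[leb]_(t in `[0%R, +oo[) (GE_term n t * expR (- (v * t)))%:E =
   (x ^+ n * (1 + x)^-1 ^+ n.+1 / v)%:E)%E.
Proof.
move=> v0 x12 x.
have x0 : 0 <= x by rewrite divr_ge0 ?powR_ge0 ?ltW.
have [] := @alternating_series_integral _ _ R leb `[0%R, +oo[ (f v n)
   (fun t => GE_term n t * expR (- (v * t))).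
- by [].
- move=> j; apply: measurable_funTS; apply: measurable_funM; last exact: measurable_expRNM.
  apply: measurable_funM => //; apply: measurable_funX.
  by apply: measurable_funM => //; exact: measurable_powR.
- by apply: measurable_funTS; apply: measurable_funM;
    [exact: measurable_GE_term|exact: measurable_expRNM].
- move=> j t _; apply: mulr_ge0; last exact: expR_ge0.
  apply: mulr_ge0; first by apply: mulr_ge0 => //; exact: ltW.
  by rewrite exprn_ge0// mulr_ge0 ?powR_ge0// ltW.
- under eq_eseriesr do rewrite (intf _ _ v0) -/x.
  rewrite (@nneseries_EFin _ _ (x ^+ n / v * (1 - x)^-1 ^+ n.+1)) ?ltry//.
  rewrite (_ : series _ = (fun N => x ^+ n / v * series (fun j => 'C(n + j, n)%:R * x ^+ j) N)).
    apply: cvgM; first exact: cvg_cst.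
    by apply: cvg_negative_binomial; rewrite ger0_norm.
  apply/funext => N; rewrite /series/= mulr_sumr; apply: eq_bigr => j _.
  by rewrite exprD; ring.
- move=> t _.
  rewrite (_ : series _ = (fun N => expR (- (v * t)) * ((theta * t `^ nu) ^+ n / n`!%:R *
    series (fun j => n`!%:R * 'C(n + j, n)%:R * c (n + j)%N * (- (theta * t `^ nu)) ^+ j) N))).
    rewrite [_ * expR _]mulrC; apply: cvgM; first exact: cvg_cst.
    apply: cvgM; first exact: cvg_cst.
    exact: cvg_derive1n_mittag_leffler.
  apply/funext => N; rewrite /series/= !mulr_sumr; apply: eq_bigr => j _.
  rewrite /f [(- (theta * _)) ^+ j]exprNn exprD; field.
  by rewrite gt_eqF// ltr0n fact_gt0.
move=> iF cI; split => //; apply/esym/(cvg_unique _ _ cI) => //.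
rewrite (_ : (fun N => _) = (fun N => (x ^+ n / v * series (fun j => 'C(n + j, n)%:R * (- x) ^+ j) N)%:E)).
  apply: cvg_EFin; first exact: nearW.
  rewrite (_ : x ^+ n * _ / v = x ^+ n / v * (1 - (- x))^-1 ^+ n.+1); last first.
    by rewrite opprK; ring.
  apply: cvgM; first exact: cvg_cst.
  by apply: cvg_negative_binomial; rewrite normrN ger0_norm.
apply/funext => N; rewrite /series/= mulr_sumr -sumEFin; apply: eq_bigr => j _.
rewrite intf// -EFinM; congr EFin; rewrite -/x [(- x) ^+ j]exprNn exprD; ring.
Qed.

End mittag_leffler_theory.

(** * Signed functions with vanishing Laplace transform *)

Section laplace_zero.
Variable R : realType.
Notation leb := (@lebesgue_measure R).

(** The positive and negative parts of [h], discounted by [exp (- v0 t)], have equal transforms at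
    all integers, hence define the same measure. If [h t0 > 0], right continuity gives an interval
    after [t0] that the first part charges and the second does not. *)
Lemma laplace_zero_le0 (h : R -> R) (v0 t0 : R) : measurable_fun setT h ->
  (forall n : nat,
    leb.-integrable `[0%R, +oo[ (fun t => (h t * expR (- ((v0 + n%:R) * t)))%:E) /\
    (\int[leb]_(t in `[0%R, +oo[) (h t * expR (- ((v0 + n%:R) * t)))%:E = 0)%E) ->
  0 <= t0 -> h t @[t --> t0^'+] --> h t0 -> h t0 <= 0.
Proof.
move=> mh lap t00 ch; rewrite leNgt; apply/negP => ht0.
pose W (g : R -> R) (t : R) := (0 <= t)%R%:R * (Num.max (g t) 0 * expR (- (v0 * t))).
(* [laplace_unique] asks for a variable that is nonnegative everywhere; negative [t] have weight 0
   in [W]. *)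
pose X (t : R) := Num.max 0 t.
have W0 g t : 0 <= W g t by rewrite /W !mulr_ge0 ?expR_ge0// le_max lexx orbT.
have mW g : measurable_fun setT g -> measurable_fun setT (W g).
  move=> mg; apply: measurable_funM.
    by apply: measurable_natr_bool; exact: measurable_fun_ler.
  by apply: measurable_funM; [exact: measurable_maxr|exact: measurable_expRNM].
have mX : measurable_fun setT X by apply: measurable_maxr.
have X0 t : 0 <= X t by rewrite /X le_max lexx.
have itvE : `[0%R, +oo[%classic = [set t : R | 0 <= t].
  by apply/seteqP; split => t /=; rewrite in_itv/= andbT.
have lapW g n : (\int[leb]_t (expR (- (n%:R * X t)) * W g t)%:E =
    \int[leb]_(t in `[0%R, +oo[) (Num.max (g t * expR (- ((v0 + n%:R) * t))) 0)%:E)%E.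
  rewrite itvE integral_setb; apply: eq_integral => t _; congr EFin.
  rewrite /W; case: leP => t00'; last by rewrite !mul0r mulr0.
  rewrite !mul1r /X max_r// (mulrC (expR _)) -mulrA -expRD.
  rewrite -[X in _ = Num.max _ X](mul0r (expR (- ((v0 + n%:R) * t)))) -maxr_pMl ?expR_ge0//.
  by congr (_ * expR _); ring.
have mhN : measurable_fun setT (\- h) by exact: measurableT_comp.
have posneg n :
    (\int[leb]_t (expR (- (n%:R * X t)) * W h t)%:E < +oo)%E /\
    (\int[leb]_t (expR (- (n%:R * X t)) * W h t)%:E =
     \int[leb]_t (expR (- (n%:R * X t)) * W (\- h) t)%:E)%E.
  have [ih] := lap n; rewrite integralE !lapW.
  set f := (fun t => (h t * expR _)%:E) in ih *.
  have fpE : (f^\+ = (fun t => (Num.max (h t * expR (- ((v0 + n%:R) * t))) 0)%:E))%E.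
    by apply/funext => t; rewrite /f funeposE -EFin_max.
  have fnE : (f^\- = (fun t => (Num.max ((\- h) t * expR (- ((v0 + n%:R) * t))) 0)%:E))%E.
    by apply/funext => t; rewrite /f funenegE -EFinN -EFin_max /= mulNr.
  have mI : measurable (`[0%R, +oo[%classic : set (measurableTypeR R)) by exact: measurable_itv.
  move: (integrable_pos_fin_num mI ih) (integrable_neg_fin_num mI ih); rewrite fpE fnE.
  case: (integral _ _ _) => // r _; case: (integral _ _ _) => // s _.
  by rewrite ltry => -[/eqP]; rewrite subr_eq0 => /eqP ->.
have Wlty g : (\int[leb]_t (W g t)%:E = \int[leb]_t (expR (- (0%:R * X t)) * W g t)%:E)%E.
  by apply: eq_integral => t _; rewrite mul0r oppr0 expR0 mul1r.
have LU := @laplace_unique R _ _ leb _ _ leb (W h) X (W (\- h)) X (mW _ mh) (mW _ mhN) mX mX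
  (W0 h) (W0 _) X0 X0.
rewrite !Wlty in LU.
have [P1 P2] := posneg 0%N.
have {LU} LU := LU P1 (ltac:(by rewrite -P2)) (fun n => (posneg n).2).
have h20 : 0 < h t0 / 2 by rewrite divr_gt0.
have [e /= e0 he] : \forall t \near t0^'+, h t0 / 2 < h t.
  by apply: (cvgr_gt _ ch); rewrite ltr_pdivrMr// mulr_natr mulr2n ltrDl.
pose A : set R := `]t0, (t0 + e)%R[%classic.
have XA : X @^-1` A = A.
  apply/seteqP; split => t; rewrite /X /A /= !in_itv/=.
    by rewrite lt_max ltNge t00/= => /andP[t1 t2]; move: t2; rewrite max_r ?t1//; exact/ltW/(le_lt_trans t00).
  by move=> /andP[t1 t2]; rewrite max_r ?t1//; exact/ltW/(le_lt_trans t00).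
have hA t : A t -> h t0 / 2 <= h t.
  rewrite /A/= in_itv/= => /andP[t1 t2]; apply/ltW/he => //=.
  by rewrite ltr_distlC; apply/andP; split; [apply: lt_trans t1; rewrite ltrBlDr ltrDl|].
have tA t : A t -> 0 <= t.
  by rewrite /A/= in_itv/= => /andP[t1 _]; exact/ltW/(le_lt_trans t00).
(* A lower bound of [exp (- v0 t)] on [A], whatever the sign of [v0]. *)
pose c := expR (- (`|v0| * (t0 + e))).
have := LU A (measurable_itv _); rewrite /weighted_law XA.
rewrite [RHS]integral0_eq; last first.
  move=> t At; rewrite /W max_r ?mul0r ?mulr0// oppr_le0.
  by apply: le_trans (hA t At); exact: ltW.
apply/eqP; rewrite gt_eqF//.
apply: (@lt_le_trans _ _ (\int[leb]_(t in A) (h t0 / 2 * c)%:E)%E); last first.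
  apply: ge0_le_integral => //.
  - exact: measurable_itv.
  - by move=> t _; rewrite lee_fin mulr_ge0 ?expR_ge0// ltW.
  - by apply/measurable_EFinP/measurable_funTS; exact: mW.
  - move=> t At; rewrite lee_fin /W (tA _ At) mul1r.
    apply: ler_pM; [exact: ltW|exact: expR_ge0|by rewrite le_max hA|].
    rewrite /c ler_expR lerN2.
    move: (At); rewrite /A/= in_itv/= => /andP[_ /ltW te].
    apply: (@le_trans _ _ (`|v0| * t)); first by rewrite ler_wpM2r ?tA// ler_norm.
    by rewrite ler_wpM2l.
rewrite integral_cst//=; last exact: measurable_itv.
rewrite lebesgue_measure_itv/= lte_fin ltrDl e0 -EFinD addrAC subrr add0r -EFinM lte_fin.
by rewrite !mulr_gt0// expR_gt0.
Qed.

End laplace_zero.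

(** With [r = x / (1 + x)], the [n]-th term is [r ^ n - r ^ n.+1]. *)
Lemma sum_geometric_telescope (R : realType) (x : R) k : 0 <= x ->
  \sum_(n < k) x ^+ n * (1 + x)^-1 ^+ n.+1 = 1 - (x / (1 + x)) ^+ k.
Proof.
move=> x0; have x1 : 1 + x != 0 by rewrite gt_eqF// ltr_pwDl.
elim: k => [|k IH]; first by rewrite big_ord0 expr0 subrr.
rewrite big_ord_recr/= IH !exprMn !exprVn !exprS; field.
by rewrite x1 expf_neq0.
Qed.

Section laplace_GE.
Context d (Omega : measurableType d) (R : realType) (P : probability Omega R).
Notation leb := (@lebesgue_measure R).
Variables (nu theta : R) (k : nat) (X : {RV P >-> R}).
Hypotheses (nu0 : 0 < nu) (theta0 : 0 < theta) (X0 : forall w, 0 <= X w).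
Hypothesis laplaceX : forall v, 0 < v ->
  (\int[P]_w (expR (- (v * X w)))%:E = ((theta / (theta + v `^ nu)) ^+ k)%:E)%E.

Let G t := \sum_(n < k) GE_term nu theta n t.
Let S t := fine (ccdf X t).

Let SE t : (S t)%:E = P [set w | (t < X w)%R].
Proof.
rewrite /S fineK; first by rewrite /ccdf /distribution /pushforward; congr (P _);
  apply/seteqP; split => w /=; rewrite in_itv/= andbT.
exact: fin_num_measure.
Qed.

Let mXt t : measurable [set w | t < X w].
Proof.
rewrite (_ : [set w | t < X w] = X @^-1` `]t, +oo[%classic); first exact: measurable_funPTI.
by apply/seteqP; split => w /=; rewrite in_itv/= andbT.
Qed.

Let S01 t : 0 <= S t <= 1.
Proof. apply/andP; rewrite -!lee_fin SE; split => //.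
exact: probability_le1. Qed.

Let mS : measurable_fun setT S.
Proof.
apply: measurableT_comp; first exact: fine_measurable.
exact: ccdf_measurable.
Qed.

Let mG : measurable_fun setT G.
Proof. by apply: measurable_sum => n; exact: measurable_GE_term. Qed.

Let laplaceS v : 0 < v ->
  leb.-integrable `[0%R, +oo[ (fun t => (S t * expR (- (v * t)))%:E) /\
  (\int[leb]_(t in `[0%R, +oo[) (S t * expR (- (v * t)))%:E =
   ((1 - (theta / (theta + v `^ nu)) ^+ k) / v)%:E)%E.
Proof.
move=> v0.
have mSe : measurable_fun (`[0%R, +oo[%classic : set R) (fun t => (S t * expR (- (v * t)))%:E).
  by apply/measurable_EFinP/measurable_funTS/measurable_funM => //; exact: measurable_expRNM.
have Se0 t : 0 <= S t * expR (- (v * t)).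
  by rewrite mulr_ge0 ?expR_ge0//; case/andP: (S01 t).
have E : (\int[leb]_(t in `[0%R, +oo[) (S t * expR (- (v * t)))%:E =
   ((1 - (theta / (theta + v `^ nu)) ^+ k) / v)%:E)%E.
  have := @integral_tail_exponential R _ _ P (fun=> 1) X (measurable_cst _)
    (measurable_funPT X) (fun=> ler01) X0 v v0.
  have I1 t : (\int[P]_(x in [set x | (t < X x)%R]) (1%R)%:E = (S t)%:E)%E.
    by rewrite integral_cst// mul1e SE.
  under eq_integral do rewrite I1 -EFinM.
  under [in X in _ = X -> _]eq_integral do rewrite mulr1.
  have -> : (\int[P]_w (1 - expR (- (v * X w)))%:E =
      (1 - (theta / (theta + v `^ nu)) ^+ k)%:E)%E.
    apply: (EFin_add_inj _ _ (laplaceX v0)); first by rewrite laplaceX ?ltry.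
      by rewrite laplaceX// lee_fin exprn_ge0// divr_ge0 ?addr_ge0 ?powR_ge0 ?ltW.
    have mE : measurable_fun setT (fun w => expR (- (v * X w))).
      by apply: measurable_expRNM; exact: measurable_funPT.
    rewrite -ge0_integralD//.
    - rewrite -EFinD subrK; under eq_integral do rewrite -EFinD subrK.
      by rewrite integral_cst//= probability_setT mule1.
    - by move=> w _; rewrite lee_fin subr_ge0 -expR0 ler_expR oppr_le0 mulr_ge0// ltW.
    - by apply/measurable_EFinP; exact: measurable_funB.
    - exact/measurable_EFinP.
  have -> : (\int[leb]_t (exponential_pdf v t * S t)%:E =
      v%:E * \int[leb]_(t in `[0%R, +oo[) (S t * expR (- (v * t)))%:E)%E.
    rewrite -ge0_integralZl_EFin//; last 2 first.
      by move=> t _; rewrite lee_fin.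
      exact: ltW.
    rewrite [RHS]integral_mkcond; apply: eq_integral => t _.
    rewrite /exponential_pdf !patchE; case: ifP => _; last by rewrite mul0r.
    by rewrite -EFinM mulNr; congr EFin; ring.
  have : (0 <= \int[leb]_(t in `[0%R, +oo[) (S t * expR (- (v * t)))%:E)%E.
    by apply: integral_ge0 => t _; rewrite lee_fin.
  case: (integral _ _ _) => // [r r0 [<-]|_].
    by congr EFin; rewrite mulrC mulKf// gt_eqF.
  by rewrite gt0_muley ?lte_fin.
split => //; apply/integrableP; split => //.
under eq_integral do rewrite /= ger0_norm//.
by rewrite E ltry.
Qed.

(** From this rate on the ratio of [v0P] is at most 1/3, hence strictly below the 1/2 required by
    [laplace_GE_term]. *)
Let v0 := (3 * theta) `^ nu^-1.
Let v0_gt0 : 0 < v0. Proof. by rewrite powR_gt0// mulr_gt0. Qed.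

Let v0P v : v0 <= v -> theta / v `^ nu < 2^-1.
Proof.
move=> vv0; have v0' : 0 < v by exact: lt_le_trans vv0.
have : 3 * theta <= v `^ nu.
  have := @ge0_ler_powR R nu (ltW nu0) v0 v; rewrite !nnegrE => /(_ (ltW v0_gt0) (ltW v0') vv0).
  by rewrite /v0 -powRrM mulVf ?gt_eqF// powRr1// mulr_ge0// ltW.
move=> h; rewrite ltr_pdivrMr ?powR_gt0//; 
apply: (@lt_le_trans _ _ (2^-1 * (3 * theta))); last by rewrite ler_wpM2l.
by rewrite mulrA ltr_pMl//; lra.
Qed.

Let laplaceG v : v0 <= v ->
  leb.-integrable `[0%R, +oo[ (fun t => (G t * expR (- (v * t)))%:E) /\
  (\int[leb]_(t in `[0%R, +oo[) (G t * expR (- (v * t)))%:E =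
   ((1 - (theta / (theta + v `^ nu)) ^+ k) / v)%:E)%E.
Proof.
move=> vv0; have v0' : 0 < v by exact: lt_le_trans vv0.
have GE t : (G t * expR (- (v * t)))%:E =
    (\sum_(n < k) (GE_term nu theta n t * expR (- (v * t)))%:E)%E.
  by rewrite /G mulr_suml sumEFin.
rewrite (funext GE).
have H n := laplace_GE_term nu0 theta0 n v0' (v0P vv0).
split.
  by apply: integrable_sum => // n _; case: (H n).
rewrite integral_sum//; last by move=> n; case: (H n).
under eq_bigr do rewrite (H _).2.
rewrite sumEFin -mulr_suml sum_geometric_telescope ?divr_ge0 ?powR_ge0 ?ltW//.
congr (((1 - _ ^+ _) / _)%:E).
have vn : 0 < v `^ nu by rewrite powR_gt0.
field; rewrite !gt_eqF//; exact: addr_gt0.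
Qed.

Let laplaceB v : v0 <= v -> 
  leb.-integrable `[0%R, +oo[ (fun t => ((S t - G t) * expR (- (v * t)))%:E) /\
  (\int[leb]_(t in `[0%R, +oo[) ((S t - G t) * expR (- (v * t)))%:E = 0)%E /\
  leb.-integrable `[0%R, +oo[ (fun t => ((G t - S t) * expR (- (v * t)))%:E) /\
  (\int[leb]_(t in `[0%R, +oo[) ((G t - S t) * expR (- (v * t)))%:E = 0)%E.
Proof.
move=> vv0; have v0' : 0 < v by exact: lt_le_trans vv0.
have [iG GE] := laplaceG vv0; have [iS SE'] := laplaceS v0'.
have E1 t : ((S t - G t) * expR (- (v * t)))%:E = ((S t * expR (- (v * t)))%:E - (G t * expR (- (v * t)))%:E)%E.
  by rewrite mulrBl EFinB.
have E2 t : ((G t - S t) * expR (- (v * t)))%:E = ((G t * expR (- (v * t)))%:E - (S t * expR (- (v * t)))%:E)%E.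
  by rewrite mulrBl EFinB.
rewrite (funext E1) (funext E2); split; first exact: integrableB.
split; first by rewrite integralB// GE SE' subee.
split; first exact: integrableB.
by rewrite integralB// GE SE' subee.
Qed.

(** The survival functions [S] and [G] have equal transforms from [v0] on. Both are
    right-continuous, so [laplace_zero_le0], applied to [S - G] and to [G - S], gives equality at
    every time and not just almost everywhere. *)
Lemma laplace_GE : is_GE nu k theta X.
Proof.
move=> t t0.
have cG : G u @[u --> t^'+] --> G t.
  by apply: cvg_big => [|n _]; [exact: add_continuous|exact: GE_term_right_continuous].
have cS : S u @[u --> t^'+] --> S t.
  have := @ccdf_right_continuous _ _ _ P X t.
  rewrite -[ccdf X t](@fineK R) ?fin_num_measure//.
  by move/fine_cvg.
have h1 : S t - G t <= 0.
  apply: (@laplace_zero_le0 R (fun t => S t - G t) v0) => //.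
  - exact: measurable_funB.
  - move=> n; have v0n : v0 <= v0 + n%:R by rewrite lerDl.
    by have [? [? _]] := laplaceB v0n.
  - exact: cvgB.
have h2 : G t - S t <= 0.
  apply: (@laplace_zero_le0 R (fun t => G t - S t) v0) => //.
  - exact: measurable_funB.
  - move=> n; have v0n : v0 <= v0 + n%:R by rewrite lerDl.
    by have [_ [_ ?]] := laplaceB v0n.
  - exact: cvgB.
rewrite cdf_1_ccdf -[ccdf X t]fineK ?fin_num_measure// -/(S t) -EFinB; congr EFin.
rewrite /GE_cdf; congr (1 - _); rewrite -/(G t).
by apply/eqP; rewrite eq_le -subr_le0 h1 -subr_le0 h2.
Qed.

End laplace_GE.

(** * The jump chain of the queue *)

Lemma ae_forall_count d (T : measurableType d) (R : realType)
    (m : {measure set T -> \bar R}) (I : countType) (Q : I -> T -> Prop) :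
  (forall i, {ae m, forall w, Q i w}) -> {ae m, forall w, forall i, Q i w}.
Proof.
move=> H; have H' n : {ae m, forall w, if @unpickle I n is Some i then Q i w else True}.
  by case: unpickle => [i|]; [exact: H|exact: aeW].
have := ae_foralln H'; apply: filterS => w Hw i.
by have := Hw (pickle i); rewrite pickleK.
Qed.

Lemma null_set_ae d (T : measurableType d) (R : realType)
    (m : {measure set T -> \bar R}) (A : set T) :
  measurable A -> m A = 0%E -> {ae m, forall w, ~ A w}.
Proof. by move=> mA A0; exists A; split => // w /= /contrapT. Qed.

Lemma measurable_natr_set d (T : measurableType d) (R : realType) (A : set T) :
  measurable A -> measurable_fun setT (fun w => `[< A w >]%:R : R).
Proof.
move=> mA; rewrite (_ : (fun w => _) = \1_A); first exact: measurable_indic.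
by apply/funext => w; rewrite indicE.
Qed.

Lemma integral_natr_set d (T : measurableType d) (R : realType)
    (m : {measure set T -> \bar R}) (A : set T) :
  measurable A -> (\int[m]_w (`[< A w >]%:R : R)%:E = m A)%E.
Proof.
move=> mA; have := @integral_indic _ _ _ m setT measurableT A mA; rewrite setIT => <-.
by apply: eq_integral => w _; rewrite indicE.
Qed.

(* One coordinate at a time, the indicator of [t i < H i] is traded for
   [exp (- a i * H i)]. *)
Section exponential_coordinates.
Context d (Omega : measurableType d) (R : realType) (P : probability Omega R).
Variables (H : nat -> Omega -> R) (B : set Omega) (C : R) (r : nat -> R) (n : nat).
Hypotheses (mH : forall i, measurable_fun setT (H i)) (H0 : forall i w, 0 <= H i w).
Hypothesis Hae : {ae P, forall w, forall i, 0 < H i w}.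
Hypotheses (mB : measurable B) (C0 : 0 <= C) (r0 : forall i, (i < n)%N -> 0 < r i).
Hypothesis tails : forall t : nat -> R, (forall i, 0 <= t i) ->
  P [set w | B w /\ forall i, (i < n)%N -> t i < H i w] =
  (C * \prod_(i < n) expR (- (r i * t i)))%:E.

Let factor (j : nat) (a t : nat -> R) (i : nat) (w : Omega) : R :=
  if (i < j)%N then expR (- (a i * H i w)) else (t i < H i w)%R%:R.
Let value (j : nat) (a t : nat -> R) (i : nat) : R :=
  if (i < j)%N then r i / (r i + a i) else expR (- (r i * t i)).

Let mfactor j a t i : measurable_fun setT (factor j a t i).
Proof.
rewrite /factor; case: (i < j)%N; first exact: measurable_expRNM.
by apply: measurable_natr_bool; exact: measurable_fun_ltr.
Qed.

Let factor_ge0 j a t i w : 0 <= factor j a t i w.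
Proof. by rewrite /factor; case: ifP => _; rewrite ?expR_ge0. Qed.

(** The thresholds not yet traded are arbitrary in the induction hypothesis. Letting the one of
    [H j] vary shows that, under the density formed by the other factors, [H j] has an exponential
    tail of rate [r j]. *)
Let coordinates j (a t : nat -> R) : (j <= n)%N -> (forall i, 0 <= a i) ->
  (forall i, 0 <= t i) ->
  (\int[P]_w (`[< B w >]%:R * \prod_(i < n) factor j a t i w)%:E =
   (C * \prod_(i < n) value j a t i)%:E)%E.
Proof.
elim: j t => [|j IH] t jn a0 t0.
  have -> : \prod_(i < n) value 0 a t i = \prod_(i < n) expR (- (r i * t i)) by [].
  rewrite -tails//.
  have mS : measurable [set w | B w /\ forall i, (i < n)%N -> t i < H i w].
    rewrite (_ : [set w | _] = B `&` \bigcap_(i in [set i | (i < n)%N]) [set w | t i < H i w]).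
      apply: measurableI => //; apply: bigcap_measurableType => i _.
      have := @measurable_fun_ltr _ _ _ setT (fun=> t i) (H i) (measurable_cst _) (mH i).
      move=> /(_ measurableT [set true] I); rewrite setTI.
      by congr measurable; apply/seteqP; split => w /=.
    by apply/seteqP; split => w /= [].
  rewrite -(integral_natr_set P mS); apply: eq_integral => w _; congr EFin.
  case: asboolP => Bw; last first.
    by rewrite mul0r; case: asboolP => // -[].
  rewrite mul1r; case: asboolP => [[_ tH]|tH].
    by rewrite big1// => i _; rewrite /factor/= tH.
  apply/eqP; rewrite prodf_seq_eq0; apply/hasP.
  have /existsNP[i /not_implyP[iltn tHi]] : ~ forall i, (i < n)%N -> t i < H i w.
    by move=> h; apply: tH.
  exists (Ordinal iltn); rewrite ?mem_index_enum//= /factor/= pnatr_eq0 eqb0.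
  exact/negP.
pose jo := Ordinal jn.
have restE (b : nat -> R) w : `[< B w >]%:R * \prod_(i < n) factor j.+1 a b i w =
    expR (- (a j * H j w)) * (`[< B w >]%:R * \prod_(i < n | i != jo) factor j.+1 a b i w).
  by rewrite (bigD1 jo)//= {1}/factor ltnSn mulrCA.
under eq_integral do rewrite restE.
have valueE : \prod_(i < n) value j.+1 a t i =
    r j / (r j + a j) * \prod_(i < n | i != jo) value j.+1 a t i.
  by rewrite (bigD1 jo)//= {1}/value ltnSn.
rewrite valueE mulrCA mulrC mulrA.
have ltjS (i : 'I_n) : i != jo -> (i < j.+1)%N = (i < j)%N.
  by move=> ij; rewrite ltnS leq_eqVlt -[i == j :> nat]/(i == jo) (negbTE ij).
have m1 : measurable_fun setT (fun w => `[< B w >]%:R * \prod_(i < n | i != jo) factor j.+1 a t i w).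
  apply: measurable_funM; first exact: measurable_natr_set.
  under eq_fun do rewrite -big_filter.
  by apply: measurable_prod => i _; exact: mfactor.
have ge1 w : 0 <= `[< B w >]%:R * \prod_(i < n | i != jo) factor j.+1 a t i w.
  by rewrite mulr_ge0// prodr_ge0.
have tailW (s : R) : 0 <= s -> (\int[P]_(w in [set w | (s < H j w)%R])
   (`[< B w >]%:R * \prod_(i < n | i != jo) factor j.+1 a t i w)%:E =
   (C * \prod_(i < n | i != jo) value j.+1 a t i * expR (- (r j * s)))%:E)%E.
  move=> s0; pose t' i := if i == j then s else t i.
  have t'0 i : 0 <= t' i by rewrite /t'; case: ifP.
  have t'j i : i != jo -> t' (i : 'I_n) = t i.
    by rewrite /t' => ij; rewrite -[(i : nat) == j]/(i == jo) (negbTE ij).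
  have fE w : \prod_(i < n) factor j a t' i w =
      (s < H j w)%R%:R * \prod_(i < n | i != jo) factor j.+1 a t i w.
    rewrite (bigD1 jo)//=; congr (_ * _); first by rewrite /factor ltnn /t' eqxx.
    by apply: eq_bigr => i ij; rewrite /factor ltjS// t'j.
  have vE : \prod_(i < n) value j a t' i =
      expR (- (r j * s)) * \prod_(i < n | i != jo) value j.+1 a t i.
    rewrite (bigD1 jo)//=; congr (_ * _); first by rewrite /value ltnn /t' eqxx.
    by apply: eq_bigr => i ij; rewrite /value ltjS// t'j.
  have := IH t' (ltnW jn) a0 t'0; rewrite vE mulrCA mulrC => <-.
  by rewrite integral_setb; apply: eq_integral => w _; rewrite fE mulrCA.
(* The total mass of that density is its tail at [0], since [H j] is almost surely positive. *)
have WC : (\int[P]_w (`[< B w >]%:R * \prod_(i < n | i != jo) factor j.+1 a t i w)%:E =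
    (C * \prod_(i < n | i != jo) value j.+1 a t i)%:E)%E.
  have := tailW 0 (lexx 0); rewrite mulr0 oppr0 expR0 mulr1 => <-.
  rewrite integral_setb; apply: ae_eq_integral => //.
  - exact/measurable_EFinP.
  - apply/measurable_EFinP/measurable_funM => //.
    by apply: measurable_natr_bool; exact: measurable_fun_ltr.
  - by move: Hae; apply: filterS => w Hw _; rewrite Hw mul1r.
rewrite (@laplace_of_exponential_tail R _ _ P _ (H j) m1 (mH j) ge1 (H0 j) _ (r j) (a j) _ (r0 jn) (a0 j) WC tailW).
  congr EFin; ring.
rewrite mulr_ge0// prodr_ge0// => i ij; rewrite /value; case: ifP => ?; rewrite ?expR_ge0//.
by rewrite divr_ge0// ?addr_ge0// ltW// r0.
Qed.

Lemma exponential_coordinates (a : nat -> R) : (forall i, 0 <= a i) ->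
  (\int[P]_w (`[< B w >]%:R * \prod_(i < n) expR (- (a i * H i w)))%:E =
   (C * \prod_(i < n) (r i / (r i + a i)))%:E)%E.
Proof.
move=> a0; have := coordinates (leqnn n) a0 a0.
under eq_bigr do rewrite /value ltn_ord.
move=> <-; apply: eq_integral => w _; congr (_ * _)%:E.
by apply: eq_bigr => i _; rewrite /factor ltn_ord.
Qed.

End exponential_coordinates.

Lemma measurable_point_nat2 (x : nat * nat) : measurable [set x].
Proof.
case: x => a b; rewrite (_ : [set (a, b)] = [set a] `*` [set b]).
  exact: measurableX.
by apply/seteqP; split => [[c e] [-> ->]|[c e] [/= -> ->]].
Qed.

Section ctmc.
Context d (Omega : measurableType d) (R : realType) (P : probability Omega R)
  d' (E : measurableType d').
Hypothesis points : forall x : E, measurable [set x].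
Variables (S : set E) (q : E -> E -> R) (X : R -> Omega -> E).
Hypotheses (q0 : forall x y, 0 <= q x y) (rate0 : forall x, S x -> 0 < exit_rate q x).
Hypothesis ctmcX : is_ctmc P S q X.

Lemma ctmc_jump_chain : exists (Y : nat -> Omega -> E) (H : nat -> Omega -> R),
  let J n w := \sum_(i < n) H i w in
  [/\ forall n, measurable_fun setT (Y n),
      forall n, measurable_fun setT (H n),
      forall n w, 0 <= H n w,
      {ae P, forall w,
        [/\ forall n, S (Y n w), forall n, 0 < H n w,
            J n w @[n --> \oo] --> +oo &
            forall n t, J n w <= t < J n.+1 w -> X t w = Y n w]} &
      forall n (y : nat -> E) (a : nat -> R), (forall i, (i <= n)%N -> S (y i)) ->
        (forall i, 0 <= a i) ->
        (\int[P]_w (`[< forall i, (i <= n)%N -> Y i w = y i >]%:R *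
            \prod_(i < n) expR (- (a i * H i w)))%:E =
         (fine (P [set w | Y 0%N w = y 0%N]) *
           \prod_(i < n) (q (y i) (y i.+1) / (exit_rate q (y i) + a i)))%:E)%E].
Proof.
have [mX [Y [H [mY mH good law]]]] := ctmcX.
(* The holding times are positive only almost surely; the truncation makes them nonnegative on every
   path. *)
pose H' n w := Num.max 0 (H n w).
have mH' n : measurable_fun setT (H' n) by apply: measurable_maxr.
have H'0 n w : 0 <= H' n w by rewrite /H' le_max lexx.
exists Y, H'; split => //.
- move: good; apply: filterS => w [XS H0 Joo XY].
  have HE n : H' n w = H n w by rewrite /H' max_r// ltW.
  have JE n : \sum_(i < n) H' i w = \sum_(i < n) H i w by apply: eq_bigr => i _.
  split.
  + move=> n; rewrite -(XY n (\sum_(i < n) H i w)).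
      by apply: XS; rewrite sumr_ge0// => i _; exact: ltW.
    by rewrite lexx big_ord_recr/= ltrDl.
  + by move=> n; rewrite HE.
  + by rewrite (funext JE).
  + by move=> n t; rewrite !JE; exact: XY.
- move=> n y a Sy a0.
  have mB : measurable [set w | forall i, (i <= n)%N -> Y i w = y i].
    rewrite (_ : [set w | _] = \bigcap_(i in [set i | (i <= n)%N]) (Y i @^-1` [set y i])).
      by apply: bigcap_measurableType => i _; exact: measurable_preimageT.
    by apply/seteqP; split => w /=.
  have r0 i : (i < n.+1)%N -> 0 < exit_rate q (y i) by move=> ?; apply/rate0/Sy.
  pose C := fine (P [set w | Y 0%N w = y 0%N]) *
    \prod_(i < n) (q (y i) (y i.+1) / exit_rate q (y i)).
  have C0 : 0 <= C.
    rewrite mulr_ge0 ?fine_ge0// prodr_ge0// => i _; rewrite divr_ge0//.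
    by apply/ltW/r0; rewrite ltnS ltnW.
  have Hae : {ae P, forall w, forall i, 0 < H' i w}.
    by move: good; apply: filterS => w [_ H0 _ _] i; rewrite /H' lt_max H0 orbT.
  have tails (t : nat -> R) : (forall i, 0 <= t i) ->
      P [set w | (forall i, (i <= n)%N -> Y i w = y i) /\
        forall i, (i < n.+1)%N -> t i < H' i w] =
      (C * \prod_(i < n.+1) expR (- (exit_rate q (y i) * t i)))%:E.
    move=> t0; transitivity (P [set w | forall i, (i <= n)%N -> Y i w = y i /\ t i < H i w]).
      congr (P _); apply/seteqP; split => w /=.
        move=> [h1 h2] i iln; split; first exact: h1.
        by have := h2 i iln; rewrite /H' lt_max ltNge t0.
      move=> h; split => i iln; first by have [] := h i iln.
      by rewrite /H' lt_max; have [_ ->] := h i iln; rewrite orbT.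
    rewrite law// /C -[in RHS]mulrA [in RHS]EFinM fineK//; apply: fin_num_measure.
    exact: (measurable_preimageT (mY 0%N) (points (y 0%N))).
  (* The law is given for [n.+1] holding times, but only the first [n] are discounted: rate 0 on the
     last one contributes the factor 1. *)
  pose a' i := if i == n then 0 else a i.
  have a'0 i : 0 <= a' i by rewrite /a'; case: ifP.
  have a'E (i : 'I_n) : a' i = a i by rewrite /a' ltn_eqF.
  have a'n : a' n = 0 by rewrite /a' eqxx.
  have eE w : \prod_(i < n.+1) expR (- (a' i * H' i w)) = \prod_(i < n) expR (- (a i * H' i w)).
    rewrite big_ord_recr/= a'n mul0r oppr0 expR0 mulr1.
    by apply: eq_bigr => i _; rewrite a'E.
  have := @exponential_coordinates _ _ _ P H' _ C (fun i => exit_rate q (y i)) n.+1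
    mH' H'0 Hae mB C0 r0 tails a' a'0.
  rewrite big_ord_recr/= a'n addr0 divff ?gt_eqF ?r0// mulr1.
  under eq_integral do rewrite eE.
  move=> ->; congr EFin; rewrite /C -mulrA -big_split/=; congr (_ * _).
  apply: eq_bigr => i _; rewrite a'E mulrA divfK// gt_eqF// r0//.
  by rewrite ltnS ltnW.
Qed.

End ctmc.

Lemma exit_rate2 (R : realType) (E : choiceType) (q : E -> E -> R) (x y z : E) :
  (forall u, 0 <= q x u) -> y != z -> (forall u, u != y -> u != z -> q x u = 0) ->
  exit_rate q x = q x y + q x z.
Proof.
move=> q0 yz q00; rewrite /exit_rate.
rewrite (_ : (\esum_(u in [set: E]) (q x u)%:E)%E = (\esum_(u in [set y; z]) (q x u)%:E)%E).
  rewrite esum_fset//.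
    rewrite fsbigU0//=; last first.
      by move=> u [-> zy]; move: yz; rewrite zy eqxx.
    by rewrite !fsbig_set1 -EFinD.
  by move=> u _; rewrite lee_fin.
rewrite [RHS]esum_mkcond; apply: eq_esum => u _.
case: ifPn => //; rewrite notin_setE/= => /not_orP[uy uz].
by rewrite q00//; apply/eqP.
Qed.

(** * Transition rates of the queue *)

Section queue_rates.
Variables (R : realType) (lambda mu : R) (k : nat).
Hypotheses (lambda0 : 0 < lambda) (mu0 : 0 < mu) (k1 : (1 <= k)%N).
Notation q := (queue_rate lambda mu k).
Notation theta := (k%:R * mu).

Lemma theta_gt0 : 0 < theta. Proof. by rewrite mulr_gt0// ltr0n. Qed.

Definition phase_end (x : nat * nat) : nat * nat :=
  if (2 <= x.2)%N then (x.1, x.2.-1)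
  else if (2 <= x.1)%N then (x.1.-1, k) else (0, 0)%N.

Lemma queue_rate_ge0 x y : 0 <= q x y.
Proof.
have := ltW theta_gt0 => th0.
have l0 := ltW lambda0.
have h (b : bool) (u v : R) : 0 <= u -> 0 <= v -> 0 <= if b then u else v by case: b.
rewrite /queue_rate; case: x => n s.
by apply: (h) => //; apply: (h) => //; apply: (h) => //; apply: (h) => //; apply: (h).
Qed.

Lemma queue_rate_empty : q (0, 0)%N (1%N, k) = lambda.
Proof. by rewrite /queue_rate !eqxx. Qed.

Lemma queue_rate_emptyN y : y != (1%N, k) -> q (0, 0)%N y = 0.
Proof. by move=> yk; rewrite /queue_rate eqxx (negbTE yk)/=. Qed.

Lemma queue_rate_arrival x : busy_state k x -> q x (x.1.+1, x.2) = lambda.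
Proof.
case: x => n s bx; rewrite /queue_rate bx eqxx.
by case: ifP.
Qed.

Lemma queue_rate_phase_end x : busy_state k x -> q x (phase_end x) = theta.
Proof.
case: x => n s /[dup] bx /and3P[/= n1 s1 sk].
rewrite /queue_rate bx /phase_end/=.
have -> : ((n, s) == (0, 0)%N) = false by case: n n1 {bx}.
have [s2|s2] := leqP 2 s.
  rewrite !xpair_eqE (_ : (n == n.+1) = false) ?eqxx//.
  by apply/eqP; lia.
have -> : s = 1%N by apply/eqP; rewrite eqn_leq s1 -ltnS s2.
have [n2|n2] := leqP 2 n.
  rewrite !xpair_eqE !eqxx/=.
  have -> : (n.-1 == n.+1) = false by apply/eqP; lia.
  by [].
have -> : n = 1%N by lia.
by rewrite !xpair_eqE/=.
Qed.

Lemma queue_rate_other x y : busy_state k x -> y != (x.1.+1, x.2) -> y != phase_end x ->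
  q x y = 0.
Proof.
case: x => n s /[dup] bx /and3P[/= n1 s1 sk] /negbTE ya /negbTE.
rewrite /queue_rate bx /phase_end/= ya.
have -> : ((n, s) == (0, 0)%N) = false by case: n n1 {bx ya}.
have [s2|s2] := leqP 2 s.
  move=> ->; rewrite xpair_eqE (_ : (s == 1%N) = false) ?andbF//.
  by apply/eqP; lia.
have -> : s = 1%N by lia.
have [n2|n2] := leqP 2 n => /= ->//=.
  by rewrite xpair_eqE; case: n n1 n2 {bx ya} => [|[|]].
by have -> : n = 1%N by lia.
Qed.

Lemma exit_rate_empty : exit_rate q (0, 0)%N = lambda.
Proof.
(* The empty state has a single successor; [(0, 0)] is a second target of rate 0. *)
rewrite (@exit_rate2 _ _ q (0, 0)%N (1%N, k) (0, 0)%N)//.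
- by rewrite queue_rate_empty queue_rate_emptyN ?addr0.
- exact: queue_rate_ge0.
- by move=> u u1 _; exact: queue_rate_emptyN.
Qed.

Lemma arrival_neq_phase_end x : (x.1.+1, x.2) != phase_end x.
Proof.
case: x => n s; rewrite /phase_end/=; case: ifP => _.
  by rewrite xpair_eqE; apply/negP => /andP[/eqP]; lia.
case: ifP => _; rewrite xpair_eqE//.
by apply/negP => /andP[/eqP]; lia.
Qed.

Lemma exit_rate_busy x : busy_state k x -> exit_rate q x = lambda + theta.
Proof.
move=> bx; rewrite (@exit_rate2 _ _ q x (x.1.+1, x.2) (phase_end x)).
- by rewrite queue_rate_arrival// queue_rate_phase_end.
- exact: queue_rate_ge0.
- exact: arrival_neq_phase_end.
- by move=> u; exact: queue_rate_other.
Qed.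

Lemma exit_rate_gt0 x : queue_state k x -> 0 < exit_rate q x.
Proof.
by case=> [bx|->]; [rewrite exit_rate_busy// addr_gt0// theta_gt0|rewrite exit_rate_empty].
Qed.

End queue_rates.

Definition queue_step (k : nat) (x z : nat * nat) : Prop :=
  (x = (0, 0)%N /\ z = (1%N, k)) \/
  (busy_state k x /\ (z = (x.1.+1, x.2) \/ z = phase_end k x)).

(** Common end of several proofs that an event is null: a chain that only sees arrivals, a
    subordinator that does not move, a bounded subordinator. *)
Lemma geometric_bound_eq0 (R : realType) (c K rho : R) :
  0 <= c -> 0 <= rho < 1 -> (forall l, c <= K * rho ^+ l) -> c = 0.
Proof.
move=> c0 /andP[r0 r1] cl; apply/eqP; rewrite eq_le c0 andbT leNgt; apply/negP => c0'.
have rn : `|rho| < 1 by rewrite ger0_norm.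
have /cvgr0Pnorm_lt/(_ c c0') := @cvg_geometric R K rho rn.
move=> [l _ /(_ l (leqnn l))]; rewrite /geometric/= ltNge.
by rewrite (le_trans (cl l))// ler_norm.
Qed.

(** * Almost sure properties of the jump chain *)

Section queue_paths.
Context d (Omega : measurableType d) (R : realType) (P : probability Omega R).
Variables (lambda mu : R) (k : nat).
Hypotheses (lambda0 : 0 < lambda) (mu0 : 0 < mu) (k1 : (1 <= k)%N).
Notation q := (queue_rate lambda mu k).
Notation theta := (k%:R * mu).
Variables (Y : nat -> Omega -> nat * nat).
Hypothesis mY : forall n, measurable_fun setT (Y n).
Hypothesis Yae : {ae P, forall w, forall n, queue_state k (Y n w)}.
Hypothesis cylinder : forall n (y : nat -> nat * nat),
  (forall i, (i <= n)%N -> queue_state k (y i)) ->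
  P [set w | forall i, (i <= n)%N -> Y i w = y i] =
  (fine (P [set w | Y 0%N w = y 0%N]) *
    \prod_(i < n) (q (y i) (y i.+1) / exit_rate q (y i)))%:E.

Lemma measurable_cylinder n (y : nat -> nat * nat) :
  measurable [set w | forall i, (i <= n)%N -> Y i w = y i].
Proof.
rewrite (_ : [set w | _] = \bigcap_(i in [set i | (i <= n)%N]) (Y i @^-1` [set y i])).
  by apply: bigcap_measurableType => i _; apply: measurable_preimageT => //; exact: measurable_point_nat2.
by apply/seteqP; split => w /=.
Qed.

Lemma queue_rate_nonstep x z : queue_state k x -> ~ queue_step k x z -> q x z = 0.
Proof.
move=> [bx|->] nst.
  apply: queue_rate_other => //; apply/eqP => E; apply: nst; right; split => //.
  - by left.
  - by right.
by apply: queue_rate_emptyN; apply/eqP => E; apply: nst; left.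
Qed.

Lemma queue_rate_le_exit x z : queue_state k x -> q x z / exit_rate q x <= 1.
Proof.
move=> Sx; have r0 := exit_rate_gt0 lambda0 mu0 k1 Sx.
rewrite ler_pdivrMr// mul1r; have th0 := theta_gt0 mu0 k1.
case: Sx r0 => [bx|->] r0.
  rewrite exit_rate_busy//.
  have [->|za] := eqVneq z (x.1.+1, x.2); first by rewrite queue_rate_arrival// lerDl ltW.
  have [->|zp] := eqVneq z (phase_end k x).
    by rewrite queue_rate_phase_end// lerDr ltW.
  by rewrite queue_rate_other// ltW// addr_gt0.
rewrite exit_rate_empty//.
have [->|z1] := eqVneq z (1%N, k); first by rewrite queue_rate_empty.
by rewrite queue_rate_emptyN// ltW.
Qed.

Lemma cylinder_ae n (y : nat -> nat * nat) :
  ((forall i, (i <= n)%N -> queue_state k (y i)) ->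
    P [set w | forall i, (i <= n)%N -> Y i w = y i] = 0%E) ->
  {ae P, forall w, ~ forall i, (i <= n)%N -> Y i w = y i}.
Proof.
move=> H; have [Sy|/existsNP[i /not_implyP[iln Syi]]] :=
    pselect (forall i, (i <= n)%N -> queue_state k (y i)).
  by apply: null_set_ae; [exact: measurable_cylinder|exact: H].
by move: Yae; apply: filterS => w Sw Yy; apply: Syi; rewrite -Yy.
Qed.

(** A forbidden transition has rate 0, so each finite history that ends with one is null. Coding
    histories by a length and a sequence of states leaves countably many of them. *)
Lemma queue_steps_ae : {ae P, forall w, forall n, queue_step k (Y n w) (Y n.+1 w)}.
Proof.
have H (ns : nat * seq (nat * nat)) : {ae P, forall w,
    let y := nth (0, 0)%N ns.2 in
    (forall i, (i <= ns.1.+1)%N -> Y i w = y i) -> queue_step k (y ns.1) (y ns.1.+1)}.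
  case: ns => n s /=; set y := nth _ s.
  have [st|nst] := pselect (queue_step k (y n) (y n.+1)); first exact: aeW.
  have : {ae P, forall w, ~ forall i, (i <= n.+1)%N -> Y i w = y i}.
    apply: cylinder_ae => Sy; rewrite cylinder// big_ord_recr/=.
    by rewrite (queue_rate_nonstep (Sy n (leqnSn n)) nst) mul0r mulr0 mulr0.
  by apply: filterS => w h /h.
have := ae_forall_count H; apply: filterS => w Hw n.
have : forall i, (i <= n.+1)%N -> nth (0, 0)%N (mkseq (Y ^~ w) n.+2) i = Y i w.
  by move=> i iln; rewrite nth_mkseq.
move: (mkseq _ _) => s sE; have := Hw (n, s) => /=.
by rewrite !sE//; apply => i /sE ->.
Qed.

(** Otherwise a service could last forever. In a busy state the next jump is an arrival with
    probability [lambda / (lambda + theta) < 1], so [l] arrivals in a row have geometrically small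
    probability, and only countably many histories can precede them. *)
Lemma queue_unstuck_ae : {ae P, forall w, forall n, busy_state k (Y n w) ->
  exists j, Y (n + j)%N w <> ((Y n w).1 + j, (Y n w).2)%N}.
Proof.
(* The history [s] up to index [n], continued by arrivals alone. *)
pose ext (n : nat) (s : seq (nat * nat)) i : nat * nat :=
  if (i <= n)%N then nth (0, 0)%N s i
  else ((nth (0, 0)%N s n).1 + (i - n), (nth (0, 0)%N s n).2)%N.
have H (ns : nat * seq (nat * nat)) : {ae P, forall w,
    busy_state k (nth (0, 0)%N ns.2 ns.1) -> ~ forall i, Y i w = ext ns.1 ns.2 i}.
  case: ns => n s /=; case bs : (busy_state k _); last exact: aeW.
  have [Sy|/existsNP[i Syi]] := pselect (forall i, queue_state k (ext n s i)); last first.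
    by move: Yae; apply: filterS => w Sw _ Yy; apply: Syi; rewrite -Yy.
  pose C := [set w | forall i, Y i w = ext n s i].
  have mC : measurable C.
    rewrite (_ : C = \bigcap_i (Y i @^-1` [set ext n s i])).
      by apply: bigcapT_measurable => i; apply: measurable_preimageT => //; exact: measurable_point_nat2.
    by apply/seteqP; split => w /= h i; [move=> _|]; exact: h.
  have th0 := theta_gt0 mu0 k1.
  have lt0 : 0 < lambda + theta by rewrite addr_gt0.
  suff : P C = 0%E by move=> /(null_set_ae mC); apply: filterS => w h _.
  rewrite -[P C]fineK ?fin_num_measure//; congr EFin.
  apply: (@geometric_bound_eq0 _ _ 1 (lambda / (lambda + theta))); first exact: fine_ge0.
    by rewrite divr_ge0 ?ltW//= ltr_pdivrMr// mul1r ltrDl.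
  move=> l; rewrite mul1r -lee_fin fineK ?fin_num_measure//.
  apply: (@le_trans _ _ (P [set w | forall i, (i <= n + l)%N -> Y i w = ext n s i])).
    by apply: le_measure; rewrite ?inE//; [exact: measurable_cylinder|move=> w h i _; exact: h].
  rewrite cylinder// lee_fin big_split_ord/=.
  have f01 i : 0 <= q (ext n s i) (ext n s i.+1) / exit_rate q (ext n s i) <= 1.
    rewrite queue_rate_le_exit// andbT divr_ge0 ?queue_rate_ge0//.
    by apply/ltW/exit_rate_gt0.
  have p01 : 0 <= fine (P [set w | Y 0%N w = ext n s 0%N]) <= 1.
    rewrite fine_ge0//= -lee_fin fineK ?probability_le1 ?fin_num_measure//;
      exact: (measurable_preimageT (mY 0%N) (measurable_point_nat2 _)).
  have -> : \prod_(i < l) (q (ext n s (n + i)%N) (ext n s (n + i).+1) / exit_rate q (ext n s (n + i)%N)) =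
      (lambda / (lambda + theta)) ^+ l.
    rewrite -[RHS]mulr1 -[l in RHS]card_ord -prodr_const mulr1.
    apply: eq_bigr => i _.
    have eE : ext n s (n + i)%N = ((nth (0, 0)%N s n).1 + i, (nth (0, 0)%N s n).2)%N.
      rewrite /ext; case: ifP => h; last by rewrite addKn.
      have -> : (i : nat) = 0%N by lia.
      by rewrite !addn0; case: (nth _ s n).
    have eE' : ext n s (n + i).+1 = ((ext n s (n + i)%N).1.+1, (ext n s (n + i)%N).2).
      by rewrite eE /ext ifF /=; [congr (_, _); lia|apply/negP; lia].
    have be : busy_state k (ext n s (n + i)%N).
      by rewrite eE; move: bs; rewrite /busy_state/= => /and3P[n1 -> ->]; rewrite andbT ltn_addr.
    by rewrite eE' queue_rate_arrival// exit_rate_busy.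
  have pr01 : 0 <= \prod_(i < n) (q (ext n s i) (ext n s i.+1) / exit_rate q (ext n s i)) <= 1.
    apply/andP; split; first by apply: prodr_ge0 => i _; case/andP: (f01 i).
    have := @ler_prod R 'I_n (index_enum 'I_n) xpredT _ (fun=> 1) (fun i _ => f01 i).
    by rewrite big1_eq.
  rewrite mulrA ler_piMl ?exprn_ge0 ?divr_ge0 ?(ltW lambda0) ?(ltW lt0)//.
  by case/andP: p01 => *; case/andP: pr01 => *; apply: mulr_ile1.
have := ae_forall_count H; apply: filterS => w Hw n bn; apply: contrapT.
move=> /forallNP stuck.
have : forall i, (i <= n)%N -> nth (0, 0)%N (mkseq (Y ^~ w) n.+1) i = Y i w.
  by move=> i iln; rewrite nth_mkseq.
move: (mkseq _ _) => s sE; have := Hw (n, s) => /=.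
rewrite sE//; apply => // i; rewrite /ext; case: ifP => [/sE //|iln].
rewrite sE//; have := contrapT (stuck (i - n)%N); rewrite subnKC//; lia.
Qed.

End queue_paths.

(** * Stable subordinators *)

Lemma weighted_law_natr_set d (T : measurableType d) (R : realType) d'
    (E : measurableType d') (m : {measure set T -> \bar R}) (W : T -> R)
    (X : T -> E) (A : set E) :
  weighted_law m W X A = (\int[m]_x (`[< A (X x) >]%:R * W x)%:E)%E.
Proof.
rewrite /weighted_law -integral_setb.
rewrite (_ : [set x | `[< A (X x) >]] = X @^-1` A)//.
by apply/seteqP; split => x /=; [move/asboolP|move/asboolP].
Qed.

Lemma weighted_law_cst d (T : measurableType d) (R : realType) d'
    (E : measurableType d') (m : {measure set T -> \bar R}) (c : R)
    (X : T -> E) (A : set E) : measurable_fun setT X -> measurable A ->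
  weighted_law m (fun=> c) X A = (c%:E * m (X @^-1` A))%E.
Proof. by move=> mX mA; rewrite /weighted_law integral_cst//; exact: measurable_preimageT. Qed.

Section independent_products.
Context d (Omega : measurableType d) (R : realType) (P : probability Omega R).
Variables (X : nat -> Omega -> R) (f : nat -> R -> R) (e : nat -> R) (n : nat).
Hypotheses (mX : forall i, measurable_fun setT (X i))
  (mf : forall i, measurable_fun setT (f i)) (f0 : forall i x, 0 <= f i x).
Hypothesis Xind : mutually_independent P X.
Hypothesis eE : forall i, (\int[P]_w (f i (X i w))%:E = (e i)%:E)%E.

Let e0 i : 0 <= e i.
Proof. by rewrite -lee_fin -eE; apply: integral_ge0 => w _; rewrite lee_fin. Qed.

Let p (A : nat -> set R) i := fine (P (X i @^-1` A i)).
Let factor (j : nat) (A : nat -> set R) (i : nat) (w : Omega) : R :=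
  if (i < j)%N then f i (X i w) else `[< A i (X i w) >]%:R.
Let value (j : nat) (A : nat -> set R) (i : nat) : R :=
  if (i < j)%N then e i else p A i.

Let mfactor j A i : measurable (A i) -> measurable_fun setT (factor j A i).
Proof.
move=> mA; rewrite /factor; case: (i < j)%N; first exact: measurableT_comp.
exact: (@measurable_natr_set _ _ _ (X i @^-1` A i) (measurable_preimageT (mX i) mA)).
Qed.

Let factor_ge0 j A i w : 0 <= factor j A i w.
Proof. by rewrite /factor; case: ifP. Qed.

Let value_ge0 j A i : 0 <= value j A i.
Proof. by rewrite /value; case: ifP => // _; rewrite /p fine_ge0. Qed.

(** The indicator of one coordinate at a time is traded for [f]. As [A j] is arbitrary in the
    induction hypothesis, [X j] has, under the density [W] of the other factors, its own law
    multiplied by the constant [c]. *)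
Let products j (A : nat -> set R) : (j <= n)%N -> (forall i, measurable (A i)) ->
  (\int[P]_w (\prod_(i < n) factor j A i w)%:E = (\prod_(i < n) value j A i)%:E)%E.
Proof.
elim: j A => [|j IH] A jn mA.
  have i0n : iota 0 n = index_iota 0 n by rewrite /index_iota subn0.
  have := Xind (iota_uniq 0 n) mA; rewrite i0n.
  have -> : (\prod_(i <- index_iota 0 n) P (X i @^-1` A i) = (\prod_(i < n) value 0 A i)%:E)%E.
    rewrite big_mkord -prodEFin.
    apply: eq_bigr => i _; rewrite /value/= /p fineK//; apply: fin_num_measure.
    exact: measurable_preimageT.
  move=> <-.
  have mS : measurable (\big[setI/setT]_(i <- index_iota 0 n) X i @^-1` A i).
    by apply: bigsetI_measurable => i _; exact: measurable_preimageT.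
  rewrite -(integral_natr_set P mS); apply: eq_integral => w _; congr EFin.
  have -> : \big[setI/setT]_(0 <= i < n) X i @^-1` A i = \bigcap_(i < n) (X i @^-1` A i).
    by rewrite big_mkord bigcap_mkord.
  case: asboolP => [h|h].
    by rewrite big1// => i _; rewrite /factor/=; case: asboolP => // /(_ (h i (ltn_ord i))).
  apply/eqP; rewrite prodf_seq_eq0; apply/hasP.
  have /existsNP[i /not_implyP[iltn Ai]] := h.
  exists (Ordinal iltn); rewrite ?mem_index_enum//= /factor/= pnatr_eq0 eqb0.
  exact/asboolP.
pose jo := Ordinal jn.
pose W w := \prod_(i < n | i != jo) factor j.+1 A i w.
pose c := \prod_(i < n | i != jo) value j.+1 A i.
have ltjS (i : 'I_n) : i != jo -> (i < j.+1)%N = (i < j)%N.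
  by move=> ij; rewrite ltnS leq_eqVlt -[i == j :> nat]/(i == jo) (negbTE ij).
have mW : measurable_fun setT W.
  rewrite /W; under eq_fun do rewrite -big_filter.
  by apply: measurable_prod => i _; exact: mfactor.
have W0 w : 0 <= W w by apply: prodr_ge0.
have c0 : 0 <= c by apply: prodr_ge0.
have law S : measurable S -> weighted_law P W (X j) S = weighted_law P (fun=> c) (X j) S.
  move=> mS; rewrite weighted_law_cst// weighted_law_natr_set.
  pose A' i := if i == j then S else A i.
  have mA' i : measurable (A' i) by rewrite /A'; case: ifP.
  have A'j i : i != jo -> A' (i : 'I_n) = A i.
    by rewrite /A' => ij; rewrite -[(i : nat) == j]/(i == jo) (negbTE ij).
  have fE w : \prod_(i < n) factor j A' i w = `[< S (X j w) >]%:R * W w.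
    rewrite (bigD1 jo)//=; congr (_ * _); first by rewrite /factor ltnn /A' eqxx.
    by apply: eq_bigr => i ij; rewrite /factor ltjS// A'j.
  have vE : \prod_(i < n) value j A' i = p A' j * c.
    rewrite (bigD1 jo)//=; congr (_ * _); first by rewrite /value ltnn.
    by apply: eq_bigr => i ij; rewrite /value ltjS// /p A'j.
  transitivity ((p A' j * c)%:E).
    by rewrite -vE -(IH A' (ltnW jn) mA'); apply: eq_integral => w _; rewrite fE.
  rewrite EFinM muleC /p fineK; first by rewrite /A' eqxx.
  by apply: fin_num_measure; exact: measurable_preimageT.
have := weighted_law_integral_eq mW W0 (mX j) (measurable_cst c) (fun=> c0) (mX j) (mf j) (f0 j) law.
have fE w : \prod_(i < n) factor j.+1 A i w = f j (X j w) * W w.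
  by rewrite (bigD1 jo)//=; congr (_ * _); rewrite /factor ltnSn.
have vE : \prod_(i < n) value j.+1 A i = e j * c.
  by rewrite (bigD1 jo)//=; congr (_ * _); rewrite /value ltnSn.
under eq_integral do rewrite -fE.
move=> ->; rewrite vE; under eq_integral do rewrite mulrC EFinM.
rewrite ge0_integralZl_EFin//.
- by rewrite eE -EFinM mulrC.
- by move=> w _; rewrite lee_fin.
- by apply/measurable_EFinP; apply: measurableT_comp.
Qed.

Lemma independent_expectation_prod :
  (\int[P]_w (\prod_(i < n) f i (X i w))%:E = (\prod_(i < n) e i)%:E)%E.
Proof.
have := products (leqnn n) (fun=> measurableT).
under eq_integral do under eq_bigr do rewrite /factor ltn_ord.
by under [X in _ = (X)%:E -> _]eq_bigr do rewrite /value ltn_ord.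
Qed.

End independent_products.

Lemma le_probability_integral d (T : measurableType d) (R : realType)
    (m : {measure set T -> \bar R}) (A : set T) (f : T -> R) :
  measurable A -> measurable_fun setT f -> (forall x, 0 <= f x) ->
  (forall x, A x -> 1 <= f x) -> (m A <= \int[m]_x (f x)%:E)%E.
Proof.
move=> mA mf f0 f1; rewrite -(integral_natr_set m mA); apply: ge0_le_integral => //.
- by apply/measurable_EFinP; exact: measurable_natr_set.
- exact/measurable_EFinP.
- by move=> x _; rewrite lee_fin; case: asboolP => // /f1.
Qed.

Section subordinator.
Context d (Omega : measurableType d) (R : realType) (P : probability Omega R).
Variables (nu : R) (sigma : R -> Omega -> R).
Hypotheses (nu0 : 0 < nu) (sub : is_stable_subordinator P nu sigma).

Let ms t : 0 <= t -> measurable_fun setT (sigma t).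
Proof. by case: sub => + _ _ _ _ t0; apply. Qed.

Lemma subordinator_ge0_ae : {ae P, forall w, forall t, 0 <= t -> 0 <= sigma t w}.
Proof.
case: sub => _ + _ _ _; apply: filterS => w [s0 mono _] t t0.
by rewrite -s0; exact: mono.
Qed.

Lemma subordinator_laplace t v : 0 <= t -> 0 <= v ->
  (\int[P]_w (expR (- (v * sigma t w)))%:E = (expR (- (t * v `^ nu)))%:E)%E.
Proof.
move=> t0; rewrite le_eqVlt => /predU1P[<-|v0].
  under eq_integral do rewrite mul0r oppr0 expR0.
  by rewrite integral_cst//= probability_setT mule1 powR0 ?gt_eqF// mulr0 oppr0 expR0.
by case: sub => _ _ _ _ /(_ t v t0 v0); rewrite unlock.
Qed.

Lemma subordinator_increments_laplace n (tau b : nat -> R) :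
  0 <= tau 0%N -> (forall i, tau i <= tau i.+1) -> (forall i, 0 <= b i) ->
  (\int[P]_w (\prod_(i < n) expR (- (b i * (sigma (tau i.+1) w - sigma (tau i) w))))%:E =
   (\prod_(i < n) expR (- ((tau i.+1 - tau i) * b i `^ nu)))%:E)%E.
Proof.
move=> tau0 taumono b0; have t0 i : 0 <= tau i.
  by elim: i => // i /le_trans; apply.
pose f i x := expR (- (b i * Num.max 0 x)).
have mf i : measurable_fun setT (f i).
  by apply: measurable_expRNM; exact: measurable_maxr.
have f0 i x : 0 <= f i x by exact: expR_ge0.
pose D i w := sigma (tau i.+1) w - sigma (tau i) w.
have mD i : measurable_fun setT (D i) by apply: measurable_funB; exact: ms.
have d0 i : 0 <= tau i.+1 - tau i by rewrite subr_ge0.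
have eE i : (\int[P]_w (f i (D i w))%:E = (expR (- ((tau i.+1 - tau i) * b i `^ nu)))%:E)%E.
  rewrite -(subordinator_laplace (d0 i) (b0 i)).
  transitivity (\int[P]_w (f i (sigma (tau i.+1 - tau i) w))%:E)%E.
    have law A : measurable A -> weighted_law P (fun=> 1) (D i) A =
        weighted_law P (fun=> 1) (sigma (tau i.+1 - tau i)) A.
      move=> mA; rewrite !weighted_law_cst//; last exact: ms.
      congr (_ * _)%E; case: sub => _ _ _ /(_ _ _ A (t0 i) (d0 i) mA) + _.
      by rewrite addrC subrK => E; exact: E.
    have := weighted_law_integral_eq (measurable_cst _) (fun=> ler01) (mD i)
      (measurable_cst _) (fun=> ler01) (ms (d0 i)) (mf i) (f0 i) law.
    by under eq_integral do rewrite mulr1; under [X in _ = X -> _]eq_integral do rewrite mulr1.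
  apply: ae_eq_integral => //.
  - by apply/measurable_EFinP; apply: measurableT_comp => //; exact: ms.
  - by apply/measurable_EFinP/measurable_expRNM; exact: ms.
  - by move: subordinator_ge0_ae; apply: filterS => w h _; rewrite /f max_r// h.
rewrite -(@independent_expectation_prod _ _ _ P D f _ n mD mf f0 _ eE).
  apply: ae_eq_integral => //.
  - apply/measurable_EFinP/measurable_prod => i _; apply: measurable_expRNM.
    by apply: measurable_funB; exact: ms.
  - by apply/measurable_EFinP/measurable_prod => i _; apply: measurableT_comp.
  - case: sub => _ + _ _ _; apply: filterS => w [_ mono _] _; congr EFin.
    by apply: eq_bigr => i _; rewrite /f max_r// subr_ge0 mono.
by case: sub => _ _ + _ _; apply.
Qed.

Lemma subordinator_gt0_ae t : 0 < t -> {ae P, forall w, 0 < sigma t w}.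
Proof.
move=> t0; have t0' := ltW t0.
pose A := [set w | sigma t w <= 0].
have mA : measurable A.
  have := measurable_fun_ler (ms t0') (measurable_cst (0 : R)).
  by move=> /(_ measurableT [set true] I); rewrite setTI; congr measurable; apply/seteqP; split => w /=.
suff : P A = 0%E by move=> /(null_set_ae mA); apply: filterS => w /negP; rewrite -ltNge.
rewrite -[P A]fineK ?fin_num_measure//; congr EFin.
apply: (@geometric_bound_eq0 _ _ 1 (expR (-1))); first exact: fine_ge0.
  by rewrite expR_ge0/= expR_lt1 ltrN10.
move=> l; rewrite mul1r -lee_fin fineK ?fin_num_measure//.
(* Chosen so that the exponent of the Laplace transform at [v] is [- l]; on [A] the discount is at
   least 1, whence [P A <= exp (- l)]. *)
pose v := (l%:R / t) `^ nu^-1.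
have -> : expR (-1) ^+ l = expR (- (t * v `^ nu)) :> R.
  rewrite /v -powRrM mulVf ?gt_eqF// powRr1 ?divr_ge0// mulrC divfK ?gt_eqF//.
  by rewrite -expRM_natl mulrN1.
rewrite -(subordinator_laplace t0' (powR_ge0 _ _)); apply: le_probability_integral => //.
  by apply: measurable_expRNM; exact: ms.
by move=> w; rewrite /A/= => sw; rewrite -expR0 ler_expR oppr_ge0 mulr_ge0_le0 ?powR_ge0.
Qed.

(** By stationarity of the increments it is almost sure for all pairs of rationals, and monotonicity
    extends it to all times. Strictness makes the transformed jump times distinct. *)
Lemma subordinator_increasing_ae :
  {ae P, forall w, forall s t, 0 <= s -> s < t -> sigma s w < sigma t w}.
Proof.
have H (pq : rat * rat) : {ae P, forall w, 0 <= (ratr pq.1 : R) -> (ratr pq.1 : R) < ratr pq.2 ->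
    sigma (ratr pq.1) w < sigma (ratr pq.2) w}.
  case: pq => p q /=; have [p0|_] := leP 0 (ratr p : R); last exact: aeW.
  have [pq|_] := ltP (ratr p : R) (ratr q); last exact: aeW.
  set s : R := ratr p in p0 pq *; set t : R := ratr q in pq *.
  have ts0 : 0 < t - s by rewrite subr_gt0.
  have t0 : 0 <= t by rewrite ltW// (le_lt_trans p0).
  pose A := [set x : R | x <= 0].
  have mA : measurable A.
    by rewrite (_ : A = `]-oo, 0]%classic)//; apply/seteqP; split => x /=; rewrite in_itv.
  have : P (sigma (t - s) @^-1` A) = 0%E.
    apply: measure_negligible; first exact: (measurable_preimageT (ms (ltW ts0))).
    have := subordinator_gt0_ae ts0; apply: negligibleS => w /=; rewrite /A /= => h1 h2.
    by move: h2; rewrite ltNge h1.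
  case: sub => _ _ _ /(_ _ _ A p0 (ltW ts0) mA) <- _; rewrite addrC subrK.
  move=> /null_set_ae; have mD : measurable [set w | A (sigma t w - sigma s w)].
    exact: (measurable_preimageT (measurable_funB (ms t0) (ms p0))).
  by move=> /(_ mD); apply: filterS => w /negP; rewrite /A/= -ltNge subr_gt0.
have := ae_forall_count H; case: sub => _ + _ _ _; apply: filterS2 => w [_ mono _] Hw s t s0 st.
have /rat_in_itvoo[p] := st; rewrite inE/= => /itvP sp.
have pt : ratr p < t by rewrite sp.
have /rat_in_itvoo[r] := pt; rewrite inE/= => /itvP pr.
have p0 : 0 <= ratr p :> R by rewrite (le_trans s0)// ltW// sp.
apply: (@le_lt_trans _ _ (sigma (ratr p) w)); first by rewrite mono// ltW// sp.
apply: (@lt_le_trans _ _ (sigma (ratr r) w)).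
  by apply: (Hw (p, r)) => //=; rewrite pr.
by apply: mono; [rewrite (le_trans p0)// ltW// pr|rewrite ltW// pr].
Qed.

(** If every [sigma n] stays below [c], then [exp (c - sigma l) >= 1]; the probability of this is at
    most [exp (c - l)] for every [l]. The set whose infimum is the inverse process is thereby
    nonempty. *)
Lemma subordinator_unbounded_ae :
  {ae P, forall w, forall c, exists n : nat, c < sigma n%:R w}.
Proof.
have H (c : nat) : {ae P, forall w, exists n : nat, c%:R < sigma n%:R w}.
  pose A := [set w | forall n : nat, sigma n%:R w <= c%:R].
  have mA : measurable A.
    rewrite (_ : A = \bigcap_n [set w | sigma n%:R w <= c%:R]).
      apply: bigcapT_measurable => n.
      have := measurable_fun_ler (ms (ler0n R n)) (measurable_cst (c%:R : R)).
      by move=> /(_ measurableT [set true] I); rewrite setTI; congr measurable; apply/seteqP; split => w /=.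
    by apply/seteqP; split => w /= h n; [move=> _|]; exact: h.
  suff : P A = 0%E.
    move=> /(null_set_ae mA); apply: filterS => w /existsNP[n /negP].
    by rewrite -ltNge => h; exists n.
  rewrite -[P A]fineK ?fin_num_measure//; congr EFin.
  apply: (@geometric_bound_eq0 _ _ (expR c%:R) (expR (-1))); first exact: fine_ge0.
    by rewrite expR_ge0/= expR_lt1 ltrN10.
  move=> l; rewrite -lee_fin fineK ?fin_num_measure//.
  have := subordinator_laplace (ler0n R l) ler01; rewrite powR1 mulr1.
  rewrite -expRM_natl mulrN1 EFinM => <-.
  rewrite -ge0_integralZl_EFin ?expR_ge0//.
  - apply: (@le_probability_integral _ _ _ P A (fun w => expR c%:R * expR (- (1 * sigma l%:R w)))) => //.
    + by apply: measurable_funM => //; apply: measurable_expRNM; exact: ms.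
    + by move=> w Aw; rewrite mul1r -expRD (le_trans _ (expR_ge1Dx _))// lerDl subr_ge0 Aw.
  - by apply/measurable_EFinP/measurable_expRNM; exact: ms.
have := ae_foralln H; apply: filterS => w Hw c.
have [m _ /(_ m (leqnn m))/= cm] := nbhs_infty_ger c.
by have [n mn] := Hw m; exists n; exact: le_lt_trans mn.
Qed.

End subordinator.

(** * The time change *)

(* The jump chain and the jump times are determined by the process only almost
   surely, whence the null sets. *)
Section ae_events.
Context d (Omega : measurableType d) (R : realType) (P : probability Omega R)
  d' (E : measurableType d') (X : R -> Omega -> E).

Definition ae_process_events (A : set Omega) :=
  exists2 A', process_events X A' & {ae P, forall w, A w <-> A' w}.

Local Notation F := (g_sigma_algebraType [set A | exists t (B : set E),
        [/\ 0 <= t, measurable B & A = X t @^-1` B]]).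

Lemma ae_process_events_ae (A B : set Omega) : {ae P, forall w, A w <-> B w} ->
  ae_process_events B -> ae_process_events A.
Proof.
move=> AB [B' FB' BB']; exists B' => //.
by move: AB BB'; apply: filterS2 => w ->.
Qed.

Lemma ae_process_eventsC (A : set Omega) : ae_process_events A -> ae_process_events (~` A).
Proof.
move=> [A' FA' AA']; exists (~` A'); first exact: (@measurableC _ F).
by move: AA'; apply: filterS => w h; split => n /h.
Qed.

Lemma ae_process_events_bigcup (A : nat -> set Omega) :
  (forall n, ae_process_events (A n)) -> ae_process_events (\bigcup_n A n).
Proof.
move=> AP; have AP' n : exists B, process_events X B /\ {ae P, forall w, A n w <-> B w}.
  by have [B ? ?] := AP n; exists B.
have [A' A'P] := boolp.choice AP'; exists (\bigcup_n A' n).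
  by apply: (@bigcupT_measurable _ F) => n; case: (A'P n).
have H n : {ae P, forall w, A n w <-> A' n w} by case: (A'P n).
by have := ae_foralln H; apply: filterS => w h; split => -[n _ /h ?]; exists n.
Qed.

Lemma ae_process_events0 : ae_process_events set0.
Proof. by exists set0; [exact: (@measurable0 _ F)|exact: aeW]. Qed.

Lemma ae_process_events_count (I : countType) (Q : I -> Prop) (A : I -> set Omega) :
  (forall i, Q i -> ae_process_events (A i)) ->
  ae_process_events [set w | exists2 i, Q i & A i w].
Proof.
move=> H; pose B n := if @unpickle I n is Some i then [set w | Q i /\ A i w] else set0.
have : ae_process_events (\bigcup_n B n).
  apply: ae_process_events_bigcup => n; rewrite /B; case: unpickle => [i|]; last exact: ae_process_events0.
  have [Qi|Qi] := pselect (Q i).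
    by apply: ae_process_events_ae (H _ Qi); apply: aeW => w; split => [[]|].
  by apply: ae_process_events_ae ae_process_events0; apply: aeW => w; split => [[]|].
apply: ae_process_events_ae; apply: aeW => w; split => [[i Qi Ai]|[n _]].
  by exists (pickle i) => //; rewrite /B pickleK.
by rewrite /B; case: unpickle => // i [Qi Ai]; exists i.
Qed.

Lemma ae_process_eventsI (A B : set Omega) :
  ae_process_events A -> ae_process_events B -> ae_process_events (A `&` B).
Proof.
move=> [A' FA' AA'] [B' FB' BB']; exists (A' `&` B'); first exact: (@measurableI _ F).
by move: AA' BB'; apply: filterS2 => w h1 h2; split => -[/h1 ? /h2 ?].
Qed.

Lemma ae_process_events_all (n : nat) (A : nat -> set Omega) :
  (forall i, (i < n)%N -> ae_process_events (A i)) ->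
  ae_process_events [set w | forall i, (i < n)%N -> A i w].
Proof.
elim: n => [|n IH] H.
  exists setT; first exact: (@measurableT _ F).
  exact: aeW.
have := ae_process_eventsI (IH (fun i iltn => H i (leqW iltn))) (H n (ltnSn n)).
apply: ae_process_events_ae; apply: aeW => w; split.
  by move=> h; split; [move=> i iltn; apply/h/leqW|exact: h].
by move=> [h1 h2] i; rewrite ltnS leq_eqVlt => /predU1P[->|/h1].
Qed.

Lemma ae_process_events_eq (t : R) (x : E) : 0 <= t -> measurable [set x] ->
  ae_process_events [set w | X t w = x].
Proof.
move=> t0 mx; exists [set w | X t w = x]; last exact: aeW.
by apply: sub_sigma_algebra; exists t, [set x].
Qed.

End ae_events.

(** * Jump times and visited states as events of the process *)

Section jump_events.
Context d (Omega : measurableType d) (R : realType) (P : probability Omega R)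
  (X : R -> Omega -> nat * nat) (Y : nat -> Omega -> nat * nat) (H : nat -> Omega -> R).
Let J n w := \sum_(i < n) H i w.
Hypothesis good : {ae P, forall w,
  [/\ forall n, 0 < H n w, forall n, Y n w <> Y n.+1 w,
      J n w @[n --> \oo] --> +oo &
      forall n t, J n w <= t < J n.+1 w -> X t w = Y n w]}.

Let JS n w : J n.+1 w = J n w + H n w. Proof. by rewrite /J big_ord_recr. Qed.
Let J0 w : J 0 w = 0. Proof. by rewrite /J big_ord0. Qed.

Let mono w : (forall n, 0 < H n w) -> forall i j, (i <= j)%N -> J i w <= J j w.
Proof.
move=> H0 i j /subnK <-; elim: (j - i)%N => // m IH.
by rewrite addSn JS (le_trans IH)// lerDl ltW.
Qed.

Definition rational_chain n (t : R) (s : seq rat) :=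
  [/\ forall i, (i <= n)%N -> 0 <= (ratr (nth 0 s i) : R),
      forall i, (i < n)%N -> (ratr (nth 0 s i) : R) < ratr (nth 0 s i.+1) &
      ratr (nth 0 s n) < t].

(** One rational in each of the first [n.+1] sojourns gives the chain. Conversely, two times of a
    chain cannot share a sojourn when they are consecutive, so the [i]-th one is at least [J i]. *)
Lemma jump_time_lt_chain n t : {ae P, forall w, J n w < t <->
  exists2 s, rational_chain n t s &
    forall i, (i < n)%N -> X (ratr (nth 0 s i)) w <> X (ratr (nth 0 s i.+1)) w}.
Proof.
move: good; apply: filterS => w [H0 YY Joo XY]; split.
  move=> Jt; have Jlt i : exists q : rat, J i w < ratr q < J i.+1 w.
    have : J i w < J i.+1 w by rewrite JS ltrDl.
    by move=> /rat_in_itvoo[q]; rewrite inE/= => /itvP qP; exists q; rewrite !qP.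
  have [q qP] := boolp.choice Jlt.
  (* The last rational must lie before [t] as well as in the [n]-th sojourn. *)
  have [r /andP[Jr rm]] : exists r : rat, J n w < ratr r < Num.min t (J n.+1 w).
    have : J n w < Num.min t (J n.+1 w) by rewrite lt_min Jt JS ltrDl H0.
    by move=> /rat_in_itvoo[p]; rewrite inE/= => /itvP pP; exists p; rewrite !pP.
  move: rm; rewrite lt_min => /andP[rt rJ].
  pose q' i := if i == n then r else q i.
  have q'P i : (i <= n)%N -> J i w < ratr (q' i) < J i.+1 w.
    by move=> _; rewrite /q'; case: eqP => [->|_]; [rewrite Jr|exact: qP].
  have nthq i : (i <= n)%N -> nth 0 (mkseq q' n.+1) i = q' i.
    by move=> iln; rewrite nth_mkseq.
  exists (mkseq q' n.+1).
    split.
    - move=> i iln; rewrite nthq//; have /andP[/ltW + _] := q'P i iln.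
      by apply: le_trans; rewrite -(J0 w) mono.
    - move=> i iltn; rewrite !nthq//; last exact: ltnW.
      have /andP[_ a] := q'P i (ltnW iltn); have /andP[b _] := q'P i.+1 iltn.
      exact: lt_trans a b.
    - by rewrite nthq// /q' eqxx.
  move=> i iltn; rewrite !nthq//; last exact: ltnW.
  have /andP[a b] := q'P i (ltnW iltn); have /andP[a' b'] := q'P i.+1 iltn.
  by rewrite (XY i) ?(ltW a)// (XY i.+1) ?(ltW a').
move=> [s [s0 smono st] Xs].
suff : J n w <= ratr (nth 0 s n) by move=> /le_lt_trans; apply.
have {st} H1 i : (i <= n)%N -> J i w <= ratr (nth 0 s i).
  elim: i => [_|i IH iltn]; first by rewrite J0 s0.
  rewrite leNgt; apply/negP => sJ; apply: (Xs i iltn).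
  have Ji := IH (ltnW iltn); have si := smono i iltn.
  rewrite (XY i) ?Ji ?(lt_trans si)// (XY i)// sJ andbT.
  by rewrite (le_trans Ji)// ltW.
exact: H1.
Qed.

Lemma ae_process_events_neq (s t : R) : 0 <= s -> 0 <= t ->
  ae_process_events P X [set w | X s w <> X t w].
Proof.
move=> s0 t0; have : ae_process_events P X (~` [set w | exists2 x : nat * nat, True &
    ([set w | X s w = x] `&` [set w | X t w = x]) w]).
  apply/ae_process_eventsC/ae_process_events_count => x _.
  by apply: ae_process_eventsI; apply: ae_process_events_eq => //; exact: measurable_point_nat2.
apply: ae_process_events_ae; apply: aeW => w; split.
  by move=> /= st [x _ [/= sx tx]]; apply: st; rewrite sx tx.
by move=> h st; apply: h; exists (X s w).
Qed.

Lemma jump_time_lt_event n t : ae_process_events P X [set w | J n w < t].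
Proof.
have : ae_process_events P X [set w | exists2 s, rational_chain n t s &
    [set w | forall i, (i < n)%N -> [set w | X (ratr (nth 0 s i)) w <> X (ratr (nth 0 s i.+1)) w] w] w].
  apply: ae_process_events_count => s [s0 smono st].
  apply: ae_process_events_all => i iltn.
  by apply: ae_process_events_neq; apply: s0 => //; exact: ltnW.
by apply: ae_process_events_ae; exact: jump_time_lt_chain.
Qed.

(** The state is read at a rational time inside the [n]-th sojourn. Only events of the form [J < t]
    are available, so a second, larger rational witnesses that this time lies before [J n.+1]. *)
Lemma jump_state_event n y : ae_process_events P X [set w | Y n w = y].
Proof.
have : ae_process_events P X [set w | exists2 q : rat * rat,
      0 <= (ratr q.1 : R) /\ (ratr q.1 : R) < ratr q.2 &
    ([set w | J n w < ratr q.1] `&` ~` [set w | J n.+1 w < ratr q.2] `&`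
     [set w | X (ratr q.1) w = y]) w].
  apply: ae_process_events_count => -[p q] /= [p0 pq].
  apply: ae_process_eventsI.
    by apply: ae_process_eventsI; [|apply: ae_process_eventsC]; exact: jump_time_lt_event.
  by apply: ae_process_events_eq => //; exact: measurable_point_nat2.
apply: ae_process_events_ae; move: good; apply: filterS => w [H0 YY Joo XY]; split.
  move=> Yy; have : J n w < J n.+1 w by rewrite JS ltrDl.
  move=> /rat_in_itvoo[p]; rewrite inE/= => /itvP pP.
  have pJ : ratr p < J n.+1 w by rewrite pP.
  have /rat_in_itvoo[r] := pJ; rewrite inE/= => /itvP rP.
  have Jp : J n w < ratr p by rewrite pP.
  exists (p, r) => /=.
    by split; [rewrite -(J0 w) (le_trans _ (ltW Jp))// mono|rewrite rP].
  split; last by rewrite (XY n) ?(ltW Jp).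
  by split => //; apply/negP; rewrite -leNgt ltW// rP.
move=> [[p r] /= [p0 pr] [[Jp /negP]]]; rewrite -leNgt => rJ <-.
by rewrite (XY n)// (ltW Jp) (lt_le_trans pr).
Qed.

Lemma jump_grid_event n (h : R) m : 0 < h ->
  ae_process_events P X [set w | Num.truncn (h * J n w) = m].
Proof.
move=> h0; have : ae_process_events P X (~` [set w | J n w < m%:R / h] `&` [set w | J n w < m.+1%:R / h]).
  by apply: ae_process_eventsI; [apply: ae_process_eventsC|]; exact: jump_time_lt_event.
apply: ae_process_events_ae; move: good; apply: filterS => w [H0 _ _ _].
have Jn0 : 0 <= J n w by rewrite -(J0 w) mono.
have hJ0 : 0 <= h * J n w by rewrite mulr_ge0// ltW.
have e1 x : (J n w < x / h) = (h * J n w < x) by rewrite ltr_pdivlMr// mulrC.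
split => /=.
  move=> <-; have /andP[a b] := truncn_itv hJ0; rewrite !e1; split => //.
  by apply/negP; rewrite -leNgt.
by rewrite !e1 => -[/negP]; rewrite -leNgt => a b; apply: truncn_def; rewrite a b.
Qed.

End jump_events.

(* Largest multiple of [1 / r.+1] that is guaranteed to lie strictly below
   [s > 0] (it is [0] for [s = 0]). *)
Definition grid_below (R : realType) (r : nat) (s : R) : R :=
  (Num.truncn (r.+1%:R * s)).-1%:R / r.+1%:R.

(** * Left limits and inverses of increasing functions *)

Section grid.
Variable R : realType.
Implicit Types (s t u : R) (r : nat).

Lemma grid_below_ge0 r s : 0 <= grid_below r s.
Proof. by rewrite divr_ge0. Qed.

Lemma grid_below0 r : grid_below r (0 : R) = 0.
Proof. by rewrite /grid_below mulr0 truncn0 mul0r. Qed.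

Lemma grid_below_lt r s : 0 < s -> grid_below r s < s.
Proof.
move=> s0; have r0 : 0 < r.+1%:R :> R by [].
have rs0 : 0 <= r.+1%:R * s by rewrite mulr_ge0// ltW.
rewrite /grid_below ltr_pdivrMr// (mulrC s).
have /andP[h _] := truncn_itv rs0.
case E : (Num.truncn _) h => [|m] h /=; first by rewrite mulr_gt0.
by apply: lt_le_trans h; rewrite ltr_nat.
Qed.

Lemma grid_below_ge r s : 0 <= s -> s - 2 / r.+1%:R <= grid_below r s.
Proof.
move=> s0; have r0 : 0 < r.+1%:R :> R by [].
have rs0 : 0 <= r.+1%:R * s by rewrite mulr_ge0.
rewrite /grid_below lerBlDr -mulrDl ler_pdivlMr// mulrC.
have /andP[_ h] := truncn_itv rs0; apply: (le_trans (ltW h)).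
case: (Num.truncn _) => [|m] /=; first by rewrite add0r ler_nat.
by rewrite -natrD addn2.
Qed.

Lemma cvg_grid_below s : 0 <= s -> grid_below r s @[r --> \oo] --> s.
Proof.
move=> s0; apply: (@squeeze_cvgr _ _ _ _ (fun r => s - 2 / r.+1%:R) (fun=> s)).
- apply: nearW => r; rewrite grid_below_ge//=.
  move: s0; rewrite le_eqVlt => /predU1P[<-|s0]; first by rewrite grid_below0.
  exact/ltW/grid_below_lt.
- rewrite -[X in _ --> X]subr0; apply: cvgB; first exact: cvg_cst.
  rewrite -[X in _ --> X](mulr0 2); apply: cvgM; first exact: cvg_cst.
  exact: cvg_harmonic.
- exact: cvg_cst.
Qed.

Lemma le_grid_below r s t : s <= t -> grid_below r s <= grid_below r t.
Proof.
move=> st; rewrite ler_wpM2r ?invr_ge0// ler_nat -!subn1 leq_sub2r// le_truncn//.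
by rewrite ler_wpM2l.
Qed.

(* [f (s -)]; the set is empty at [s = 0], where the value is [sup set0 = 0] *)
Definition left_sup (f : R -> R) s := sup [set f u | u in [set u | 0 <= u < s]].

Variable f : R -> R.
Hypotheses (f0 : f 0 = 0) (fmono : forall s t, 0 <= s -> s < t -> f s < f t).

Let fle s t : 0 <= s -> s <= t -> f s <= f t.
Proof. by move=> s0; rewrite le_eqVlt => /predU1P[->//|st]; exact/ltW/fmono. Qed.

Lemma left_sup0 : left_sup f 0 = 0.
Proof.
rewrite /left_sup (_ : [set u | _] = set0) ?image_set0 ?sup0//.
by apply/seteqP; split => u //= /andP[u0]; rewrite ltNge u0.
Qed.

Let has s : 0 < s -> has_sup [set f u | u in [set u | 0 <= u < s]].
Proof.
move=> s0; split; first by exists (f 0), 0 => //=; rewrite lexx.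
by exists (f s) => _ [u /= /andP[u0 us] <-]; rewrite fle// ltW.
Qed.

Lemma left_sup_ub s u : 0 <= u -> u < s -> f u <= left_sup f s.
Proof.
move=> u0 us; apply: sup_upper_bound; first exact: has (le_lt_trans u0 us).
by exists u => //=; rewrite u0.
Qed.

Lemma left_sup_le s t : 0 < s -> (forall u, 0 <= u -> u < s -> f u <= t) -> left_sup f s <= t.
Proof.
move=> s0 h; apply: ge_sup; first by have [] := has s0.
by move=> _ [u /= /andP[u0 us] <-]; exact: h.
Qed.

Lemma left_sup_lt s t : 0 <= s -> s < t -> left_sup f s < left_sup f t.
Proof.
move=> s0 st; pose u := (s + t) / 2; pose v := (u + t) / 2.
have su : s < u by rewrite /u; lra.
have uv : u < v by rewrite /v /u; lra.
have vt : v < t by rewrite /v /u; lra.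
have u0 : 0 <= u by rewrite (le_trans s0)// ltW.
apply: (@le_lt_trans _ _ (f u)).
  move: s0; rewrite le_eqVlt => /predU1P[s0|s0].
    by rewrite -s0 left_sup0 -f0 fle.
  by apply: left_sup_le => // x x0 xs; rewrite fle// ltW// (lt_trans xs).
apply: (@lt_le_trans _ _ (f v)); first exact: fmono.
by apply: left_sup_ub => //; rewrite (le_trans u0)// ltW.
Qed.

(** For [s > 0] the grid points approach [s] from strictly below, so the limit is the left limit
    whether or not [f] jumps at [s]. *)
Lemma cvg_left_sup s : 0 <= s -> f (grid_below r s) @[r --> \oo] --> left_sup f s.
Proof.
rewrite le_eqVlt => /predU1P[<-|s0].
  rewrite left_sup0; under eq_fun do rewrite grid_below0 f0; exact: cvg_cst.
apply/cvgrPdist_le => e e0.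
have [_ [u /= /andP[u0 us] <-] fu] := sup_adherent e0 (has s0).
move/cvgr_gt: (cvg_grid_below (ltW s0)) => /(_ u us); apply: filterS => r ur.
have h1 : f (grid_below r s) <= left_sup f s.
  by apply: left_sup_ub; [exact: grid_below_ge0|exact: grid_below_lt].
have h2 : f u <= f (grid_below r s) by rewrite fle// ltW.
rewrite ger0_norm ?subr_ge0// lerBlDr -lerBlDl.
by apply: le_trans h2; exact: ltW.
Qed.

Hypothesis funb : forall c, exists s, 0 <= s /\ c < f s.

Let inv t := inf [set s | 0 <= s /\ t < f s].

Let hasi t : has_inf [set s | 0 <= s /\ t < f s].
Proof. by split; [exact: funb|exists 0 => s []]. Qed.

Lemma inverse_ge0 t : 0 <= inv t.
Proof. by apply: lb_le_inf => [|s []//]; exact: funb. Qed.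

(** The infimum reaches [s] exactly when no [u < s] has [f u > t]. The value of [f] at [s] itself
    does not matter, which is why the left limit appears. *)
Lemma le_inverse s t : 0 < s -> (s <= inv t) = (left_sup f s <= t).
Proof.
move=> s0; apply/idP/idP => [st|st].
  apply: left_sup_le => // u u0 us; rewrite leNgt; apply/negP => tf.
  have : inv t <= u by apply: ge_inf => //; have [] := hasi t.
  by rewrite leNgt (lt_le_trans us).
apply: lb_le_inf; first exact: funb.
move=> u [u0 tf]; rewrite leNgt; apply/negP => us.
by have := left_sup_ub u0 us; rewrite leNgt (le_lt_trans st).
Qed.

Lemma inverse_between s s' t : 0 <= s -> s < s' -> 0 <= t ->
  (s <= inv t < s') = (left_sup f s <= t < left_sup f s').
Proof.
move=> s0 ss t0; have -> : (inv t < s') = (t < left_sup f s').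
  by rewrite [LHS]ltNge (le_inverse _ (le_lt_trans s0 ss)) -ltNge.
suff -> : (s <= inv t) = (left_sup f s <= t) by [].
have [s1|s1] := ltP 0 s; first exact: le_inverse.
have -> : s = 0 by apply/eqP; rewrite eq_le s1.
by rewrite left_sup0 t0 inverse_ge0.
Qed.

Lemma left_sup_unbounded (J : nat -> R) : J n @[n --> \oo] --> +oo ->
  forall c, exists n, c < left_sup f (J n).
Proof.
move=> Joo c; have [s [s0 cs]] := funb c.
have [N _ /(_ N (leqnn N)) sJ] := (cvgryPgt _).1 Joo s.
by exists N; apply: (lt_le_trans cs); exact: left_sup_ub.
Qed.

End grid.

Section fibers.
Context d (T : measurableType d) (R : realType) (m : {measure set T -> \bar R})
  (I : countType) (W : T -> I).
Hypothesis mW : forall i, measurable [set x | W x = i].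

Lemma measurable_fun_count d' (U : measurableType d') (F : I -> T -> U) :
  (forall i, measurable_fun setT (F i)) -> measurable_fun setT (fun x => F (W x) x).
Proof.
move=> mF _ B mB; rewrite setTI.
rewrite (_ : _ @^-1` B = \bigcup_n (if @unpickle I n is Some i then
   [set x | W x = i] `&` F i @^-1` B else set0)).
  apply: bigcupT_measurable => n; case: unpickle => [i|]; last exact: measurable0.
  by apply: measurableI => //; exact: measurable_preimageT.
apply/seteqP; split => x /=.
  by move=> Bx; exists (pickle (W x)) => //; rewrite pickleK.
by move=> [n _]; case: unpickle => // i [/= <-].
Qed.

(** Lets an identity be checked for each value of a discrete variable, such as the grid cells of the
    jump times or the history of the chain. *)
Lemma integral_fibers (f g : T -> R) :
  measurable_fun setT f -> measurable_fun setT g ->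
  (forall x, 0 <= f x) -> (forall x, 0 <= g x) ->
  (forall i, \int[m]_x (`[< W x = i >]%:R * f x)%:E =
             \int[m]_x (`[< W x = i >]%:R * g x)%:E)%E ->
  (\int[m]_x (f x)%:E = \int[m]_x (g x)%:E)%E.
Proof.
move=> mf mg f0 g0 fg.
pose F n := [set x | pickle (W x) = n].
have mF n : measurable (F n).
  have := measurable_fun_count (F := fun i _ => pickle i) (fun i => measurable_cst (pickle i)).
  move=> /(_ measurableT [set n]); rewrite setTI; apply.
  by [].
have tF : trivIset setT F.
  by apply/trivIsetP => i j _ _ /eqP ij; apply/seteqP; split => x // -[/= xi xj]; apply: ij; rewrite -xi -xj.
have UF : \bigcup_n F n = setT by apply/seteqP; split => x // _; exists (pickle (W x)).
rewrite -UF !ge0_integral_bigcup//; last 4 first.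
- by rewrite UF; exact/measurable_EFinP.
- by move=> x _; rewrite lee_fin.
- by rewrite UF; exact/measurable_EFinP.
- by move=> x _; rewrite lee_fin.
apply: eq_eseriesr => n _.
have [[x0 Fx0]|/forallNP F0] := pselect (exists x, F n x); last first.
  by have -> : F n = set0; [apply/seteqP; split => x // /F0|rewrite !integral_set0].
have -> : F n = [set x | `[< W x = W x0 >]].
  apply/seteqP; split => x /=; rewrite /F/= -Fx0; last by move=> /asboolP ->.
  by move=> /(pcan_inj pickleK) ->; exact/asboolP.
by rewrite !integral_setb.
Qed.

End fibers.

Lemma process_events_measurable d (Omega : measurableType d) (R : realType) d'
    (E : measurableType d') (X : R -> Omega -> E) (A : set Omega) :
  (forall t, 0 <= t -> measurable_fun setT (X t)) ->
  process_events X A -> measurable A.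
Proof.
move=> mX; apply: smallest_sub; first exact: sigma_algebra_measurable.
by move=> _ [t [B [t0 mB ->]]]; apply: measurable_preimageT => //; exact: mX.
Qed.

Lemma ae_eq_measure d (T : measurableType d) (R : realType)
    (m : {measure set T -> \bar R}) (A B : set T) : measurable A -> measurable B ->
  {ae m, forall x, A x <-> B x} -> m A = m B.
Proof.
move=> mA mB AB; rewrite -(integral_natr_set m mA) -(integral_natr_set m mB).
apply: ae_eq_integral => //.
- by apply/measurable_EFinP; exact: measurable_natr_set.
- by apply/measurable_EFinP; exact: measurable_natr_set.
- by move: AB; apply: filterS => x ABx _; congr (_%:R)%:E; congr nat_of_bool; apply: asbool_equiv_eq.
Qed.

Section time_change.
Context d (Omega : measurableType d) (R : realType) (P : probability Omega R).
Variables (nu : R) (sigma : R -> Omega -> R) (X : R -> Omega -> nat * nat)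
  (Y : nat -> Omega -> nat * nat) (H : nat -> Omega -> R).
Hypotheses (nu0 : 0 < nu) (sub : is_stable_subordinator P nu sigma)
  (mX : forall t, 0 <= t -> measurable_fun setT (X t))
  (indep : independent_processes P X sigma)
  (mY : forall n, measurable_fun setT (Y n)) (mH : forall n, measurable_fun setT (H n))
  (H0 : forall n w, 0 <= H n w).
Let J n w := \sum_(i < n) H i w.
Hypothesis good : {ae P, forall w,
  [/\ forall n, 0 < H n w, forall n, Y n w <> Y n.+1 w,
      J n w @[n --> \oo] --> +oo &
      forall n t, J n w <= t < J n.+1 w -> X t w = Y n w]}.

Let ms t : 0 <= t -> measurable_fun setT (sigma t).
Proof. by case: sub => + _ _ _ _ t0; apply. Qed.

Let J0 n w : 0 <= J n w. Proof. by apply: sumr_ge0. Qed.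

Let JS n w : J n.+1 w = J n w + H n w. Proof. by rewrite /J big_ord_recr. Qed.

Let mJ n : measurable_fun setT (J n).
Proof. by apply: measurable_sum => i. Qed.

Let mtrunc n (h : R) m : measurable [set w | Num.truncn (h * J n w) = m].
Proof.
have mh : measurable_fun setT (fun w => h * J n w) by apply: measurable_funM.
have m1 := @measurable_fun_ler _ _ _ setT (fun=> m%:R) _ (measurable_cst _) mh.
have m2 := @measurable_fun_ltr _ _ _ setT _ (fun=> m.+1%:R) mh (measurable_cst _).
have m3 := @measurable_fun_ltr _ _ _ setT _ (fun=> 0) mh (measurable_cst _).
(* [Num.truncn] is 0 on negative arguments, and the sign of [h] is arbitrary here. *)
pose b w := (if h * J n w < 0 then m == 0%N else (m%:R <= h * J n w) && (h * J n w < m.+1%:R)).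
have mb : measurable_fun setT b.
  by apply: measurable_fun_ifT => //; apply: measurable_and.
have := mb measurableT [set true] I; rewrite setTI; congr measurable.
apply/seteqP; split => w /=; rewrite /b; case: ltP => h0.
- by move=> /eqP ->; apply/truncn0Pn; rewrite -ltNge (lt_trans h0).
- by move=> /truncn_def.
- by move=> <-; apply/eqP/truncn0Pn; rewrite -ltNge (lt_trans h0).
- by move=> <-; exact: truncn_itv.
Qed.

Let mgrid r n : measurable_fun setT (fun w => grid_below r (J n w)).
Proof.
pose F (m : nat) (_ : Omega) : R := m.-1%:R / r.+1%:R.
have mF m : measurable_fun setT (F m) by exact: measurable_cst.
exact: (@measurable_fun_count _ _ nat (fun w => Num.truncn (r.+1%:R * J n w))
  (fun m => mtrunc n r.+1%:R m) _ _ F mF).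
Qed.

Lemma measurable_grid r n :
  measurable_fun setT (fun w => sigma (grid_below r (J n w)) w).
Proof.
apply: (@measurable_fun_count _ _ nat (fun w => Num.truncn (r.+1%:R * J n w)) _ _ _
  (fun m w => sigma (m.-1%:R / r.+1%:R) w)).
  by move=> m; exact: mtrunc.
by move=> m; apply: ms; rewrite divr_ge0.
Qed.

Lemma independent_ae_events (A B : set Omega) : measurable A ->
  ae_process_events P X A -> process_events sigma B -> (P (A `&` B) = P A * P B)%E.
Proof.
move=> mA [A' FA' AA'] FB.
have mA' := process_events_measurable mX FA'.
have mB := process_events_measurable ms FB.
rewrite (ae_eq_measure mA mA' AA') -(indep FA' FB); apply: ae_eq_measure; [exact: measurableI|exact: measurableI|].
by move: AA'; apply: filterS => w h; split => -[/h ? ?].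
Qed.

Section fixed_history.
Variables (n : nat) (y : nat -> nat * nat) (b : nat -> R).
Hypothesis b0 : forall i, 0 <= b i.
Let B := [set w | forall i, (i <= n)%N -> Y i w = y i].

Let Bevent (r : nat) (s : nat -> nat) :=
  B `&` [set w | forall i, (i < n.+1)%N -> Num.truncn (r.+1%:R * J i w) = s i].

Let Bevent_ae r s : ae_process_events P X (Bevent r s).
Proof.
apply: ae_process_eventsI.
  rewrite (_ : B = [set w | forall i, (i < n.+1)%N -> [set w | Y i w = y i] w])//.
  by apply: ae_process_events_all => i _; exact: (jump_state_event good).
apply: (@ae_process_events_all _ _ _ P _ _ X n.+1 (fun i => [set w | Num.truncn (r.+1%:R * J i w) = s i])) => i _.
exact: (jump_grid_event good).
Qed.

Let mB : measurable B. Proof. exact: measurable_cylinder. Qed.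

Let mBevent r s : measurable (Bevent r s).
Proof.
apply: measurableI => //.
rewrite (_ : [set w | _] = \bigcap_(i in [set i | (i < n.+1)%N]) [set w | Num.truncn (r.+1%:R * J i w) = s i]).
  by apply: bigcap_measurableType => i _; exact: mtrunc.
by apply/seteqP; split => w /=.
Qed.

(** [minn i n] freezes the times after index [n]: independence of increments is stated for infinite
    nondecreasing sequences. *)
Let tau (r : nat) (s : nat -> nat) i : R := (s (minn i n)).-1%:R / r.+1%:R.

Let tauE r s i w : (i <= n)%N -> Bevent r s w -> grid_below r (J i w) = tau r s i.
Proof. by move=> iln [_ /(_ i iln) /= h]; rewrite /grid_below h /tau (minn_idPl iln). Qed.

(* Once the grid cells of the jump times are fixed to [s], the process [sigma]
   is evaluated at deterministic times, and independence applies. *)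
Let fixed_grid r s :
  (\int[P]_w (`[< Bevent r s w >]%:R * \prod_(i < n) expR (- (b i * (sigma (tau r s i.+1) w - sigma (tau r s i) w))))%:E =
   \int[P]_w (`[< Bevent r s w >]%:R * \prod_(i < n) expR (- (b i `^ nu * (tau r s i.+1 - tau r s i))))%:E)%E.
Proof.
(* The cells of an actual path are nondecreasing; for any other [s] the event is empty and both
   sides vanish. *)
have [taumono|ntau] := pselect (forall i, tau r s i <= tau r s i.+1); last first.
  have B0 w : ~ Bevent r s w.
    move=> Bw; apply: ntau => i; have [iltn|nlei] := ltnP i n.
      rewrite -!(tauE _ Bw)//; last exact: ltnW.
      by apply: le_grid_below; rewrite JS lerDl.
    by rewrite /tau !(minn_idPr _)//; exact: leqW.
  by rewrite !integral0_eq// => w _; case: asboolP => [/B0//|_]; rewrite mul0r.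
have tau_ge0 i : 0 <= tau r s i by rewrite divr_ge0.
pose g w := \prod_(i < n) expR (- (b i * (sigma (tau r s i.+1) w - sigma (tau r s i) w))).
have g0 w : 0 <= g w by apply: prodr_ge0 => i _; exact: expR_ge0.
have mg : measurable_fun setT g.
  by apply: measurable_prod => i _; apply: measurable_expRNM; apply: measurable_funB; exact: ms.
have gevent (S : set R) : measurable S -> process_events sigma (g @^-1` S).
  pose F := g_sigma_algebraType [set A | exists t (B : set R),
        [/\ 0 <= t, measurable B & A = sigma t @^-1` B]].
  have msF t : 0 <= t -> measurable_fun (setT : set F) (sigma t).
    move=> t0 _ C mC; rewrite setTI; apply: sub_sigma_algebra.
    by exists t, C.
  have mgF : measurable_fun (setT : set F) g.
    by apply: measurable_prod => i _; apply: measurable_expRNM; apply: measurable_funB; exact: msF.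
  by move=> mS; have := mgF measurableT S mS; rewrite setTI.
set A := Bevent r s.
have mA : measurable A by exact: mBevent.
have PA0 : 0 <= fine (P A) by rewrite fine_ge0.
have law S : measurable S -> weighted_law P (fun w => `[< A w >]%:R) g S = weighted_law P (fun=> fine (P A)) g S.
  move=> mS; rewrite weighted_law_cst// fineK ?fin_num_measure//.
  have mgS := measurable_preimageT mg mS.
  transitivity (P (A `&` (g @^-1` S))); last first.
    by apply: independent_ae_events; [exact: mBevent|exact: Bevent_ae|exact: gevent].
  rewrite weighted_law_natr_set -(integral_natr_set P (measurableI _ _ mA mgS)).
  apply: eq_integral => w _; rewrite -natrM mulnb andbC; congr (_%:R)%:E.
  by congr nat_of_bool; rewrite -asbool_and.
have mnA : measurable_fun setT (fun w => `[< A w >]%:R : R) by exact: measurable_natr_set.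
(* The test function must be nonnegative on the whole line; [max 0] is the identity on the values of
   [g]. *)
have := @weighted_law_integral_eq R _ _ _ _ P (fun w => `[< A w >]%:R) g _ _ P (fun=> fine (P A)) g (fun x => Num.max 0 x)
  mnA (fun w => ler0n _ _) mg (measurable_cst _) (fun=> PA0) mg
  (measurable_maxr (measurable_cst _) (@measurable_id _ _ _)) (fun x => ltac:(by rewrite le_max lexx)) law.
under eq_integral do rewrite max_r// mulrC.
move=> ->; under eq_integral do rewrite max_r// mulrC EFinM.
rewrite ge0_integralZl_EFin//; last 2 first.
  by move=> w _; rewrite lee_fin.
  exact/measurable_EFinP.
rewrite (subordinator_increments_laplace nu0 sub n (tau_ge0 0%N) taumono b0).
under [RHS]eq_integral do rewrite mulrC EFinM.
rewrite ge0_integralZl_EFin//; last 2 first.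
- by apply/measurable_EFinP; apply: measurable_natr_set; exact: mBevent.
- by apply: prodr_ge0 => i _; exact: expR_ge0.
rewrite integral_natr_set; last exact: mBevent.
rewrite fineK ?fin_num_measure//.
rewrite muleC; congr (_%:E * _)%E; apply: eq_bigr => i _; congr (expR (- _)).
by rewrite mulrC.
Qed.

(** [fixed_grid] gathered over the countably many cells. The absolute values change nothing almost
    surely, and they keep the integrands between 0 and 1 on every path, as the passage to the limit
    requires. *)
Let discrete_time_change r :
  (\int[P]_w (`[< B w >]%:R * \prod_(i < n) expR (- (b i *
      `|sigma (grid_below r (J i.+1 w)) w - sigma (grid_below r (J i w)) w|)))%:E =
   \int[P]_w (`[< B w >]%:R * \prod_(i < n) expR (- (b i `^ nu *
      (grid_below r (J i.+1 w) - grid_below r (J i w)))))%:E)%E.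
Proof.
pose W w := mkseq (fun i => Num.truncn (r.+1%:R * J i w)) n.+1.
have WE w s : (W w == s) = (size s == n.+1) && [forall i : 'I_n.+1, Num.truncn (r.+1%:R * J i w) == nth 0%N s i].
  apply/eqP/andP => [<-|[/eqP ss /forallP h]].
    rewrite size_mkseq eqxx; split => //; apply/forallP => i.
    by rewrite nth_mkseq.
  apply: (@eq_from_nth _ 0%N); first by rewrite size_mkseq.
  by rewrite size_mkseq => i iln; rewrite nth_mkseq//; exact/eqP/(h (Ordinal iln)).
have mW s : measurable [set w | W w = s].
  rewrite (_ : [set w | _] = if size s == n.+1 then \bigcap_(i in [set i | (i < n.+1)%N])
      [set w | Num.truncn (r.+1%:R * J i w) = nth 0%N s i] else set0).
    case: ifP => _ //; apply: bigcap_measurableType => i _; exact: mtrunc.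
  apply/seteqP; split => w /=.
    move=> /eqP; rewrite WE; case: eqP => //= _ /forallP h i iln.
    exact/eqP/(h (Ordinal iln)).
  case: ifP => // ss h; apply/eqP; rewrite WE ss; apply/forallP => i.
  by apply/eqP; exact: (h i (ltn_ord i)).
apply: (integral_fibers mW).
- apply: measurable_funM; first exact: measurable_natr_set.
  apply: measurable_prod => i _; apply: measurable_expRNM.
  by apply: measurableT_comp => //; apply: measurable_funB; exact: measurable_grid.
- apply: measurable_funM; first exact: measurable_natr_set.
  apply: measurable_prod => i _; apply: measurableT_comp => //.
  by apply: measurableT_comp => //; apply: measurable_funM => //; exact: measurable_funB.
- by move=> w; rewrite mulr_ge0// prodr_ge0// => i _; exact: expR_ge0.
- by move=> w; rewrite mulr_ge0// prodr_ge0// => i _; exact: expR_ge0.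
move=> s; have [ss|ss] := eqVneq (size s) n.+1; last first.
  rewrite !integral0_eq// => w _; case: asboolP => [/eqP|_]; rewrite ?mul0r//.
  by rewrite WE (negbTE ss).
  by rewrite WE (negbTE ss).
have BE w : `[< W w = s >]%:R * `[< B w >]%:R = `[< Bevent r (nth 0%N s) w >]%:R :> R.
  rewrite -natrM mulnb; congr (_%:R); congr nat_of_bool; rewrite -asbool_and.
  apply: asbool_equiv_eq; split.
    move=> [/eqP]; rewrite WE => /andP[_ /forallP h] Bw; split => // i iln.
    exact/eqP/(h (Ordinal iln)).
  move=> [Bw h]; split => //; apply/eqP; rewrite WE ss eqxx; apply/forallP => i.
  by apply/eqP; exact: (h i (ltn_ord i)).
have := fixed_grid r (nth 0%N s).
rewrite (_ : (\int[P]_w _)%E = (\int[P]_w (`[< W w = s >]%:R * (`[< B w >]%:R * \prod_(i < n) expR (- (b i *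
      `|sigma (grid_below r (J i.+1 w)) w - sigma (grid_below r (J i w)) w|))))%:E)%E).
  move=> ->; apply: eq_integral => w _; rewrite mulrA BE; case: asboolP => [Bw|_]; last by rewrite !mul0r.
  congr (_ * _)%:E; apply: eq_bigr => i _.
  by rewrite -!(tauE _ Bw)// ltnW.
have [_ mono _ _ _] := sub.
apply: ae_eq_integral => //.
- apply/measurable_EFinP/measurable_funM; first exact: measurable_natr_set.
  by apply: measurable_prod => i _; apply: measurable_expRNM; apply: measurable_funB; apply: ms; rewrite divr_ge0.
- apply/measurable_EFinP/measurable_funM; first exact: measurable_natr_set (mW s).
  apply: measurable_funM; first exact: measurable_natr_set mB.
  apply: measurable_prod => i _; apply: measurable_expRNM.
  by apply: measurableT_comp => //; apply: measurable_funB; exact: measurable_grid.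
- move: mono; apply: filterS => w [_ mono _] _; rewrite mulrA BE.
  case: asboolP => [Bw|_]; last by rewrite !mul0r.
  congr (_ * _)%:E; apply: eq_bigr => i _.
  rewrite -!(tauE _ Bw)//; last exact: ltnW.
  rewrite ger0_norm// subr_ge0 mono ?grid_below_ge0//.
  by apply: le_grid_below; rewrite JS lerDl.
Qed.

Lemma integral_time_change (A : nat -> Omega -> R) :
  (forall i, measurable_fun setT (A i)) -> (forall i w, A i w <= A i.+1 w) ->
  {ae P, forall w, forall i, sigma (grid_below r (J i w)) w @[r --> \oo] --> A i w} ->
  (\int[P]_w (`[< B w >]%:R * \prod_(i < n) expR (- (b i * (A i.+1 w - A i w))))%:E =
   \int[P]_w (`[< B w >]%:R * \prod_(i < n) expR (- (b i `^ nu * H i w)))%:E)%E.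
Proof.
move=> mA monoA cA.
have bound (c : nat -> R) w : (forall i, 0 <= c i) ->
    (`| (`[< B w >]%:R * \prod_(i < n) expR (- c i))%:E | <= (1 : R)%:E)%E.
  move=> c0; have p0 : 0 <= \prod_(i < n) expR (- c i) by apply: prodr_ge0 => i _; exact: expR_ge0.
  rewrite abse_EFin lee_fin ger0_norm ?mulr_ge0//.
  apply: mulr_ile1 => //; first by case: (`[< _ >]); rewrite ?lexx ?ler01.
  apply: prodr_ile1 => i _; rewrite expR_ge0/= -[leRHS]expR0 ler_expR oppr_le0.
  exact: c0.
have cvgprod (c : nat -> nat -> R) (l : nat -> R) w :
    (forall i, c r i @[r --> \oo] --> l i) ->
    ((`[< B w >]%:R * \prod_(i < n) expR (- c r i))%:E @[r --> \oo] -->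
    (`[< B w >]%:R * \prod_(i < n) expR (- l i))%:E)%E.
  move=> cl; apply: cvg_EFin; first exact: nearW.
  apply: cvgM; first exact: cvg_cst.
  apply: cvg_big => [|i _]; first exact: mul_continuous.
  by apply: continuous_cvg; [exact: continuous_expR|exact: cvgN].
have int1 : P.-integrable setT (fun=> (1 : R)%:E).
  exact: finite_measure_integrable_cst.
have mprod (c : nat -> Omega -> R) : (forall i, measurable_fun setT (c i)) ->
    measurable_fun setT (fun w => (`[< B w >]%:R * \prod_(i < n) expR (- c i w))%:E).
  move=> mc; apply/measurable_EFinP/measurable_funM; first exact: measurable_natr_set.
  apply: measurable_prod => i _; apply: measurableT_comp => //.
  exact: measurableT_comp.
have DCT (c : nat -> nat -> Omega -> R) (l : nat -> Omega -> R) :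
    (forall r i, measurable_fun setT (c r i)) -> (forall i, measurable_fun setT (l i)) ->
    (forall r i w, 0 <= c r i w) ->
    {ae P, forall w, forall i, c r i w @[r --> \oo] --> l i w} ->
    (\int[P]_w (`[< B w >]%:R * \prod_(i < n) expR (- c r i w))%:E @[r --> \oo] -->
     \int[P]_w (`[< B w >]%:R * \prod_(i < n) expR (- l i w))%:E)%E.
  move=> mc ml c0 cl.
  have [||||_ _ //] := @dominated_convergence _ _ R P setT measurableT
    (fun r w => (`[< B w >]%:R * \prod_(i < n) expR (- c r i w))%:E)
    (fun w => (`[< B w >]%:R * \prod_(i < n) expR (- l i w))%:E) _ _ _ _ int1.
  - by move=> r; exact: mprod.
  - exact: mprod.
  - move: cl; apply: filterS => w clw _.
    exact: (cvgprod (fun r i => c r i w) (fun i => l i w)).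
  - by apply: aeW => w r _; apply: (bound (fun i => c r i w)).
have c1 := DCT (fun r i w => b i * `|sigma (grid_below r (J i.+1 w)) w - sigma (grid_below r (J i w)) w|)
  (fun i w => b i * (A i.+1 w - A i w)).
have c2 := DCT (fun r i w => b i `^ nu * (grid_below r (J i.+1 w) - grid_below r (J i w)))
  (fun i w => b i `^ nu * H i w).
have {}c1 : (\int[P]_w (`[< B w >]%:R * \prod_(i < n) expR (- (b i *
      `|sigma (grid_below r (J i.+1 w)) w - sigma (grid_below r (J i w)) w|)))%:E @[r --> \oo] -->
    \int[P]_w (`[< B w >]%:R * \prod_(i < n) expR (- (b i * (A i.+1 w - A i w))))%:E)%E.
  apply: c1.
  - by move=> r i; apply: measurable_funM => //; apply: measurableT_comp => //; apply: measurable_funB; exact: measurable_grid.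
  - by move=> i; apply: measurable_funM => //; exact: measurable_funB.
  - by move=> r i w; rewrite mulr_ge0.
  move: cA; apply: filterS => w cA i; apply: cvgM; first exact: cvg_cst.
  rewrite -[A i.+1 w - A i w]ger0_norm ?subr_ge0//.
  by apply: cvg_norm; apply: cvgB; exact: cA.
have {}c2 : (\int[P]_w (`[< B w >]%:R * \prod_(i < n) expR (- (b i `^ nu *
      (grid_below r (J i.+1 w) - grid_below r (J i w)))))%:E @[r --> \oo] -->
    \int[P]_w (`[< B w >]%:R * \prod_(i < n) expR (- (b i `^ nu * H i w)))%:E)%E.
  apply: c2.
  - by move=> r i; apply: measurable_funM => //; exact: measurable_funB.
  - by move=> i; exact: measurable_funM.
  - by move=> r i w; rewrite mulr_ge0 ?powR_ge0// subr_ge0 le_grid_below// JS lerDl.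
  - apply: aeW => w i; apply: cvgM; first exact: cvg_cst.
    rewrite [X in _ --> X](_ : _ = J i.+1 w - J i w); last by rewrite JS addrAC subrr add0r.
    by apply: cvgB; exact: cvg_grid_below.
rewrite (funext discrete_time_change) in c1.
exact: (cvg_unique (@ereal_hausdorff R) c1 c2).
Qed.

End fixed_history.
End time_change.

Lemma queue_step_neq k x z : (1 <= k)%N -> queue_step k x z -> x <> z.
Proof.
move=> k1 [[-> ->] //|[/and3P[n1 s1 sk] [->|->]]].
  by case: x n1 s1 sk => n s _ _ _ [] /=; lia.
case: x n1 s1 sk => n s /= n1 s1 sk; rewrite /phase_end/=.
by case: ifP => h; [|case: ifP => h'] => -[]; lia.
Qed.

(** An almost sure property need not define a measurable set. A measurable one of full measure
    inside it allows random variables to be defined by cases. *)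
Lemma ae_measurable_set d (T : measurableType d) (R : realType)
    (m : {measure set T -> \bar R}) (Q : T -> Prop) : {ae m, forall x, Q x} ->
  exists2 G, measurable G & {ae m, forall x, G x} /\ forall x, G x -> Q x.
Proof.
move=> [N [mN N0 QN]]; exists (~` N); first exact: measurableC.
by split; [exact: null_set_ae|move=> x Nx; apply: contrapT => /QN].
Qed.

Section fractional_jump_chain.
Context d (Omega : measurableType d) (R : realType) (P : probability Omega R).
Variables (lambda mu nu : R) (k : nat) (Q : R -> Omega -> nat * nat)
  (sigma : R -> Omega -> R).
Hypotheses (lambda0 : 0 < lambda) (mu0 : 0 < mu) (k1 : (1 <= k)%N) (nu0 : 0 < nu).
Hypotheses (queueQ : is_erlang_queue P lambda mu k Q)
  (sub : is_stable_subordinator P nu sigma) (indep : independent_processes P Q sigma).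
Notation q := (queue_rate lambda mu k).

(** In semi-Markov form: the jump chain is that of [Q], while the factor with [nu]-th powers is the
    transform of a Mittag-Leffler holding time. *)
Lemma fractional_jump_chain : exists (Y : nat -> Omega -> nat * nat) (A : nat -> Omega -> R),
  [/\ forall n, measurable_fun setT (Y n),
      forall n, measurable_fun setT (A n) /\ forall w, A n w <= A n.+1 w,
      {ae P, forall w, [/\ A 0 w = 0, forall n, A n w < A n.+1 w,
        forall c, exists n, c < A n w &
        forall n t, A n w <= t < A n.+1 w -> fractional_queue Q sigma t w = Y n w]},
      {ae P, forall w, [/\ forall n, queue_state k (Y n w),
        forall n, queue_step k (Y n w) (Y n.+1 w) &
        forall n, busy_state k (Y n w) ->
          exists j, Y (n + j)%N w <> ((Y n w).1 + j, (Y n w).2)%N]} &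
      forall n (y : nat -> nat * nat) (b : nat -> R),
        (forall i, (i <= n)%N -> queue_state k (y i)) -> (forall i, 0 <= b i) ->
        (\int[P]_w (`[< forall i, (i <= n)%N -> Y i w = y i >]%:R *
            \prod_(i < n) expR (- (b i * (A i.+1 w - A i w))))%:E =
         (fine (P [set w | Y 0%N w = y 0%N]) *
           \prod_(i < n) (q (y i) (y i.+1) / (exit_rate q (y i) + b i `^ nu)))%:E)%E].
Proof.
have [mQ _] := queueQ.
have [Y [H /= [mY mH H0 path law]]] := ctmc_jump_chain measurable_point_nat2
  (queue_rate_ge0 lambda0 mu0 k1) (exit_rate_gt0 lambda0 mu0 k1) queueQ.
have cyl n y : (forall i, (i <= n)%N -> queue_state k (y i)) ->
  P [set w | forall i, (i <= n)%N -> Y i w = y i] =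
  (fine (P [set w | Y 0%N w = y 0%N]) *
    \prod_(i < n) (q (y i) (y i.+1) / exit_rate q (y i)))%:E.
  move=> Sy; have := law n y (fun=> 0) Sy (fun=> lexx _).
  under [X in _ = (_ * X)%:E -> _]eq_bigr do rewrite addr0.
  move=> <-; rewrite -(integral_natr_set P (measurable_cylinder mY n y)).
  apply: eq_integral => w _; rewrite big1 ?mulr1// => i _.
  by rewrite mul0r oppr0 expR0.
have Yae : {ae P, forall w, forall n, queue_state k (Y n w)}.
  by move: path; apply: filterS => w [].
have steps := queue_steps_ae lambda0 mu0 k1 mY Yae cyl.
have unstuck := queue_unstuck_ae lambda0 mu0 k1 mY Yae cyl.
pose J n w := \sum_(i < n) H i w.
have J0 n w : 0 <= J n w by apply: sumr_ge0.
have JS n w : J n.+1 w = J n w + H n w by rewrite /J big_ord_recr.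
have good : {ae P, forall w, [/\ forall n, 0 < H n w, forall n, Y n w <> Y n.+1 w,
      J n w @[n --> \oo] --> +oo & forall n t, J n w <= t < J n.+1 w -> Q t w = Y n w]}.
  move: path steps; apply: filterS2 => w [Sw Hw Jw Qw] st; split => // n.
  exact: queue_step_neq (st n).
have sgood : {ae P, forall w, [/\ sigma 0 w = 0,
    forall s t, 0 <= s -> s < t -> sigma s w < sigma t w &
    forall c, exists s, 0 <= s /\ c < sigma s w]}.
  have [_ mono _ _ _] := sub.
  move: mono (subordinator_increasing_ae nu0 sub) (subordinator_unbounded_ae nu0 sub).
  apply: filterS3 => w [s0 _ _] inc unb; split => // c.
  by have [n cn] := unb c; exists n%:R.
have [G mG [aeG GP]] := ae_measurable_set (filterI good sgood).
(* Outside [G] the paths of [sigma] are arbitrary; the value 0 there keeps [A n] measurable, as a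
   limit of grid values, and nondecreasing in [n] on every path. *)
pose A n w := if w \in G then left_sup (sigma ^~ w) (J n w) else 0.
have Alim n w : `[< G w >]%:R * sigma (grid_below r (J n w)) w @[r --> \oo] --> A n w.
  rewrite /A; case: ifPn => [|].
    rewrite inE => Gw; have [[_ _ _ _] [s0 smono _]] := GP w Gw.
    by rewrite asboolT//; under eq_fun do rewrite mul1r; exact: cvg_left_sup.
  rewrite notin_setE => Gw; rewrite asboolF//.
  by under eq_fun do rewrite mul0r; exact: cvg_cst.
have mA n : measurable_fun setT (A n).
  apply: (measurable_fun_cvg (h := fun r w => `[< G w >]%:R * sigma (grid_below r (J n w)) w)) => //.
  move=> r; apply: measurable_funM; first exact: measurable_natr_set.
  exact: (measurable_grid sub mH).
have AG n w : G w -> A n w = left_sup (sigma ^~ w) (J n w) by move=> Gw; rewrite /A ifT ?inE.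
have Alt n w : G w -> A n w < A n.+1 w.
  move=> Gw; have [[Hw _ _ _] [s0 smono _]] := GP w Gw.
  by rewrite !AG// left_sup_lt// JS ltrDl.
have AleS n w : A n w <= A n.+1 w.
  have [Gw|Gw] := pselect (G w); first exact/ltW/Alt.
  by rewrite /A !ifN// notin_setE.
have A0 w : A 0 w = 0.
  by rewrite /A; case: ifP => // _; rewrite /J big_ord0 left_sup0.
exists Y, A; split => //.
- move: aeG; apply: filterS => w Gw.
  have [[Hw Yw Jw Qw] [s0 smono sunb]] := GP w Gw; split => //.
  + by move=> n; exact: Alt.
  + move=> c; have [n cn] := left_sup_unbounded smono sunb Jw c.
    by exists n; rewrite AG.
  move=> n t /[dup] Ant; rewrite !AG//.
  have t0 : 0 <= t.
    case/andP: Ant => /(le_trans _) + _; apply; rewrite -(A0 w).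
    by elim: n => // n IH; exact: le_trans (AleS n w).
  rewrite -(inverse_between smono sunb)//; last by rewrite JS ltrDl.
  exact: Qw.
- move: Yae steps unstuck; exact: filterS3.
move=> n y b Sy b0; have bnu0 i : 0 <= b i `^ nu by exact: powR_ge0.
rewrite -(law n y _ Sy bnu0).
apply: (integral_time_change nu0 sub mQ indep mY mH H0 good) => //.
by move: aeG; apply: filterS => w Gw i; have := Alim i w; rewrite asboolT//; under eq_fun do rewrite mul1r.
Qed.

End fractional_jump_chain.

(** * Service times along a trajectory *)

Definition starts_service (k : nat) (x z : nat * nat) : bool :=
  ((x == (0, 0)%N) && (z == (1%N, k))) || [&& (2 <= x.1)%N, x.2 == 1%N & z == (x.1.-1, k)].

Definition completes_service (k : nat) (x z : nat * nat) : bool :=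
  ((x == (1, 1)%N) && (z == (0, 0)%N)) || [&& (2 <= x.1)%N, x.2 == 1%N & z == (x.1.-1, k)].

(** A residual service at time 0 is not counted, so the service numbered [m] is in progress at count
    [m.+1], and count 0 precedes all services. *)
Fixpoint service_count (k : nat) (y : nat -> nat * nat) (i : nat) : nat :=
  if i is j.+1 then service_count k y j + starts_service k (y j) (y j.+1)
  else (1 <= (y 0%N).1)%N && ((y 0%N).2 == k).

Definition starting k (y : nat -> nat * nat) i : bool :=
  if i is j.+1 then starts_service k (y j) (y j.+1) else service_count k y 0 == 1%N.

(** The count stays at [m.+1] in an empty system left behind by the [m]-th service, hence the second
    condition. *)
Definition serving k y m i := (service_count k y i == m.+1) && (y i != (0, 0)%N).

Lemma service_count_mono k y i j : (i <= j)%N -> (service_count k y i <= service_count k y j)%N.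
Proof.
move=> /subnK <-; elim: (j - i)%N => // m IH.
by rewrite addSn /= (leq_trans IH)// leq_addr.
Qed.

Section service_intervals.
Variables (k : nat) (y : nat -> nat * nat).
Hypotheses (k1 : (1 <= k)%N) (Sy : forall n, queue_state k (y n))
  (steps : forall n, queue_step k (y n) (y n.+1))
  (unstuck : forall n, busy_state k (y n) -> exists j, y (n + j)%N <> ((y n).1 + j, (y n).2)%N).
Notation count := (service_count k y).
Notation start i := (starts_service k (y i) (y i.+1)).
Notation compl i := (completes_service k (y i) (y i.+1)).

Let busyP i : busy_state k (y i) = (y i != (0, 0)%N).
Proof.
by case: (Sy i) => [b|->//]; rewrite b; case: (y i) b => -[|n] s; case/and3P.
Qed.

Let step_empty i : y i = (0, 0)%N -> start i /\ ~~ compl i.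
Proof.
move=> yi; have := steps i; rewrite /queue_step /starts_service /completes_service yi.
by move=> [[_ ->]|[]//]; rewrite !eqxx; split.
Qed.

Let step_compl i : compl i -> y i != (0, 0)%N /\ (start i \/ y i.+1 = (0, 0)%N).
Proof.
rewrite /completes_service /starts_service => /orP[/andP[/eqP -> /eqP ->]|].
  by split => //; right.
case: (y i) => n s /= /and3P[n2 /eqP-> /eqP ->] /=; split.
  by apply/negP => /eqP [] n0; rewrite n0 in n2.
by left; rewrite n2 !eqxx orbT.
Qed.

Let step_busy i : y i != (0, 0)%N -> ~~ compl i -> y i.+1 != (0, 0)%N /\ ~~ start i.
Proof.
rewrite -busyP => bi; have := steps i; rewrite /queue_step.
move=> [[yi _]|[_]]; first by move: bi; rewrite yi.
rewrite /completes_service /starts_service; case: (y i) bi => n s /and3P[/= n1 s1 sk] [->|->] /=.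
  rewrite !xpair_eqE /= => _; split => //; rewrite negb_or; apply/andP; split.
    by apply/negP; lia.
  by apply/negP => /and3P[_ _ /andP[/eqP]]; lia.
rewrite /phase_end/=; case: ifP => s2.
  rewrite !xpair_eqE /= => _; split; first by lia.
  by rewrite negb_or; apply/andP; split; apply/negP; lia.
have -> : s = 1%N by lia.
case: ifP => n2; first by rewrite !eqxx orbT.
have -> : n = 1%N by lia.
by rewrite eqxx.
Qed.

Let count_mono := @service_count_mono k y.

(** Strong induction on the current phase. Arrivals do not go on forever, so at some step a phase
    ends: either the service ends with it, and another one begins at once or at the jump out of the
    empty state, or a smaller phase is reached. *)
Let start_after i : exists2 j, (i <= j)%N & start j.
Proof.
have [yi|yi] := eqVneq (y i) (0, 0)%N; first by exists i => //; case: (step_empty yi).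
move: yi; move Es : (y i).2 => s; elim/ltn_ind: s i Es => s IH i Es yi.
have ex : exists j, y (i + j)%N != ((y i).1 + j, (y i).2)%N.
  by have [|j /eqP] := @unstuck i; [rewrite busyP|exists j].
case: (ex_minnP ex) => j yj jmin.
have j0 : j = j.-1.+1.
  by case: j yj {jmin} => //; rewrite !addn0; case: (y i) => ? ?; rewrite eqxx.
have yj1 : y (i + j.-1)%N = ((y i).1 + j.-1, (y i).2)%N.
  by apply/eqP; apply: contrapT => /negP /jmin; rewrite {1}j0 ltnn.
set h := (i + j.-1)%N in yj1.
have hS : h.+1 = (i + j)%N by rewrite j0 /h addnS.
have yh : y h != (0, 0)%N.
  by move: yi; rewrite yj1; case: (y i) => -[|n] [|t]; rewrite !xpair_eqE/= ?add0n ?andbT ?andbF//;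
     rewrite ?addSn.
have ih : (i <= h)%N by exact: leq_addr.
have := steps h; rewrite /queue_step; case=> [[y0]|[bh []]].
- by rewrite y0 in yh.
- move=> E; exfalso; move: yj; rewrite -hS E yj1/= -addnS -j0.
  by rewrite eqxx.
have [ch|nch] := boolP (compl h).
  have [_ [sh|y0] _] := step_compl ch; first by exists h.
  by exists h.+1; [exact: leqW|case: (step_empty y0)].
have [yh1 _] := step_busy yh nch.
move=> E; have : ((y h.+1).2 < s)%N.
  have /and3P[h1 h2 h3] := bh.
  rewrite E /phase_end; case: ifP => s2 /=; first by rewrite -Es yj1/= in s2 *; lia.
  exfalso; move: nch; rewrite /completes_service E /phase_end s2.
  have -> : (y h).2 = 1%N by lia.
  case: ifP => n2; rewrite ?n2 ?eqxx//= ?orbT//.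
  have -> : y h = (1, 1)%N by case: (y h) h1 h2 s2 n2 => a c /= *; congr (_, _); lia.
  by [].
move=> /IH/(_ h.+1 erefl yh1)[l hl sl].
by exists l => //; apply: leq_trans hl; exact: leqW.
Qed.

Lemma service_count_unbounded m : exists i, (m < count i)%N.
Proof.
elim: m => [|m [i mi]].
  by have [j _ sj] := start_after 0; exists j.+1; rewrite /= sj addn1.
have [j ij sj] := start_after i; exists j.+1; rewrite /= sj addn1 ltnS.
by apply: leq_trans mi _; exact: count_mono.
Qed.

Lemma service_intervals : exists b e : nat -> nat,
  [/\ forall m, (b m < b m.+1)%N /\ (b m < e m)%N,
      forall i, (exists m, i = b m) <-> starting k y i,
      forall m, compl (e m).-1,
      forall m i, (b m <= i)%N -> (i.+1 < e m)%N -> ~~ compl i &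
      forall m i, serving k y m i = (b m <= i < e m)%N].
Proof.
pose b m := ex_minn (service_count_unbounded m).
have b_count m : (m < count (b m))%N by rewrite /b; case: ex_minnP.
have b_min m i : (m < count i)%N -> (b m <= i)%N.
  by rewrite /b; case: ex_minnP => j _; apply.
have bP m : count (b m) = m.+1 /\ starting k y (b m).
  have := b_count m; have := b_min m; case: (b m) => [|j] bm /=.
    by case: (_ && _) => // m0; split => //; congr _.+1; lia.
  have : ~~ (m < count j)%N by apply/negP => /bm; rewrite ltnn.
  by rewrite -leqNgt; case: (start j) => /=; lia.
have b_inj i : starting k y i -> i = b (count i).-1 /\ (0 < count i)%N.
  case: i => [|i] bi.
    split; last by rewrite (eqP bi).
    by apply/eqP; rewrite eq_sym -leqn0; apply: b_min; rewrite (eqP bi).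
  have c0 : count i.+1 = (count i).+1 by rewrite /=; move: bi => /= ->; rewrite addn1.
  rewrite c0; split => //=; apply/eqP; rewrite eqn_leq; apply/andP; split.
    rewrite leqNgt; apply/negP; rewrite ltnS => /count_mono.
    by rewrite leqNgt b_count.
  by apply: b_min; rewrite c0.
have busy_b m : y (b m) != (0, 0)%N.
  have [_] := bP m; case: (b m) => [|i] /=.
    by case: (y 0%N) => -[|n] s //=; rewrite eqxx.
  rewrite /starts_service => /orP[/andP[_ /eqP ->]//|].
  case: (y i) => n s /= /and3P[n2 _ /eqP ->]; rewrite xpair_eqE; lia.
have exe m : exists i, (b m <= i)%N && compl i.
  apply: contrapT => /forallNP nc.
  have [i mi] := service_count_unbounded m.+1.
  have bi : (b m <= i)%N by apply: b_min; exact: ltnW.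
  have H j : y (b m + j)%N != (0, 0)%N /\ count (b m + j) = m.+1.
    elim: j => [|j [IH1 IH2]]; first by rewrite addn0; split => //; case: (bP m).
    have : ~~ compl (b m + j)%N.
      by apply/negP => h; apply: (nc (b m + j)%N); rewrite leq_addr.
    by move=> /(step_busy IH1)[h1 /negbTE h2]; rewrite addnS/= h2 addn0.
  by move: mi; rewrite -(subnKC bi) (H _).2 ltnn.
(* [compl i] concerns the jump from [i] to [i.+1], so the first index outside the service is the
   successor of the first completing one. *)
pose e m := (ex_minn (exe m)).+1.
have eP m : [/\ (b m < e m)%N, compl (e m).-1 &
    forall i, (b m <= i)%N -> (i.+1 < e m)%N -> ~~ compl i].
  rewrite /e; case: ex_minnP => j /andP[bj cj] jmin; split => // i bi ij.
  by apply/negP => ci; have := jmin i; rewrite bi ci => /(_ isT); rewrite leqNgt -ltnS ij.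
have during m j : (b m + j < e m)%N -> y (b m + j)%N != (0, 0)%N /\ count (b m + j) = m.+1.
  elim: j => [|j IH]; first by rewrite addn0; split => //; case: (bP m).
  rewrite addnS => h; have [IH1 IH2] := IH (ltnW h).
  have [_ _ /(_ (b m + j)%N (leq_addr _ _) h)] := eP m.
  by move=> /(step_busy IH1)[h1 /negbTE h2]; rewrite /= h2 addn0.
(* After the [m]-th service the count has increased, except possibly at the index [e m] itself, when
   the system has just emptied; the next jump begins a service. *)
have after m i : (e m <= i)%N -> (m.+1 < count i)%N \/ i = e m /\ y i = (0, 0)%N.
  have [be ce _] := eP m; have eE : e m = (e m).-1.+1 by case: (e m) be.
  have ebE : (e m).-1 = (b m + ((e m).-1 - b m))%N by rewrite subnKC//; lia.
  have [_ ecount] : y (e m).-1 != (0, 0)%N /\ count (e m).-1 = m.+1.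
    by rewrite ebE; apply: during; rewrite -ebE; lia.
  have [_ []] := step_compl ce; rewrite -eE; [move=> st|move=> y0].
    move=> /count_mono ci; left; apply: leq_trans ci.
    by rewrite eE/= -eE st ecount addn1.
  rewrite leq_eqVlt => /predU1P[<-|]; first by right.
  have c1 : (count (e m).-1 <= count (e m))%N by apply: count_mono; exact: leq_pred.
  move=> /count_mono ci; left; apply: leq_trans ci; have [st _] := step_empty y0.
  by rewrite (_ : count (e m).+1 = (count (e m) + start (e m))%N)// st addn1 ltnS -ecount.
exists b, e; split.
- move=> m; split; last by case: (eP m).
  rewrite ltnNge; apply/negP => /count_mono.
  by rewrite (bP m).1 (bP m.+1).1 ltnn.
- by move=> i; split => [[m ->]|/b_inj[]]; [case: (bP m)|exists (count i).-1].
- by move=> m; case: (eP m).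
- by move=> m; case: (eP m).
move=> m i; apply/andP/andP => [[/eqP ci yi]|[bi ie]].
  split; first by apply: b_min; rewrite ci.
  by rewrite ltnNge; apply/negP => /after[]; [rewrite ci ltnn|case=> _ /eqP; exact/negP].
by have := @during m (i - b m)%N; rewrite subnKC// => /(_ ie)[? ->].
Qed.

End service_intervals.
Section trajectory.
Variables (R : realType) (k : nat) (y : nat -> nat * nat) (A : nat -> R) (x : R -> nat * nat).
Hypotheses (k1 : (1 <= k)%N) (Sy : forall n, queue_state k (y n))
  (steps : forall n, queue_step k (y n) (y n.+1))
  (unstuck : forall n, busy_state k (y n) -> exists j, y (n + j)%N <> ((y n).1 + j, (y n).2)%N).
Hypotheses (A0 : A 0%N = 0) (AS : forall n, A n < A n.+1) (Aunb : forall c, exists n, c < A n)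
  (xA : forall n t, A n <= t < A n.+1 -> x t = y n).

Definition service_length m n := \sum_(i < n) (serving k y m i)%:R * (A i.+1 - A i).

Let Amono i j : (i <= j)%N -> A i <= A j.
Proof.
move=> /subnK <-; elim: (j - i)%N => // n IH.
by rewrite addSn (le_trans IH)// ltW.
Qed.

Let A_lt i j : (A i < A j) = (i < j)%N.
Proof.
apply/idP/idP; first by rewrite ltNge ltnNge; apply: contra; exact: Amono.
by move=> /Amono; apply: lt_le_trans.
Qed.

Let jump_index t : 0 <= t -> exists n, A n <= t < A n.+1.
Proof.
move=> t0; case: (ex_minnP (Aunb t)) => -[|n] tn nmin; first by move: tn; rewrite A0 ltNge t0.
exists n; rewrite tn andbT leNgt; apply/negP => /nmin; rewrite ltnn.
by [].
Qed.

Let jump_left i : \forall u \near (A i.+1)^'-, x u = y i.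
Proof.
near=> u; apply: xA; apply/andP; split; last by near: u; exact: nbhs_left_lt.
by apply/ltW; near: u; exact: nbhs_left_gt.
Unshelve. all: by end_near. Qed.

Let xAi i : x (A i) = y i.
Proof. by apply: xA; rewrite lexx AS. Qed.

Let jumps_at i : jumps x (A i.+1) (y i) (y i.+1).
Proof. by split => //; rewrite -A0 A_lt. Qed.

(** Within a sojourn the left limit and the value coincide, so a change of state can only happen at
    some [A i.+1]. *)
Let jumps_index t a c : jumps x t a c -> a <> c ->
  exists i, [/\ t = A i.+1, y i = a & y i.+1 = c].
Proof.
move=> [t0 xa xc] ac; have [n /andP[nt tn]] := jump_index (ltW t0).
have uniq v : (\forall u \near t^'-, x u = v) -> a = v.
  by move=> xv; have [u [/= e1 e2]] := @filter_ex _ _ (at_left_proper_filter t) _ (filterI xa xv); rewrite -e1 -e2.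
move: nt; rewrite le_eqVlt => /predU1P[nt|nt].
  case: n nt tn => [|i] nt tn; first by move: t0; rewrite -nt A0 ltxx.
  exists i; split => //; first by apply/esym/uniq; rewrite -nt.
  by rewrite -xAi nt.
exfalso; apply: ac; rewrite -xc (@xA n) ?(ltW nt)//; apply: uniq.
near=> u; apply: xA; apply/andP; split; last first.
  by apply: lt_trans tn; near: u; exact: nbhs_left_lt.
by apply/ltW; near: u; exact: nbhs_left_gt.
Unshelve. all: by end_near. Qed.

Let service_endsP t : service_ends k x t <-> exists2 i, completes_service k (y i) (y i.+1) & t = A i.+1.
Proof.
split.
  case=> [/jumps_index[//|i [-> yi yi1]]|[n n2 /jumps_index[|i [-> yi yi1]]]].
  - by exists i => //; rewrite /completes_service yi yi1.
  - by case; lia.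
  - by exists i => //; rewrite /completes_service yi yi1/= n2 !eqxx orbT.
move=> [i + ->]; have := jumps_at i; rewrite /completes_service.
case: (y i) => a s; case: (y i.+1) => b l /= J /orP[/andP[/eqP ea /eqP eb]|/and3P[a2 /eqP es /eqP eb]].
  by left; rewrite -ea -eb.
by right; exists a => //; rewrite -eb -[in (a, _)]es.
Qed.

Let service_beginsP t : service_begins k x t <->
  exists2 i, starting k y i & t = A i.
Proof.
split.
  case=> [[-> x1 x2]|/jumps_index[//|i [-> yi yi1]]|[n n2 /jumps_index[|i [-> yi yi1]]]].
  - by exists 0%N => //; move: x1 x2; rewrite -A0 xAi /= => -> ->; rewrite eqxx.
  - by exists i.+1 => //; rewrite /starting /starts_service yi yi1 !eqxx.
  - by case; lia.
  - by exists i.+1 => //; rewrite /starting /starts_service yi yi1/= n2 !eqxx orbT.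
move=> [[|i] + ->].
  rewrite A0 /= => h; apply: Or31; rewrite -A0 xAi; move: h.
  by rewrite eqb1 => /andP[-> /eqP].
have := jumps_at i; rewrite /starting /starts_service.
case: (y i) => a s; case: (y i.+1) => b l /= J /orP[/andP[/eqP ea /eqP eb]|/and3P[a2 /eqP es /eqP eb]].
  by apply: Or32; rewrite -ea -eb.
by apply: Or33; exists a => //; rewrite -eb -[in (a, _)]es.
Qed.

Lemma are_service_times_trajectory (T : nat -> R) :
  (forall m, exists N, forall n, (N <= n)%N -> service_length m n = T m) ->
  are_service_times k x T.
Proof.
move=> Tlim; have [b [e [be bstart ecompl nocompl servingE]]] := service_intervals k1 Sy steps unstuck.
have eE m : e m = (e m).-1.+1 by have [_] := be m; case: (e m).
have TE m : T m = A (e m) - A (b m).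
  have [N /(_ (N + e m)%N (leq_addr _ _)) <-] := Tlim m.
  (* The increments over the service interval telescope; the upper index is [n] clamped between
     [b m] and [e m]. *)
  have len n : service_length m n = A (maxn (b m) (minn (e m) n)) - A (b m).
    elim: n => [|n IH].
      by rewrite /service_length big_ord0 minn0 maxn0 subrr.
    rewrite /service_length big_ord_recr/= -/(service_length m n) IH servingE.
    have [_ bem] := be m.
    have [nb|bn] := ltnP n (b m).
      rewrite mul0r addr0; congr (A _ - _); lia.
    have [ne|en] := ltnP n (e m).
      rewrite mul1r (_ : maxn (b m) (minn (e m) n.+1) = n.+1); last lia.
      rewrite (_ : maxn (b m) n = n); last lia.
      by lra.
    rewrite andbF mul0r addr0; congr (A _ - _); lia.
  have [_ bem] := be m.
  rewrite len; congr (A _ - _); lia.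
exists (fun m => A (b m)); split.
- by move=> m; rewrite A_lt; case: (be m).
- move=> t; rewrite service_beginsP; split => [[i bi ->]|[m ->]].
    by have [m ->] := (bstart i).2 bi; exists m.
  by exists (b m) => //; apply/bstart; exists m.
move=> m; have [_ bem] := be m; rewrite TE subrKC; split.
- by rewrite subr_gt0 A_lt.
- apply/service_endsP; exists (e m).-1; first exact: ecompl.
  by rewrite -eE.
move=> u /andP[bu ue] /service_endsP[i ci ui]; move: bu ue; rewrite ui !A_lt => bi ie.
by have := nocompl m i bi ie; rewrite ci.
Qed.

Lemma service_length_eventually m : exists N l, forall n, (N <= n)%N -> service_length m n = l.
Proof.
have [b [e [be bstart ecompl nocompl servingE]]] := service_intervals k1 Sy steps unstuck.
exists (e m), (service_length m (e m)) => n /subnK <-.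
elim: (n - e m)%N => // j IH.
rewrite addSn /service_length big_ord_recr/= -/(service_length m _) IH servingE.
by rewrite [X in _ && X]ltnNge leq_addl andbF mul0r addr0.
Qed.

End trajectory.

(** * Discounted services *)

Lemma service_count_ext k (y y' : nat -> nat * nat) n :
  (forall i, (i <= n)%N -> y i = y' i) -> service_count k y n = service_count k y' n.
Proof.
elim: n => [|n IH] yy /=; first by rewrite yy.
by rewrite IH ?yy// => i iln; apply: yy; exact: leqW.
Qed.

Definition extend_path (y : nat -> nat * nat) n (z : nat * nat) i :=
  if (i <= n)%N then y i else z.

(* Discounting the time spent in the [m]-th service at rate [v m] makes the
   expected discount of the services still to be completed a martingale: each
   phase of the [m]-th service contributes the factor
   [theta / (theta + v m `^ nu)]. *)
Section discounted_services.
Variables (R : realType) (lambda mu nu : R) (k : nat) (v : nat -> R) (M : nat).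
Hypotheses (lambda0 : 0 < lambda) (mu0 : 0 < mu) (k1 : (1 <= k)%N) (nu0 : 0 < nu).
Hypotheses (v0 : forall m, 0 <= v m) (vM : forall m, (M <= m)%N -> v m = 0).
Notation theta := (k%:R * mu).
Notation q := (queue_rate lambda mu k).

(* The count [0] corresponds to a residual service, which is not discounted. *)
Definition service_rate (c : nat) : R := if c is m.+1 then v m else 0.

Definition phase_discount c : R := theta / (theta + service_rate c `^ nu).

(** [c] services have begun: the current one has number [c - 1] and [s] phases left, and those
    numbered from [c] on are entirely ahead. In the empty system [s = 0]. *)
Definition future_discount c s : R :=
  phase_discount c ^+ s * \prod_(m < M | (c <= m)%N) phase_discount m.+1 ^+ k.

Definition state_rate y i : R := (y i != (0, 0)%N)%:R * service_rate (service_count k y i).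

Definition elapsed_discount y (a : nat -> R) n : R :=
  \prod_(i < n) expR (- (state_rate y i * (a i.+1 - a i))).

Definition state_discount y n : R := future_discount (service_count k y n) (y n).2.

Let theta0 : 0 < theta. Proof. exact: theta_gt0. Qed.

Let rate0 c : 0 <= service_rate c. Proof. by case: c => /=. Qed.

Let den0 c : 0 < theta + service_rate c `^ nu.
Proof. by rewrite ltr_pwDl// powR_ge0. Qed.

Lemma phase_discount01 c : 0 <= phase_discount c <= 1.
Proof.
rewrite /phase_discount; apply/andP; split; first by rewrite divr_ge0// ltW.
rewrite ler_pdivrMr// mul1r lerDl.
exact: powR_ge0.
Qed.

Let discount_rate0 c : service_rate c = 0 -> phase_discount c = 1.
Proof.
by rewrite /phase_discount => ->; rewrite powR0 ?gt_eqF// addr0 divff// gt_eqF.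
Qed.

Lemma future_discount01 c s : 0 <= future_discount c s <= 1.
Proof.
have h m e : 0 <= phase_discount m ^+ e <= 1.
  by have /andP[a b] := phase_discount01 m; rewrite exprn_ge0// exprn_ile1.
have p : 0 <= \prod_(m < M | (c <= m)%N) phase_discount m.+1 ^+ k <= 1.
  by apply/andP; split; [apply: prodr_ge0|apply: prodr_ile1] => m _ //; case/andP: (h m.+1 k).
case/andP: p => p0 p1; case/andP: (h c s) => h0 h1.
by rewrite /future_discount mulr_ge0//= mulr_ile1.
Qed.

Lemma state_discount01 y n : 0 <= state_discount y n <= 1.
Proof. exact: future_discount01. Qed.

Lemma state_rate_ge0 y i : 0 <= state_rate y i.
Proof. by rewrite mulr_ge0. Qed.

Lemma elapsed_discount01 y a n : (forall i, a i <= a i.+1) -> 0 <= elapsed_discount y a n <= 1.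
Proof.
move=> aS; apply/andP; split; first by apply: prodr_ge0 => i _; exact: expR_ge0.
apply: prodr_ile1 => i _; rewrite expR_ge0/= -[leRHS]expR0 ler_expR oppr_le0.
by rewrite mulr_ge0 ?state_rate_ge0 ?subr_ge0.
Qed.

(** No phase left in the current service amounts to all [k] phases of the next one ahead. The value
    is thus the same whether a last phase is followed by an empty system or by a new service, and
    when an empty system is left. *)
Let future_discount0 c : future_discount c 0 = future_discount c.+1 k.
Proof.
rewrite /future_discount expr0 mul1r; have [cM|Mc] := ltnP c M.
  rewrite (bigD1 (Ordinal cM))//=; congr (_ * _); apply: eq_bigl => i.
  by rewrite -val_eqE/=; lia.
rewrite discount_rate0 ?expr1n ?mul1r; last exact: vM.
by rewrite !big1// => i /=; have := ltn_ord i; lia.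
Qed.

Lemma future_discount_end c s : (M < c)%N -> future_discount c s = 1.
Proof.
move=> Mc; rewrite /future_discount discount_rate0; last by case: c Mc => //= c Mc; exact: vM.
by rewrite expr1n mul1r big1// => i ci; have := ltn_ord i; lia.
Qed.

(** The same for every initial state, hence for every initial law: a residual service has rate 0 and
    discount 1, a customer in phase [k] begins service 0, and an empty system has all services
    ahead. *)
Lemma state_discount_init y : state_discount y 0 = \prod_(m < M) (theta / (theta + v m `^ nu)) ^+ k.
Proof.
transitivity (future_discount 0 0); last by rewrite /future_discount expr0 mul1r.
rewrite /state_discount /=; case: (1 <= _)%N => /=; last first.
  by rewrite /future_discount (@discount_rate0 0)// !expr1n.
by case: eqP => [->|_] /=; [rewrite future_discount0|rewrite /future_discount (@discount_rate0 0)// !expr1n].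
Qed.

Let count_arrival (y : nat -> nat * nat) n : busy_state k (y n) -> y n.+1 = ((y n).1.+1, (y n).2) ->
  service_count k y n.+1 = service_count k y n.
Proof.
move=> + E /=; rewrite /starts_service E; case: (y n) => a s /and3P[/= a1 s1 sk].
rewrite !xpair_eqE; have -> : (a == 0%N) = false by apply/negP; lia.
by rewrite [(_ == a.-1)](_ : _ = false) ?andbF ?addn0//; apply/negP; lia.
Qed.

Let discount_phase_end (y : nat -> nat * nat) n : busy_state k (y n) -> y n.+1 = phase_end k (y n) ->
  state_discount y n.+1 = future_discount (service_count k y n) (y n).2.-1.
Proof.
move=> + E; rewrite /state_discount/= /starts_service E /phase_end.
case: (y n) => a s /and3P[/= a1 s1 sk]; have -> : ((a, s) == (0, 0)%N) = false.
  by rewrite xpair_eqE; apply/negP; lia.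
have [s2|s2] := leqP 2 s.
  by rewrite (_ : (s == 1%N) = false) ?andbF ?addn0//; apply/negP; lia.
have -> : s = 1%N by lia.
by case: ifP => a2 /=; rewrite ?eqxx ?addn0//= addn1 future_discount0.
Qed.

Let discount_empty (y : nat -> nat * nat) n : y n = (0, 0)%N -> y n.+1 = (1%N, k) ->
  state_discount y n.+1 = state_discount y n.
Proof.
by move=> e0 e1; rewrite /state_discount/= /starts_service e0 e1 !eqxx/= addn1 future_discount0.
Qed.

Let discount_next y n z : z = ((y n).1.+1, (y n).2) -> busy_state k (y n) ->
  state_discount (extend_path y n z) n.+1 = state_discount y n.
Proof.
move=> zE b; have e i : (i <= n)%N -> extend_path y n z i = y i by rewrite /extend_path => ->.
have en : extend_path y n z n.+1 = z by rewrite /extend_path ltnn.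
have c : service_count k (extend_path y n z) n.+1 = service_count k (extend_path y n z) n.
  by apply: count_arrival; rewrite ?en e.
by rewrite /state_discount c (service_count_ext _ e) en zE.
Qed.

(** Let [c] be the current count, [beta] the [nu]-th power of its rate and [S] the current discount.
    An arrival keeps [S], the end of a phase divides it by [theta / (theta + beta)], and [lambda S +
    theta S (theta + beta) / theta = (lambda + theta + beta) S]. In the empty state the rate is
    0. *)
Lemma state_discount_step y n : queue_state k (y n) ->
  let w z := q (y n) z / (exit_rate q (y n) + state_rate y n `^ nu) * state_discount (extend_path y n z) n.+1 in
  if busy_state k (y n) then w ((y n).1.+1, (y n).2) + w (phase_end k (y n)) = state_discount y n
  else w (1%N, k) = state_discount y n.
Proof.
move=> S w; have e z : extend_path y n z n = y n by rewrite /extend_path leqnn.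
have en z : extend_path y n z n.+1 = z by rewrite /extend_path ltnn.
have cn z : service_count k (extend_path y n z) n = service_count k y n.
  by apply: service_count_ext => i; rewrite /extend_path => ->.
case: ifP => b; last first.
  case: S => [|y0]; first by rewrite b.
  rewrite /w discount_empty ?e ?en// y0 queue_rate_empty exit_rate_empty// /state_rate y0 eqxx mul0r.
  rewrite powR0 ?gt_eqF// addr0 divff ?gt_eqF// mul1r.
  by rewrite /state_discount cn e.
rewrite /w queue_rate_arrival// queue_rate_phase_end// exit_rate_busy// discount_next//.
rewrite discount_phase_end ?e ?en// cn /state_discount.
have yn0 : y n != (0, 0)%N by apply/eqP => y0; move: b; rewrite y0.
have {yn0} -> : state_rate y n = service_rate (service_count k y n) by rewrite /state_rate yn0 mul1r.
set c := service_count k y n; have d := den0 c.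
have s1 : (y n).2 = (y n).2.-1.+1 by case/and3P: b => _; case: (y n).2.
rewrite [in RHS]s1 [in X in X + _]s1 /future_discount exprS /phase_discount.
have d' : lambda + theta + service_rate c `^ nu != 0 by rewrite gt_eqF// -addrA addr_gt0.
by field; rewrite gt_eqF.
Qed.

End discounted_services.

Lemma state_rate_ext (R : realType) k (v : nat -> R) (y y' : nat -> nat * nat) n :
  (forall i, (i <= n)%N -> y i = y' i) -> state_rate k v y n = state_rate k v y' n.
Proof. by move=> yy; rewrite /state_rate yy// (service_count_ext k yy). Qed.

Lemma elapsed_discount_ext (R : realType) k (v : nat -> R) (y y' : nat -> nat * nat) a n :
  (forall i, (i <= n)%N -> y i = y' i) ->
  elapsed_discount k v y a n = elapsed_discount k v y' a n.
Proof.
move=> yy; apply: eq_bigr => i _; rewrite (@state_rate_ext _ _ _ y y')// => j ji.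
by apply: yy; apply: leq_trans ji (ltnW (ltn_ord i)).
Qed.

Lemma state_discount_ext (R : realType) mu nu k (v : nat -> R) M (y y' : nat -> nat * nat) n :
  (forall i, (i <= n)%N -> y i = y' i) ->
  state_discount mu nu k v M y n = state_discount mu nu k v M y' n.
Proof. by move=> yy; rewrite /state_discount yy// (service_count_ext k yy). Qed.

Section expected_discount.
Context d (Omega : measurableType d) (R : realType) (P : probability Omega R).
Variables (lambda mu nu : R) (k : nat) (v : nat -> R) (M : nat).
Hypotheses (lambda0 : 0 < lambda) (mu0 : 0 < mu) (k1 : (1 <= k)%N) (nu0 : 0 < nu).
Hypotheses (v0 : forall m, 0 <= v m) (vM : forall m, (M <= m)%N -> v m = 0).
Notation q := (queue_rate lambda mu k).
Variables (Y : nat -> Omega -> nat * nat) (A : nat -> Omega -> R).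
Hypotheses (mY : forall n, measurable_fun setT (Y n)) (mA : forall n, measurable_fun setT (A n))
  (AS : forall n w, A n w <= A n.+1 w).
Hypothesis path : {ae P, forall w, (forall n, queue_state k (Y n w)) /\
  (forall n, queue_step k (Y n w) (Y n.+1 w))}.
Hypothesis law : forall n (y : nat -> nat * nat) (b : nat -> R),
  (forall i, (i <= n)%N -> queue_state k (y i)) -> (forall i, 0 <= b i) ->
  (\int[P]_w (`[< forall i, (i <= n)%N -> Y i w = y i >]%:R *
      \prod_(i < n) expR (- (b i * (A i.+1 w - A i w))))%:E =
   (fine (P [set w | Y 0%N w = y 0%N]) *
     \prod_(i < n) (q (y i) (y i.+1) / (exit_rate q (y i) + b i `^ nu)))%:E)%E.

Notation history n w := (mkseq (Y ^~ w) n.+1).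
Let cylinder n y := [set w | forall i, (i <= n)%N -> Y i w = y i].

Let historyE n w i : (i <= n)%N -> nth (0, 0)%N (history n w) i = Y i w.
Proof. by move=> iln; rewrite nth_mkseq. Qed.

Let history_cylinder n (s : seq (nat * nat)) : size s = n.+1 ->
  [set w | history n w = s] = cylinder n (nth (0, 0)%N s).
Proof.
move=> ss; apply/seteqP; split => w /=; first by move=> <- i iln; rewrite historyE.
move=> h; apply: (@eq_from_nth _ (0, 0)%N); rewrite size_mkseq ?ss// => i iln.
by rewrite historyE// h.
Qed.

Let mcylinder n y : measurable (cylinder n y). Proof. exact: measurable_cylinder. Qed.

Lemma measurable_history n (s : seq (nat * nat)) : measurable [set w | history n w = s].
Proof.
have [ss|ss] := eqVneq (size s) n.+1; first by rewrite history_cylinder.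
rewrite (_ : [set w | _] = set0)//; apply/seteqP; split => w //= e.
by move: ss; rewrite -e size_mkseq eqxx.
Qed.

Let D n w := elapsed_discount k v (Y ^~ w) (A ^~ w) n.
Let S n w := state_discount mu nu k v M (Y ^~ w) n.

Let mhistory := measurable_history.

Let mDy n y : measurable_fun setT (fun w => elapsed_discount k v y (A ^~ w) n).
Proof.
apply: measurable_prod => i _; apply: measurable_expRNM.
exact: measurable_funB.
Qed.

Let mD n : measurable_fun setT (D n).
Proof.
rewrite (_ : D n = fun w => elapsed_discount k v (nth (0, 0)%N (history n w)) (A ^~ w) n).
  exact: (measurable_fun_count (mhistory n) (F := fun s w => elapsed_discount k v (nth (0, 0)%N s) (A ^~ w) n) (fun s => mDy n _)).
apply/funext => w; apply: elapsed_discount_ext => i iln.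
by rewrite historyE.
Qed.

Lemma measurable_state_discount n : measurable_fun setT (S n).
Proof.
pose F (s : seq (nat * nat)) (w : Omega) := state_discount mu nu k v M (nth (0, 0)%N s) n.
rewrite (_ : S n = fun w => F (history n w) w).
  exact: (measurable_fun_count (mhistory n) (F := F) (fun s => measurable_cst _)).
apply/funext => w; apply: state_discount_ext => i iln.
by rewrite historyE.
Qed.

Let mS := measurable_state_discount.

Let D0 n w : 0 <= D n w <= 1.
Proof. by apply: elapsed_discount01. Qed.

Let S0 n w : 0 <= S n w <= 1.
Proof. exact: state_discount01. Qed.

Let DS0 n w : 0 <= D n w * S n w.
Proof. by rewrite mulr_ge0//; [case/andP: (D0 n w)|case/andP: (S0 n w)]. Qed.

Let mDS n : measurable_fun setT (fun w => D n w * S n w).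
Proof. exact: measurable_funM. Qed.

Let weight (y : nat -> nat * nat) n := fine (P [set w | Y 0%N w = y 0%N]) *
  \prod_(i < n) (q (y i) (y i.+1) / (exit_rate q (y i) + state_rate k v y i `^ nu)).

Let cylinder_integral n y : (forall i, (i <= n)%N -> queue_state k (y i)) ->
  (\int[P]_w (`[< cylinder n y w >]%:R * (D n w * S n w))%:E =
   (weight y n * state_discount mu nu k v M y n)%:E)%E.
Proof.
move=> Sy; have b0 i : 0 <= state_rate k v y i by exact: state_rate_ge0.
rewrite /weight mulrC EFinM -(law Sy b0) -ge0_integralZl_EFin//.
- apply: eq_integral => w _; case: asboolP => [h|_]; last by rewrite !mul0r mule0.
  rewrite !mul1r mulrC EFinM /S (state_discount_ext _ _ _ _ _ h) /D (elapsed_discount_ext _ _ _ h).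
  by [].
- by move=> w _; rewrite lee_fin mulr_ge0// prodr_ge0// => i _; exact: expR_ge0.
- apply/measurable_EFinP/measurable_funM; last exact: (mDy n y).
  exact: measurable_natr_set (mcylinder n y).
- have : 0 <= state_discount mu nu k v M y n <= 1 by exact: state_discount01.
  by case/andP.
Qed.

Let weight_extend y n z : weight (extend_path y n z) n.+1 =
  weight y n * (q (y n) z / (exit_rate q (y n) + state_rate k v y n `^ nu)).
Proof.
have e i : (i <= n)%N -> extend_path y n z i = y i by rewrite /extend_path => ->.
rewrite /weight big_ord_recr/= e// [LHS]mulrA; congr (_ * _ * _).
  apply: eq_bigr => i _; have iln := ltn_ord i; rewrite !e//; last exact: ltnW.
  by rewrite (@state_rate_ext _ _ _ (extend_path y n z) y)// => j ji; apply: e; exact: leq_trans ji (ltnW _).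
rewrite e// /extend_path ltnn; congr (_ / (_ + _ `^ _)).
by apply: state_rate_ext => j ji; exact: e.
Qed.

(** The martingale property, checked on each history up to [n]: almost surely it extends by one or
    two next states, whose weighted discounts add up by [state_discount_step]. *)
Lemma expected_discount n : (\int[P]_w (D n w * S n w)%:E =
  (\prod_(m < M) (k%:R * mu / (k%:R * mu + v m `^ nu)) ^+ k)%:E)%E.
Proof.
elim: n => [|n <-].
  under eq_integral => w _ do rewrite /D /elapsed_discount big_ord0 mul1r /S (state_discount_init lambda0 mu0 k1 nu0 vM).
  by rewrite integral_cst//= probability_setT mule1.
apply: (integral_fibers (mhistory n)) => // s.
have [ss|ss] := eqVneq (size s) n.+1; last first.
  rewrite !integral0_eq// => w _; case: asboolP => [e|_]; rewrite ?mul0r//;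
    by move: ss; rewrite -e size_mkseq eqxx.
pose y := nth (0, 0)%N s.
have hE w : `[< history n w = s >] = `[< cylinder n y w >].
  by apply: asbool_equiv_eq; rewrite -[cylinder n y]history_cylinder.
under eq_integral do rewrite hE.
under [RHS]eq_integral do rewrite hE.
have mc m m' y' : measurable_fun setT (fun w => (`[< cylinder m y' w >]%:R * (D m' w * S m' w))%:E).
  by apply/measurable_EFinP/measurable_funM => //; exact: measurable_natr_set.
have ge0 m m' y' w : setT w -> (0 <= (`[< cylinder m y' w >]%:R * (D m' w * S m' w))%:E)%E.
  by move=> _; rewrite lee_fin mulr_ge0.
have [Sy|nSy] := pselect (forall i, (i <= n)%N -> queue_state k (y i)); last first.
  have Z m : (\int[P]_w (`[< cylinder n y w >]%:R * (D m w * S m w))%:E = 0)%E.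
    rewrite -(integral0 P setT); apply: ae_eq_integral => //.
    move: path; apply: filterS => w [Sw _] _; case: asboolP => [h|_]; last by rewrite mul0r.
    by exfalso; apply: nSy => i iln; rewrite -h.
  by rewrite !Z.
rewrite cylinder_integral//.
have extS z : queue_state k z -> forall i, (i <= n.+1)%N -> queue_state k (extend_path y n z i).
  by move=> Sz i _; rewrite /extend_path; case: ifP => // iln; exact: Sy.
have ext_cyl z w : cylinder n.+1 (extend_path y n z) w <-> cylinder n y w /\ Y n.+1 w = z.
  split.
    move=> h; split; last by rewrite h// /extend_path ltnn.
    by move=> i iln; rewrite h ?leqW// /extend_path iln.
  move=> [h hz] i; rewrite leq_eqVlt ltnS => /predU1P[->|iln].
    by rewrite /extend_path ltnn.
  by rewrite /extend_path iln h.
have := state_discount_step lambda0 mu0 k1 nu0 vM (Sy n (leqnn n)).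
move=> /=; case: ifP => b <-.
  have Sa : queue_state k ((y n).1.+1, (y n).2).
    by left; move: b; rewrite /busy_state/= => /and3P[_ -> ->].
  have Sp : queue_state k (phase_end k (y n)).
    move: b; rewrite /phase_end; case: (y n) => a l /and3P[/= a1 l1 lk].
    case: ifP => l2; [left|case: ifP => a2; [left|by right]]; apply/and3P; split => //=; lia.
  rewrite mulrDr [X in X + _]mulrA [X in _ + X]mulrA -!weight_extend EFinD -!cylinder_integral; [|exact: extS..].
  rewrite -ge0_integralD//; last 2 first.
    by move=> x; exact: ge0.
    by move=> x; exact: ge0.
  apply: ae_eq_integral => //.
    by apply: emeasurable_funD.
  move: path; apply: filterS => w [Sw st] _; rewrite -EFinD -mulrDl; congr (_ * _)%:E.
  case: asboolP => [h|nh]; last first.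
    by rewrite !asboolF ?addr0// => /ext_cyl[].
  have := st n; rewrite h// => -[[y0 _]|[_ zE]]; first by rewrite y0 in b.
  case: zE => zE.
    rewrite asboolT; last exact/ext_cyl.
    rewrite asboolF ?addr0//; rewrite ext_cyl zE => -[_] /eqP.
    by rewrite (negbTE (arrival_neq_phase_end lambda0 mu0 k1 _)).
  rewrite asboolF; first by rewrite add0r asboolT//; exact/ext_cyl.
  rewrite ext_cyl zE => -[_] /esym/eqP.
  by rewrite (negbTE (arrival_neq_phase_end lambda0 mu0 k1 _)).
have S1 : queue_state k (1%N, k) by left; rewrite /busy_state/= k1 leqnn.
rewrite mulrA -weight_extend -cylinder_integral; last exact: extS.
apply: ae_eq_integral => //.
move: path; apply: filterS => w [Sw st] _; congr (_%:R * _)%:E; congr nat_of_bool.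
apply: asbool_equiv_eq; rewrite ext_cyl; split => [h|[]//]; split => //.
have := st n; rewrite h// => -[[_ //]|[b']].
by rewrite b' in b.
Qed.

End expected_discount.

Lemma state_rateE (R : realType) k (v : nat -> R) M (y : nat -> nat * nat) i :
  (forall m, (M <= m)%N -> v m = 0) ->
  state_rate k v y i = \sum_(m < M) v m * (serving k y m i)%:R.
Proof.
move=> vM; rewrite /state_rate /serving; case: (y i != _); last first.
  by rewrite mul0r big1// => m _; rewrite andbF mulr0.
rewrite mul1r; case: (service_count k y i) => [|c] /=.
  by rewrite big1// => m _; rewrite mulr0.
have [cM|Mc] := ltnP c M; last first.
  rewrite vM// big1// => m _; rewrite eqSS (_ : (c == m :> nat) = false) ?mulr0//.
  by apply/negP => /eqP cm; have := ltn_ord m; rewrite -cm ltnNge Mc.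
rewrite (bigD1 (Ordinal cM))//= !eqxx mulr1 big1 ?addr0// => m.
by rewrite -val_eqE/= eqSS andbT eq_sym => /negbTE ->; rewrite mulr0.
Qed.

Lemma elapsed_discountE (R : realType) k (v : nat -> R) M (y : nat -> nat * nat) a n :
  (forall m, (M <= m)%N -> v m = 0) ->
  elapsed_discount k v y a n = \prod_(m < M) expR (- (v m * service_length k y a m n)).
Proof.
move=> vM; rewrite /elapsed_discount -!expR_sum !sumrN; congr (expR (- _)).
under eq_bigr do rewrite (state_rateE _ _ _ vM) mulr_suml.
rewrite exchange_big/=; apply: eq_bigr => m _; rewrite /service_length mulr_sumr.
by apply: eq_bigr => i _; rewrite mulrA.
Qed.

(** * Joint Laplace transform of the service times *)

Section joint_laplace.
Context d (Omega : measurableType d) (R : realType) (P : probability Omega R).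
Variables (lambda mu nu : R) (k : nat).
Hypotheses (lambda0 : 0 < lambda) (mu0 : 0 < mu) (k1 : (1 <= k)%N) (nu0 : 0 < nu).
Notation q := (queue_rate lambda mu k).
Variables (Y : nat -> Omega -> nat * nat) (A : nat -> Omega -> R).
Hypotheses (mY : forall n, measurable_fun setT (Y n)) (mA : forall n, measurable_fun setT (A n))
  (AS : forall n w, A n w <= A n.+1 w).
Hypothesis path : {ae P, forall w, [/\ forall n, queue_state k (Y n w),
  forall n, queue_step k (Y n w) (Y n.+1 w) &
  forall n, busy_state k (Y n w) ->
    exists j, Y (n + j)%N w <> ((Y n w).1 + j, (Y n w).2)%N]}.
Hypothesis law : forall n (y : nat -> nat * nat) (b : nat -> R),
  (forall i, (i <= n)%N -> queue_state k (y i)) -> (forall i, 0 <= b i) ->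
  (\int[P]_w (`[< forall i, (i <= n)%N -> Y i w = y i >]%:R *
      \prod_(i < n) expR (- (b i * (A i.+1 w - A i w))))%:E =
   (fine (P [set w | Y 0%N w = y 0%N]) *
     \prod_(i < n) (q (y i) (y i.+1) / (exit_rate q (y i) + b i `^ nu)))%:E)%E.

Let L m n w := service_length k (Y ^~ w) (A ^~ w) m n.

Lemma measurable_service_length m n : measurable_fun setT (L m n).
Proof.
rewrite (_ : L m n = fun w => service_length k (nth (0, 0)%N (mkseq (Y ^~ w) n.+1)) (A ^~ w) m n).
  apply: (measurable_fun_count (measurable_history mY n) (F := fun s w => service_length k (nth (0, 0)%N s) (A ^~ w) m n)) => s.
  apply: measurable_sum => i; apply: measurable_funM; first exact: measurable_cst.
  exact: measurable_funB.
apply/funext => w; apply: eq_bigr => i _; congr (_%:R * _); congr nat_of_bool.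
have e j : (j <= i)%N -> Y j w = nth (0, 0)%N (mkseq (Y ^~ w) n.+1) j.
  by move=> ji; rewrite nth_mkseq// ltnS (leq_trans ji)// ltnW.
by rewrite /serving (service_count_ext k e) (e i).
Qed.

Lemma service_length_ge0 m n w : 0 <= L m n w.
Proof. by apply: sumr_ge0 => i _; rewrite mulr_ge0// subr_ge0. Qed.

Variable T : nat -> Omega -> R.
Hypothesis Tlim : {ae P, forall w, forall m, L m n w @[n --> \oo] --> T m w}.
Hypothesis mT : forall m, measurable_fun setT (T m).

(** The expected discount does not depend on [n]. Almost surely more than [M] services eventually
    begin, and from then on the discount of the future is 1, as [u] sets the rates from [M] on to 0;
    dominated convergence removes it. *)
Lemma joint_laplace (v : nat -> R) (M : nat) : (forall m, 0 <= v m) ->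
  (\int[P]_w (\prod_(m < M) expR (- (v m * T m w)))%:E =
   (\prod_(m < M) (k%:R * mu / (k%:R * mu + v m `^ nu)) ^+ k)%:E)%E.
Proof.
move=> v0; pose u m := if (m < M)%N then v m else 0.
have u0 m : 0 <= u m by rewrite /u; case: ifP.
have uM m : (M <= m)%N -> u m = 0 by rewrite /u ltnNge => ->.
have uE (m : 'I_M) : u m = v m by rewrite /u ltn_ord.
under [X in _ = X%:E]eq_bigr do rewrite -uE.
under eq_integral do under eq_bigr do rewrite -uE.
have path' : {ae P, forall w, (forall n, queue_state k (Y n w)) /\
    (forall n, queue_step k (Y n w) (Y n.+1 w))}.
  by move: path; apply: filterS => w [].
have E := expected_discount lambda0 mu0 k1 nu0 u0 uM mY mA AS path' law.
pose f n w := \prod_(m < M) expR (- (u m * L m n w)) *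
  state_discount mu nu k u M (Y ^~ w) n.
have fE n w : f n w = elapsed_discount k u (Y ^~ w) (A ^~ w) n *
    state_discount mu nu k u M (Y ^~ w) n.
  by rewrite /f (elapsed_discountE _ _ _ _ uM).
have f01 n w : 0 <= f n w <= 1.
  have e01 := @elapsed_discount01 _ k u u0 (Y ^~ w) (A ^~ w) n (fun i => AS i w).
  have : 0 <= state_discount mu nu k u M (Y ^~ w) n <= 1 by exact: state_discount01.
  by rewrite fE; case/andP: e01 => a b /andP[c e]; rewrite mulr_ge0//= mulr_ile1.
have mf n : measurable_fun setT (f n).
  apply: measurable_funM.
    apply: measurable_prod => m _; apply: measurable_expRNM.
    exact: measurable_service_length.
  exact: measurable_state_discount.
have cf : {ae P, forall w, f n w @[n --> \oo] --> \prod_(m < M) expR (- (u m * T m w))}.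
  move: path Tlim; apply: filterS2 => w [Sw st us] cL.
  rewrite -[X in _ --> X]mulr1; apply: cvgM.
    apply: cvg_big => [|m _]; first exact: mul_continuous.
    apply: continuous_cvg; first exact: continuous_expR.
    by apply: cvgN; apply: cvgM; [exact: cvg_cst|exact: cL].
  apply: cvg_near_cst; have [N MN] := service_count_unbounded k1 Sw st us M.
  exists N => // n /= Nn; apply: (future_discount_end lambda0) => //.
  by apply: leq_trans MN _; exact: service_count_mono.
have [|||||_ _] := @dominated_convergence _ _ R P setT measurableT
    (fun n w => (f n w)%:E) (fun w => (\prod_(m < M) expR (- (u m * T m w)))%:E)
    (fun=> (1 : R)%:E).
- by move=> n; apply/measurable_EFinP.
- apply/measurable_EFinP; apply: measurable_prod => m _; exact: measurable_expRNM.
- move: cf; apply: filterS => w cw _; apply: cvg_EFin => //; exact: nearW.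
- exact: finite_measure_integrable_cst.
- apply: aeW => w n _; case/andP: (f01 n w) => a b.
  by rewrite abse_EFin lee_fin ger0_norm.
under eq_fun do (under eq_integral do rewrite fE; rewrite E).
move=> cC; symmetry; apply: cvg_unique cC => //.
exact: cvg_cst.
Qed.

End joint_laplace.

(** * Independence of the service times *)

Section laplace_independence.
Context d (Omega : measurableType d) (R : realType) (P : probability Omega R).
Variables (T : nat -> Omega -> R) (phi : R -> R).
Hypotheses (mT : forall m, measurable_fun setT (T m)) (T0 : forall m w, 0 <= T m w).
Hypotheses (phi0 : phi 0 = 1) (phi_ge0 : forall x, 0 <= x -> 0 <= phi x).
Hypothesis laplace : forall (v : nat -> R) (M : nat), (forall m, 0 <= v m) ->
  (\int[P]_w (\prod_(m < M) expR (- (v m * T m w)))%:E = (\prod_(m < M) phi (v m))%:E)%E.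

Let big_seq_ord (F : nat -> R) (s : seq nat) M : uniq s -> (forall i, i \in s -> (i < M)%N) ->
  \prod_(i <- s) F i = \prod_(m < M) (if (m : nat) \in s then F m else 1).
Proof.
move=> us sM; rewrite -(big_mkord xpredT (fun m => if m \in s then F m else 1)).
rewrite -[RHS]big_mkcond -[RHS]big_filter; apply: perm_big; apply: uniq_perm => //.
  by rewrite filter_uniq// iota_uniq.
move=> i; rewrite mem_filter mem_index_iota /=.
by case: (boolP (i \in s)) => //= /sM ->.
Qed.

Let laplace_seq (v : nat -> R) (s : seq nat) : uniq s -> (forall m, 0 <= v m) ->
  (\int[P]_w (\prod_(i <- s) expR (- (v i * T i w)))%:E = (\prod_(i <- s) phi (v i))%:E)%E.
Proof.
move=> us v0; pose M := (\max_(i <- s) i).+1.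
have sM i : i \in s -> (i < M)%N by move=> si; rewrite ltnS (leq_bigmax_seq _ si).
rewrite (big_seq_ord _ us sM).
under eq_integral do rewrite (big_seq_ord _ us sM).
pose u m := if m \in s then v m else 0.
have u0 m : 0 <= u m by rewrite /u; case: ifP.
transitivity (\prod_(m < M) phi (u m))%:E; last first.
  by congr EFin; apply: eq_bigr => m _; rewrite /u; case: ifP.
rewrite -laplace//; apply: eq_integral => w _; congr EFin; apply: eq_bigr => m _.
by rewrite /u; case: ifP => // _; rewrite mul0r oppr0 expR0.
Qed.

(** To pass from an exponential to an indicator at [i], give [i] an arbitrary integer rate. The
    induction hypothesis for [i :: s2] shows that [T i] has the same transform under the density [W]
    as under the constant [c], and uniqueness applies. *)
Let mixed (A : nat -> set R) (v : nat -> R) (s1 s2 : seq nat) :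
  (forall i, measurable (A i)) -> uniq (s1 ++ s2) -> (forall m, 0 <= v m) ->
  (\int[P]_w (\prod_(i <- s1) `[< A i (T i w) >]%:R * \prod_(i <- s2) expR (- (v i * T i w)))%:E =
   (\prod_(i <- s1) fine (P (T i @^-1` A i)) * \prod_(i <- s2) phi (v i))%:E)%E.
Proof.
move=> mA; have mTA i : measurable (T i @^-1` A i) by apply: measurable_preimageT.
elim: s1 s2 v => [|i s1 IH] s2 v us v0.
  by under eq_integral do rewrite big_nil mul1r; rewrite laplace_seq// big_nil mul1r.
have us2 : uniq (s1 ++ s2) by case/andP: us.
have us' : uniq (s1 ++ i :: s2) by rewrite (perm_uniq (permEl (perm_catCA s1 [:: i] s2))).
have is2 : i \notin s2 by case/andP: us => + _; rewrite mem_cat negb_or => /andP[].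
pose W w := \prod_(i <- s1) `[< A i (T i w) >]%:R * \prod_(i <- s2) expR (- (v i * T i w)).
pose c := \prod_(i <- s1) fine (P (T i @^-1` A i)) * \prod_(i <- s2) phi (v i).
have W0 w : 0 <= W w by rewrite mulr_ge0// prodr_ge0// => j _; exact: expR_ge0.
have c0 : 0 <= c.
  by rewrite mulr_ge0// prodr_ge0// => j _; [exact: fine_ge0|exact: phi_ge0].
have mW : measurable_fun setT W.
  apply: measurable_funM; apply: measurable_prod => j _; last exact: measurable_expRNM.
  exact: (measurable_natr_set (mTA j)).
have WE : (\int[P]_w (W w)%:E = c%:E)%E by exact: IH.
have := @laplace_unique R _ _ P _ _ P W (T i) (fun=> c) (T i) mW (measurable_cst _) (mT i) (mT i)
  W0 (fun=> c0) (T0 i) (T0 i).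
have -> : (\int[P]_w (W w)%:E < +oo)%E by rewrite WE ltry.
have -> : (\int[P]_w c%:E < +oo)%E by rewrite integral_cst//= probability_setT mule1 ltry.
move=> /(_ isT isT) H.
have {H} := H _ (A i) (mA i).
rewrite weighted_law_natr_set weighted_law_cst//.
move=> E; transitivity (\int[P]_w (`[< A i (T i w) >]%:R * W w)%:E)%E.
  by apply: eq_integral => w _; rewrite big_cons mulrA.
rewrite E; first by rewrite big_cons -mulrA -/c [RHS]EFinM fineK ?fin_num_measure// muleC.
move=> n; pose v' j := if j == i then n%:R else v j.
have v'0 j : 0 <= v' j by rewrite /v'; case: ifP.
have v's2 (F : nat -> R -> R) : \prod_(j <- s2) F j (v' j) = \prod_(j <- s2) F j (v j).
  apply: eq_big_seq => j js; rewrite /v' ifF//; apply/negP => /eqP ji.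
  by move: is2; rewrite -ji js.
have v'i : v' i = n%:R by rewrite /v' eqxx.
transitivity (\prod_(j <- s1) fine (P (T j @^-1` A j)) * \prod_(j <- i :: s2) phi (v' j))%:E.
  rewrite -IH//; apply: eq_integral => w _.
  by rewrite big_cons (v's2 (fun j x => expR (- (x * T j w)))) v'i mulrCA.
rewrite big_cons (v's2 (fun _ => phi)) v'i.
have phiE : (\int[P]_w (expR (- (n%:R * T i w)))%:E = (phi n%:R)%:E)%E.
  have := @laplace_seq (fun=> n%:R) [:: i] isT (fun=> ler0n _ _).
  by rewrite big_seq1 => <-; apply: eq_integral => w _; rewrite big_seq1.
under [in RHS]eq_integral do rewrite mulrC EFinM.
rewrite ge0_integralZl_EFin//; last first.
  by apply/measurable_EFinP; exact: measurable_expRNM.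
by rewrite phiE -EFinM mulrCA mulrC.
Qed.

Lemma laplace_mutually_independent : mutually_independent P T.
Proof.
move=> s A us mA; have mTA i : measurable (T i @^-1` A i) by apply: measurable_preimageT.
have := @mixed A (fun=> 0) s [::] mA; rewrite cats0 => /(_ us (fun=> lexx _)).
under eq_integral do rewrite big_nil mulr1.
rewrite big_nil mulr1.
have mbig : measurable (\big[setI/setT]_(i <- s) (T i @^-1` A i)).
  by elim/big_ind: _ => // B C mB mC; exact: measurableI.
rewrite -(integral_natr_set P mbig) => E.
transitivity (\int[P]_w (\prod_(i <- s) `[< A i (T i w) >]%:R)%:E)%E.
  apply: eq_integral => w _; congr EFin; elim: s {us E mbig} => [|i s IH].
    by rewrite !big_nil asboolT.
  rewrite !big_cons -IH -natrM mulnb; congr (_%:R); congr nat_of_bool.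
  by rewrite -asbool_and; apply: asbool_equiv_eq.
rewrite E; elim: s {us E mbig} => [|i s IH]; first by rewrite !big_nil.
by rewrite !big_cons EFinM IH fineK//; exact: fin_num_measure.
Qed.

End laplace_independence.

Theorem corollary4p3 (d : measure_display) (Omega : measurableType d)
    (R : realType) (P : probability Omega R)
    (lambda mu nu : R) (k : nat)
    (Q : R -> Omega -> nat * nat) (sigma : R -> Omega -> R) :
  0 < lambda -> 0 < mu -> (1 <= k)%N -> 0 < nu < 1 ->
  is_erlang_queue P lambda mu k Q ->
  is_stable_subordinator P nu sigma ->
  independent_processes P Q sigma ->
  exists T : nat -> {RV P >-> R},
    [/\ {ae P, forall w,
          are_service_times k (fun t => fractional_queue Q sigma t w)
            (fun m => T m w)},
        mutually_independent P (fun m => T m : Omega -> R) &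
        forall m, is_GE nu k (k%:R * mu) (T m)].
Proof.
move=> lambda0 mu0 k1 /andP[nu0 _] queueQ sub indep.
have [Y [A [mY mAS Apath Ypath law]]] :=
  fractional_jump_chain lambda0 mu0 k1 nu0 queueQ sub indep.
have mA n : measurable_fun setT (A n) by case: (mAS n).
have AS n w : A n w <= A n.+1 w by case: (mAS n).
pose L m n w := service_length k (Y ^~ w) (A ^~ w) m n.
have Lev : {ae P, forall w, forall m, exists N l, forall n, (N <= n)%N -> L m n w = l}.
  by move: Ypath; apply: filterS => w [Sw st us] m; exact: service_length_eventually.
have [G mG [aeG GL]] := ae_measurable_set Lev.
(* Outside [G] the lengths need not stabilise; the value 0 makes [T m] measurable and nonnegative
   everywhere. *)
pose T m w := if w \in G then limn (fun n => L m n w) else 0.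
have cstlim (f : nat -> R) N l : (forall n, (N <= n)%N -> f n = l) -> f n @[n --> \oo] --> l.
  by move=> fl; apply: cvg_near_cst; exists N.
have TG m w : G w -> L m n w @[n --> \oo] --> T m w.
  move=> Gw; have [N [l Nl]] := GL w Gw m; rewrite /T ifT ?inE//.
  by have cl := cstlim _ _ _ Nl; rewrite (cvg_lim _ cl).
have Tlim m w : `[< G w >]%:R * L m n w @[n --> \oo] --> T m w.
  have [Gw|Gw] := pselect (G w).
    by rewrite asboolT//; under eq_fun do rewrite mul1r; exact: TG.
  rewrite asboolF// /T ifN ?notin_setE//.
  by under eq_fun do rewrite mul0r; exact: cvg_cst.
have mL m n : measurable_fun setT (L m n) by exact: measurable_service_length.
have mT m : measurable_fun setT (T m).
  apply: (measurable_fun_cvg (h := fun n w => `[< G w >]%:R * L m n w)) => // n.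
  by apply: measurable_funM => //; exact: measurable_natr_set.
have T0 m w : 0 <= T m w.
  rewrite -(cvg_lim _ (Tlim m w))//; apply: limr_ge.
    by apply/cvg_ex; exists (T m w).
  by apply: nearW => n; rewrite mulr_ge0//; exact: service_length_ge0.
have aeT : {ae P, forall w, forall m, L m n w @[n --> \oo] --> T m w}.
  by move: aeG; apply: filterS => w Gw m; exact: TG.
pose theta := k%:R * mu; have theta0 : 0 < theta by exact: theta_gt0.
pose phi x := (theta / (theta + x `^ nu)) ^+ k.
have joint := joint_laplace lambda0 mu0 k1 nu0 mY mA AS Ypath law aeT mT.
have phi0 : phi 0 = 1.
  by rewrite /phi powR0 ?gt_eqF// addr0 divff ?expr1n// gt_eqF.
have phi_ge0 x : 0 <= x -> 0 <= phi x.
  by move=> _; rewrite exprn_ge0// divr_ge0 ?addr_ge0 ?powR_ge0// ltW.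
have single m v : 0 < v -> (\int[P]_w (expR (- (v * T m w)))%:E = (phi v)%:E)%E.
  (* The marginal transform is the joint one with rate [v] at [m] and rate 0 at the earlier
     services. *)
  move=> v0; pose u i := if i == m then v else 0.
  have prodE (F : nat -> R -> R) : (forall i, F i 0 = 1) -> \prod_(i < m.+1) F i (u i) = F m v.
    move=> F1; rewrite big_ord_recr/= /u eqxx big1 ?mul1r// => i _.
    by rewrite ifF ?F1//; apply/negP => /eqP im; have := ltn_ord i; rewrite im ltnn.
  rewrite -(prodE (fun=> phi))// -joint; last by move=> i; rewrite /u; case: ifP => // _; exact: ltW.
  apply: eq_integral => w _; rewrite (prodE (fun i x => expR (- (x * T i w))))// => i.
  by rewrite mul0r oppr0 expR0.
pose X m : {RV P >-> R} := HB.pack (T m) (isMeasurableFun.Build _ _ _ _ (T m) (mT m)).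
exists X; split.
- move: Apath Ypath aeG; apply: filterS3 => w [A0 Alt Aunb xA] [Sw st us] Gw.
  apply: (are_service_times_trajectory k1 Sw st us A0 Alt Aunb xA) => m.
  have [N [l Nl]] := GL w Gw m; exists N => n Nn.
  rewrite -/(L m n w) Nl//.
  exact: cvg_unique (cstlim _ _ _ Nl) (TG m w Gw).
- exact: (laplace_mutually_independent mT T0 phi0 phi_ge0 joint).
move=> m; apply: laplace_GE => //.
  by move=> w; exact: T0.
by move=> v v0; exact: single.
Qed.
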